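(* Let $n\ge 2$, and let $f\in C^\alpha(\mathbb{S}^n)$ be a positive function, where $\alpha>0$. Extend $f$ to $\mathbb{R}^{n+1}\setminus\{0\}$ so that it is homogeneous of degree $-1$. Let $u$ be a solution of $$\Delta_{\mathbb{S}^n}u+nu=f\quad\text{on }\mathbb{S}^n .$$ Then $u$ is convex if and only if for all $x,\xi\in\mathbb{S}^n$ with $\xi\perp x$, $$\frac{1}{\omega_n}\int_{\mathbb{R}^{n+1}}\frac{|x-y|^2-(n+1)\langle\xi,y\rangle^2}{|x-y|^{n+3}}\Big(f(y)-\frac{f(x)}{|y|}\Big)\,dy+\frac1n f(x)\ \ge\ 0 .$$
   Context: $\omega_n=|\mathbb{S}^n|$ is the surface area of the unit sphere $\mathbb{S}^n\subset\mathbb{R}^{n+1}$, and $\Delta_{\mathbb{S}^n}$ is the Laplace–Beltrami operator on $\mathbb{S}^n$. A solution $u$ is called convex if $\nabla^2u+uI\ge0$ on $\mathbb{S}^n$, where $\nabla$ is the covariant derivative with respect to a local orthonormal frame on $\mathbb{S}^n$; equivalently, the degree-one homogeneous extension of $u$ to $\mathbb{R}^{n+1}$ is a convex function. $C^\alpha(\mathbb{S}^n)$ is the space of Hölder continuous functions with exponent $\alpha$. *)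

(* Defs.v *)
From HB Require Import structures.
From mathcomp Require Import all_boot all_order all_algebra.
From mathcomp Require Import all_classical all_reals all_analysis.

Set Implicit Arguments.
Unset Strict Implicit.
Unset Printing Implicit Defensive.

Import Order.TTheory GRing.Theory Num.Theory.
Import numFieldNormedType.Exports.
Local Open Scope classical_set_scope.
Local Open Scope ring_scope.

(* The norm that the library puts on 'rV[R]_n is the sup norm; it is used here
   only for its topology.  The Euclidean structure is the following one. *)
Definition dotp (R : realType) (n : nat) (x y : 'rV[R]_n) : R :=
  \sum_(i < n) x ord0 i * y ord0 i.

Definition enorm (R : realType) (n : nat) (x : 'rV[R]_n) : R :=
  Num.sqrt (dotp x x).

(* unit_sphere, at type 'rV[R]_n.+1, is the n-dimensional sphere of R^(n+1). *)
Definition unit_sphere (R : realType) (n : nat) : set 'rV[R]_n.+1 :=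
  [set x | enorm x = 1].

Definition sproj (R : realType) (n : nat) (y : 'rV[R]_n) : 'rV[R]_n :=
  (enorm y)^-1 *: y.

(* Functions on the sphere are represented by functions on R^(n+1) of which
   only the values on the sphere are ever used. *)

Definition holder_sphere (R : realType) (n : nat) (alpha : R)
    (f : 'rV[R]_n.+1 -> R) : Prop :=
  exists C : R, forall x y, unit_sphere x -> unit_sphere y ->
    `|f x - f y| <= C * (enorm (x - y)) `^ alpha.

(* Extensions to R^(n+1) \ {0}, homogeneous of degree 0 and -1. *)
Definition ext0 (R : realType) (n : nat) (T : Type) (g : 'rV[R]_n.+1 -> T) :
  'rV[R]_n.+1 -> T := fun y => g (sproj y).

Definition extN1 (R : realType) (n : nat) (f : 'rV[R]_n.+1 -> R) :
  'rV[R]_n.+1 -> R := fun y => (enorm y)^-1 * f (sproj y).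

Definition C1_on (R : realType) (n : nat) (U : set 'rV[R]_n.+1)
    (g : 'rV[R]_n.+1 -> R) : Prop :=
  (forall y, U y -> differentiable g y) /\
  (forall v y, U y -> {for y, continuous ('D_v g)}).

Definition C2_on (R : realType) (n : nat) (U : set 'rV[R]_n.+1)
    (g : 'rV[R]_n.+1 -> R) : Prop :=
  C1_on U g /\ forall v, C1_on U ('D_v g).

Definition C2_sphere (R : realType) (n : nat) (u : 'rV[R]_n.+1 -> R) : Prop :=
  C2_on [set y | y != 0] (ext0 u).

(* Riemannian gradient at a point x of the sphere; it is tangent at x because
   ext0 u is constant along rays. *)
Definition sgrad (R : realType) (n : nat) (u : 'rV[R]_n.+1 -> R)
    (x : 'rV[R]_n.+1) : 'rV[R]_n.+1 :=
  \row_i 'D_(delta_mx ord0 i) (ext0 u) x.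

(* Orthogonal projection v |-> v *m tproj x onto the tangent space x^\perp. *)
Definition tproj (R : realType) (n : nat) (x : 'rV[R]_n.+1) : 'M[R]_n.+1 :=
  1%:M - x^T *m x.

(* The Levi-Civita derivative of a tangent field V at x, in the tangent
   direction xi, is the tangential part of the derivative of V along xi, i.e.
   xi *m 'J (ext0 V) x *m tproj x.  Hence shess u x is the matrix of the
   covariant Hessian (xi, eta) |-> < nabla_xi (grad u), eta > on the tangent
   space, extended by 0 to the normal line spanned by x. *)
Definition shess (R : realType) (n : nat) (u : 'rV[R]_n.+1 -> R)
    (x : 'rV[R]_n.+1) : 'M[R]_n.+1 :=
  tproj x *m jacobian (ext0 (sgrad u)) x *m tproj x.

Definition laplace_beltrami (R : realType) (n : nat) (u : 'rV[R]_n.+1 -> R)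
    (x : 'rV[R]_n.+1) : R := \tr (shess u x).

(* The trace in laplace_beltrami is the sum of the second covariant
   derivatives along any orthonormal frame E (given by rows) of x^\perp. *)
Lemma laplace_beltrami_frame (R : realType) (n : nat) (u : 'rV[R]_n.+1 -> R)
    (x : 'rV[R]_n.+1) (E : 'M[R]_(n, n.+1)) :
  unit_sphere x -> E *m E^T = 1%:M -> E *m x^T = 0 ->
  laplace_beltrami u x = \sum_(k < n) dotp (row k E *m shess u x) (row k E).
Proof.
move=> Sx EE Ex.
have xx : x *m x^T = 1%:M.
  apply/matrixP => i j; rewrite !ord1 !mxE eqxx /=.
  rewrite -[RHS](expr1n _ 2) -Sx /enorm sqr_sqrtr.
    by rewrite /dotp; apply: eq_bigr => k _; rewrite !mxE.
  by apply: sumr_ge0 => k _; rewrite -expr2 sqr_ge0.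
have xE : x *m E^T = 0.
  by rewrite -[LHS]trmxK trmx_mul trmxK Ex trmx0.
have : (col_mx x E : 'M[R]_(1 + n, 1 + n)) *m (col_mx x E : 'M[R]_(1 + n, 1 + n))^T = 1%:M.
  by rewrite tr_col_mx mul_col_row xx EE Ex xE -scalar_mx_block.
move/mulmx1C; rewrite tr_col_mx mul_row_col => xEE.
have EP : E^T *m E = tproj x by rewrite /tproj -xEE addrAC subrr add0r.
have PP : tproj x *m tproj x = tproj x.
  by rewrite -EP mulmxA -(mulmxA _ E) EE mulmx1.
transitivity (\tr (E *m shess u x *m E^T)).
  by rewrite /laplace_beltrami [RHS]mxtrace_mulC mulmxA EP /shess !mulmxA PP.
apply: eq_bigr => k _; rewrite -row_mul mxE /dotp.
by apply: eq_bigr => j _; rewrite !mxE.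
Qed.

(* nabla^2 u + u I >= 0 on every tangent space. *)
Definition sphere_convex (R : realType) (n : nat) (u : 'rV[R]_n.+1 -> R) :
    Prop :=
  forall x xi : 'rV[R]_n.+1, unit_sphere x -> dotp xi x = 0 ->
    0 <= dotp (xi *m shess u x) xi + u x * dotp xi xi.

(* Lebesgue measure on R^n.  The product sigma-algebra of the library lives on
   n.-tuple R, and the measure is built by iterating the binary product. *)

Definition tcons (R : realType) (n : nat)
    (p : measurableTypeR R * n.-tuple (measurableTypeR R)) :
  n.+1.-tuple (measurableTypeR R) := [tuple of p.1 :: p.2].

Lemma measurable_tcons (R : realType) (n : nat) :
  measurable_fun setT (@tcons R n).
Proof. exact: measurable_cons. Qed.

Section lebesgue_step.
Context (R : realType) (n : nat).
Variable mu : {sigma_finite_measure set (n.-tuple (measurableTypeR R)) -> \bar R}.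

Definition lebesgue_step : set (n.+1.-tuple (measurableTypeR R)) -> \bar R :=
  pushforward (@lebesgue_measure R \x mu)%E (@tcons R n).

Let step0 : lebesgue_step set0 = 0%E.
Proof. by rewrite /lebesgue_step /pushforward preimage_set0 measure0. Qed.

Let step_ge0 A : (0 <= lebesgue_step A)%E.
Proof. by apply: integral_ge0. Qed.

Let step_sigma_additive : semi_sigma_additive lebesgue_step.
Proof.
pose m : {measure set _ -> \bar R} := (@lebesgue_measure R \x mu)%E.
have m_ := @measure_semi_sigma_additive _ _ _ m.
move=> F mF tF mUF; rewrite /lebesgue_step /pushforward preimage_bigcup.
apply: m_.
- by move=> k; rewrite -[X in measurable X]setTI; exact: measurable_tcons.
- apply/trivIsetP => /= i j _ _ ij; rewrite -preimage_setI.
  by move/trivIsetP : tF => /(_ _ _ _ _ ij) ->//; rewrite preimage_set0.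
- by rewrite -preimage_bigcup -[X in measurable X]setTI; exact: measurable_tcons.
Qed.

HB.instance Definition _ := isMeasure.Build _ _ _ lebesgue_step
  step0 step_ge0 step_sigma_additive.

Let step_sigma_finite : sigma_finite setT lebesgue_step.
Proof.
pose leb : {sigma_finite_measure set (measurableTypeR R) -> \bar R} :=
  @lebesgue_measure R.
have /sigma_finiteP[F [TF ndF Foo]] := sigma_finiteT leb.
have /sigma_finiteP[G [TG ndG Goo]] := sigma_finiteT mu.
pose g (t : n.+1.-tuple (measurableTypeR R)) :
  measurableTypeR R * n.-tuple (measurableTypeR R) :=
  (thead t, [tuple of behead t]).
have mg : measurable_fun setT g.
  apply: measurable_fun_pair; [exact: measurable_tnth|exact: measurable_behead].
have gK : cancel (@tcons R n) g.
  by case=> a b; rewrite /g /tcons /= theadE; congr pair; apply: val_inj.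
exists (fun k => g @^-1` (F k `*` G k)).
  rewrite -preimage_bigcup; apply/esym/seteqP; split => // t _.
  have [i _ Fi] : (\bigcup_k F k) (g t).1 by rewrite -TF.
  have [j _ Gj] : (\bigcup_k G k) (g t).2 by rewrite -TG.
  exists (maxn i j) => //; split.
    by move: Fi; exact/subsetPset/ndF/leq_maxl.
  by move: Gj; exact/subsetPset/ndG/leq_maxr.
move=> k; have [mF Fk] := Foo k; have [mG Gk] := Goo k; split.
  by rewrite -[X in measurable X]setTI; apply: mg => //; exact: measurableX.
rewrite /lebesgue_step /pushforward -comp_preimage.
rewrite (_ : g \o _ = id); last by apply/funext => p /=; rewrite gK.
rewrite preimage_id -[(_ \x _)%E]/(leb \x mu)%E product_measure1E//.
by rewrite lte_mul_pinfty// ge0_fin_numE.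
Qed.

HB.instance Definition _ := Measure_isSigmaFinite.Build _ _ _ lebesgue_step
  step_sigma_finite.

End lebesgue_step.

Fixpoint lebesgue_tuple (R : realType) (n : nat) :
    {sigma_finite_measure set (n.-tuple (measurableTypeR R)) -> \bar R} :=
  match n with
  | 0 => dirac [tuple]
  | m.+1 => lebesgue_step (lebesgue_tuple R m)
  end.

Lemma lebesgue_tuple_box (R : realType) (n : nat)
    (A : 'I_n -> set (measurableTypeR R)) :
  (forall i, measurable (A i)) ->
  lebesgue_tuple R n [set t | forall i, A i (tnth t i)] =
  (\prod_(i < n) lebesgue_measure (A i))%E.
Proof.
elim: n A => [|n IH] A mA /=.
  rewrite big_ord0 diracE mem_set//; by case.
rewrite big_ord_recl -(IH (fun i => A (lift ord0 i))) //.
rewrite /lebesgue_step /pushforward -product_measure1E //.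
  have tE (a : measurableTypeR R) (t : n.-tuple (measurableTypeR R)) i :
      tnth (tcons (a, t)) (lift ord0 i) = tnth t i.
    by rewrite tnthS; congr tnth; apply: val_inj.
  congr (_ _); apply/seteqP; split => -[a t] /=.
    move=> H; split; first exact: (H ord0).
    by move=> i; have := H (lift ord0 i); rewrite tE.
  by move=> [Ha Ht] i; case: (unliftP ord0 i) => [j ->|-> //]; rewrite tE.
rewrite [X in measurable X](_ : _ = \bigcap_(i in [set: 'I_n])
    ((fun t => tnth t i) @^-1` A (lift ord0 i))); last first.
  by apply/seteqP; split => t /= H i; [move=> _; exact: H|exact: (H i I)].
apply: fin_bigcap_measurable => [|i _]; first exact: finite_finset.
by rewrite -[X in measurable X]setTI; exact: measurable_tnth.
Qed.

Definition rV_of_tuple (R : realType) (n : nat)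
  (t : n.-tuple (measurableTypeR R)) : 'rV[R]_n := \row_i tnth t i.

Definition integral_rV (R : realType) (n : nat) (g : 'rV[R]_n -> R) : R :=
  \int[lebesgue_tuple R n]_t g (rV_of_tuple t).

Definition unit_cone (R : realType) (n : nat) (A : set 'rV[R]_n.+1) :
    set 'rV[R]_n.+1 :=
  [set y | 0 < enorm y <= 1 /\ A (sproj y)].

(* Surface measure of a part A of the n-dimensional unit sphere: n + 1 times
   the volume of the cone over A. *)
Definition sphere_area (R : realType) (n : nat) (A : set 'rV[R]_n.+1) :
    \bar R :=
  ((n.+1)%:R%:E *
   lebesgue_tuple R n.+1 (@rV_of_tuple R n.+1 @^-1` unit_cone A))%E.

Definition omega (R : realType) (n : nat) : R :=
  fine (sphere_area (@unit_sphere R n)).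

(* Main.v *)
(* Let N = n + 1, c = f x / n and V y = |y| (u (y / |y|) - c).  On the unit sphere
   the Hessian of V vanishes on the radial direction and is nabla^2 u + (u - c) I
   on the tangent space; hence the Laplacian of V at y is (f (y / |y|) - f x) / |y|,
   the factor that multiplies the kernel in the integral.  Let P_e be a potential
   with gradient z / (|z|^2 + e^2)^(N/2).  Two integrations by parts show that the
   integral of (D_xi D_xi P_e)(y - x) (Laplacian V)(y) is that of
   (Laplacian P_e)(y - x) (D_xi D_xi V)(y).  As e tends to 0, Laplacian P_e is omega_n
   times an approximate identity, while the first integral converges, by
   dominated convergence, to the integral of the statement: by the Hoelder
   condition the Laplacian of V is O(|y - x|^a) at x.  Therefore the whole
   left-hand side of the inequality equals nabla^2 u (xi, xi) + u at x. *)

Require Import Defs.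
From HB Require Import structures.
From mathcomp Require Import all_boot all_order all_algebra.
From mathcomp Require Import all_classical all_reals all_analysis.
From mathcomp Require Import measurable_realfun ring lra.

Set Implicit Arguments.
Unset Strict Implicit.
Unset Printing Implicit Defensive.

Import Order.TTheory GRing.Theory Num.Theory.
Import numFieldNormedType.Exports.
Local Open Scope classical_set_scope.
Local Open Scope ring_scope.

(** The shift by c makes the Laplacian of V vanish at x; otherwise its product with a kernel of
    order -N would not be absolutely integrable there. The kernel alone is not integrable at x, so
    derivatives are exchanged for e > 0 only. All integration is Cartesian. A derivative along an
    axis is integrated over the lines of that direction, where the fundamental theorem of calculus
    and decay at infinity give 0. As N > 1, almost every such line misses the origin, the only point
    where V may fail to be smooth. The majorants [wgt] have a power singularity and a matching
    decay, and lie below products of one-variable functions with explicit primitives. The constant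
    omega_n enters as N times the volume of the unit ball, the form in which [omega] is defined. The
    field z / (|z|^2 + e^2)^(N/2) is compared with the field equal to z in the unit ball and to z /
    |z|^N outside, whose divergence is N in the ball and 0 outside; their difference decays fast
    enough for its divergence to have integral 0. *)

(** * Fubini, translations and coordinate lines for the iterated Lebesgue measure *)

Section lebesgue_tuple_fubini.
Local Open Scope ereal_scope.
Context (R : realType).
Let leb : {sigma_finite_measure set (measurableTypeR R) -> \bar R} :=
  @lebesgue_measure R.

Lemma ge0_integral_lebesgue_tupleS n (f : n.+1.-tuple (measurableTypeR R) -> \bar R) :
  measurable_fun setT f -> (forall t, 0 <= f t) ->
  \int[lebesgue_tuple R n.+1]_t f t =
  \int[leb]_a \int[lebesgue_tuple R n]_t f (tcons (a, t)).
Proof.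
move=> mf f0.
transitivity (\int[pushforward (leb \x lebesgue_tuple R n) (@tcons R n)]_t f t) => //.
rewrite (ge0_integral_pushforward (@measurable_tcons R n))//.
rewrite preimage_setT fubini_tonelli1//; last by move=> p; exact: f0.
by apply: (measurableT_comp mf); exact: measurable_tcons.
Qed.

Lemma integrable_tcons n (f : n.+1.-tuple (measurableTypeR R) -> \bar R) :
  (lebesgue_tuple R n.+1).-integrable setT f ->
  (leb \x lebesgue_tuple R n).-integrable setT (f \o @tcons R n).
Proof.
move=> /integrableP[mf foo].
have mft : measurable_fun setT (f \o @tcons R n).
  by apply: measurableT_comp => //; exact: measurable_tcons.
apply/integrable12ltyP => //.
rewrite -(@ge0_integral_lebesgue_tupleS _ (fun t => `|f t|))//.
exact: measurableT_comp.
Qed.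

Lemma integral_lebesgue_tupleS n (f : n.+1.-tuple (measurableTypeR R) -> \bar R) :
  (lebesgue_tuple R n.+1).-integrable setT f ->
  \int[lebesgue_tuple R n.+1]_t f t =
  \int[leb]_a \int[lebesgue_tuple R n]_t f (tcons (a, t)).
Proof.
move=> fi; have fi' := integrable_tcons fi.
transitivity (\int[pushforward (leb \x lebesgue_tuple R n) (@tcons R n)]_t f t) => //.
rewrite (integral_pushforward (@measurable_tcons R n))//; last exact: measurable_int fi.
by rewrite preimage_setT -integral12_prod_meas1.
Qed.

Lemma integral_lebesgue_tupleS2 n (f : n.+1.-tuple (measurableTypeR R) -> \bar R) :
  (lebesgue_tuple R n.+1).-integrable setT f ->
  \int[lebesgue_tuple R n.+1]_t f t =
  \int[lebesgue_tuple R n]_t \int[leb]_a f (tcons (a, t)).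
Proof.
move=> fi; rewrite integral_lebesgue_tupleS//.
by rewrite (Fubini (integrable_tcons fi)).
Qed.

Lemma lebesgue_measure_shift (c : R) (A : set (measurableTypeR R)) :
  measurable A -> leb ((fun t => t + c)%R @^-1` A) = leb A.
Proof.
move=> mA.
have mc : measurable_fun setT (fun t : measurableTypeR R => (t + c)%R : measurableTypeR R).
  exact: measurable_funD.
transitivity (pushforward leb (fun t : measurableTypeR R => (t + c)%R : measurableTypeR R) A) => //.
apply/esym/lebesgue_measure_unique => //.
move=> _ [[a b]] _ <-; rewrite /= /pushforward.
rewrite [X in _ = lebesgue_measure X](_ : _ = `](a - c)%R, (b - c)%R]%classic); last first.
  apply/seteqP; split => x /=; rewrite !in_itv/= => /andP[? ?]; apply/andP; split; lra.
rewrite !lebesgue_measure_itv/= !lte_fin ltrD2r.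
by case: ifP => // _; rewrite -!EFinD; congr EFin; lra.
Qed.

Lemma ge0_integral_shift (c : R) (f : measurableTypeR R -> \bar R) :
  measurable_fun setT f -> (forall t, 0 <= f t) ->
  \int[leb]_t f (t + c)%R = \int[leb]_t f t.
Proof.
move=> mf f0.
have mc : measurable_fun setT (fun t : measurableTypeR R => (t + c)%R : measurableTypeR R).
  exact: measurable_funD.
transitivity (\int[pushforward leb (fun t : measurableTypeR R => (t + c)%R : measurableTypeR R)]_t f t).
  by rewrite (ge0_integral_pushforward mc)// preimage_setT.
by apply: eq_measure_integral => A mA _; exact: lebesgue_measure_shift.
Qed.

Lemma tnth_tcons0 n (p : measurableTypeR R * n.-tuple (measurableTypeR R)) :
  tnth (tcons p) ord0 = p.1.
Proof. by rewrite (tnth_nth 0%R). Qed.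

Lemma tnth_tconsS n (p : measurableTypeR R * n.-tuple (measurableTypeR R)) (i : 'I_n) :
  tnth (tcons p) (lift ord0 i) = tnth p.2 i.
Proof. by rewrite tnthS; congr tnth; apply: val_inj. Qed.

Definition tshift n (c : 'I_n -> R) (t : n.-tuple (measurableTypeR R)) :
  n.-tuple (measurableTypeR R) := [tuple (tnth t i + c i)%R | i < n].

Lemma measurable_tshift n (c : 'I_n -> R) : measurable_fun setT (@tshift n c).
Proof.
apply/measurable_fun_tnthP => i.
rewrite (_ : _ \o _ = fun t => (tnth t i + c i)%R); last first.
  by apply/funext => t /=; rewrite tnth_mktuple.
by apply: measurable_funD => //; exact: measurable_tnth.
Qed.

Lemma tshift_tcons n (c : 'I_n.+1 -> R) (p : measurableTypeR R * n.-tuple (measurableTypeR R)) :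
  tshift c (tcons p) = tcons (p.1 + c ord0, tshift (c \o lift ord0) p.2)%R.
Proof.
apply: eq_from_tnth => i; rewrite tnth_mktuple.
case: (unliftP ord0 i) => [j ->|->]; last by rewrite !tnth_tcons0.
by rewrite !tnth_tconsS tnth_mktuple.
Qed.

Lemma ge0_integral_tshift n (c : 'I_n -> R) (f : n.-tuple (measurableTypeR R) -> \bar R) :
  measurable_fun setT f -> (forall t, 0 <= f t) ->
  \int[lebesgue_tuple R n]_t f (tshift c t) = \int[lebesgue_tuple R n]_t f t.
Proof.
elim: n c f => [|n IH] c f mf f0.
  by apply: eq_integral => t _; congr f; rewrite tuple0 [RHS]tuple0.
have mfa a : measurable_fun setT (fun t : n.-tuple (measurableTypeR R) => f (tcons (a, t))).
  apply: measurableT_comp => //.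
  exact: (measurableT_comp (@measurable_tcons R n) (pair1_measurable _)).
rewrite ge0_integral_lebesgue_tupleS//; last first.
  by apply: measurableT_comp => //; exact: measurable_tshift.
transitivity (\int[leb]_a \int[lebesgue_tuple R n]_t f (tcons ((a + c ord0)%R, t))).
  apply: eq_integral => a _.
  under eq_integral do rewrite tshift_tcons /=.
  by rewrite (IH _ (fun t => f (tcons ((a + c ord0)%R, t)))).
rewrite [RHS](ge0_integral_lebesgue_tupleS mf f0).
apply: (ge0_integral_shift (c ord0) (f := fun a => \int[lebesgue_tuple R n]_t f (tcons (a, t)))).
  apply: (measurable_fun_fubini_tonelli_F (f \o @tcons R n)) => //.
  + by apply: (measurableT_comp mf); exact: measurable_tcons.
  + by move=> p; exact: f0.
by move=> t; apply: integral_ge0 => x _; exact: f0.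
Qed.

Lemma ge0_integral_lebesgue_tuple_prod n (w : 'I_n -> measurableTypeR R -> \bar R) :
  (forall i, measurable_fun setT (w i)) -> (forall i t, 0 <= w i t) ->
  \int[lebesgue_tuple R n]_t (\prod_(i < n) w i (tnth t i)) =
  \prod_(i < n) \int[leb]_t w i t.
Proof.
have mprod m (v : 'I_m -> measurableTypeR R -> \bar R) :
    (forall i, measurable_fun setT (v i)) ->
    measurable_fun setT (fun t : m.-tuple (measurableTypeR R) => \prod_(i < m) v i (tnth t i)).
  move=> mv; elim: (index_enum _) => [|i s IHs].
    by under eq_fun do rewrite big_nil; exact: measurable_cst.
  under eq_fun do rewrite big_cons; apply: emeasurable_funM => //.
  by apply: measurableT_comp => //; exact: measurable_tnth.
elim: n w => [|n IH] w mw w0.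
  under eq_integral do rewrite big_ord0.
  by rewrite big_ord0 integral_dirac// ?diracT ?mul1e//; exact: measurable_cst.
rewrite ge0_integral_lebesgue_tupleS//; [|exact: mprod|by move=> t; apply: prode_ge0 => *; exact: w0].
rewrite big_ord_recl -(IH (w \o lift ord0))//=; try by move=> *; exact: mw.
rewrite -ge0_integralZr//; last by apply: integral_ge0 => *; apply: prode_ge0 => *; exact: w0.
apply: eq_integral => a _.
rewrite -ge0_integralZl//; first last.
- by move=> *; apply: prode_ge0 => *; exact: w0.
- by apply: (mprod n (fun i => w (lift ord0 i))) => *; exact: mw.
apply: eq_integral => t _; rewrite big_ord_recl /=; congr (_ * _).
by apply: eq_bigr => i _; rewrite tnth_tconsS.
Qed.

(** The hyperplane is a box with one side [[set c]] and every other side the whole line; its volume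
    is 0 because 0 times +oo is 0 in [\bar R]. *)
Lemma coord0_negligible n (k : 'I_n) (c : R) :
  (lebesgue_tuple R n).-negligible [set t | tnth t k = c].
Proof.
pose A i : set (measurableTypeR R) := if i == k then [set c] else setT.
have mA i : measurable (A i) by rewrite /A; case: ifP => // _; exact: measurable_set1.
have -> : [set t : n.-tuple (measurableTypeR R) | tnth t k = c] =
    [set t | forall i, A i (tnth t i)].
  apply/seteqP; split => t /=; rewrite /A.
    by move=> tk i; case: eqP => // ->.
  by move=> /(_ k); rewrite eqxx.
apply/negligibleP.
  rewrite [X in measurable X](_ : _ = \bigcap_(i in [set: 'I_n])
    ((fun t => tnth t i) @^-1` A i)); last first.
    by apply/seteqP; split => t /= H i; [move=> _; exact: H|exact: (H i I)].
  apply: fin_bigcap_measurable => [|i _]; first exact: finite_finset.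
  by rewrite -[X in measurable X]setTI; exact: measurable_tnth.
transitivity (\prod_(i < n) lebesgue_measure (A i)).
  exact: lebesgue_tuple_box.
rewrite (bigD1 k)//= /A eqxx.
by rewrite lebesgue_measure_set1 mul0e.
Qed.

Lemma ae_coords_neq0 n (P : pred 'I_n) :
  {ae lebesgue_tuple R n, forall t, forall i, P i -> tnth t i != 0%R}.
Proof.
change ((lebesgue_tuple R n).-negligible
  (~` [set t | forall i, P i -> tnth t i != 0%R])).
have H : (lebesgue_tuple R n).-negligible
    (\big[setU/set0]_(i < n) [set t | tnth t i = 0%R]).
  by elim/big_ind : _ => [|A B ? ?|i _];
    [exact: negligible_set0|exact: negligibleU|exact: coord0_negligible].
apply: negligibleS H => t /= /existsNP[i /not_implyP[_ /negP/negPn/eqP ti]].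
by rewrite (bigD1 i)//=; left.
Qed.

(** The line through [t] parallel to the axis [k], parametrized by its coordinate [a]. *)
Definition tset n (k : 'I_n) (a : R) (t : n.-tuple (measurableTypeR R)) :
  n.-tuple (measurableTypeR R) := [tuple if i == k then a else tnth t i | i < n].

Lemma tset_tcons0 n (a b : R) (t : n.-tuple (measurableTypeR R)) :
  tset ord0 a (tcons (b, t)) = tcons (a, t).
Proof.
apply: eq_from_tnth => i; rewrite tnth_mktuple.
by case: (unliftP ord0 i) => [j ->|->]; rewrite ?tnth_tcons0// !tnth_tconsS.
Qed.

Lemma tset_tconsS n (k : 'I_n) (a b : R) (t : n.-tuple (measurableTypeR R)) :
  tset (lift ord0 k) a (tcons (b, t)) = tcons (b, tset k a t).
Proof.
apply: eq_from_tnth => i; rewrite tnth_mktuple.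
case: (unliftP ord0 i) => [j ->|->]; rewrite ?tnth_tcons0// !tnth_tconsS tnth_mktuple.
by rewrite (inj_eq lift_inj).
Qed.

(** Fubini with the coordinate [k] innermost. The hypothesis concerns only lines whose other
    coordinates are all nonzero, so that in dimension at least 2 a singularity at the origin is
    never met, and only lines on which [h] is integrable, since Fubini grants this for almost all
    lines only. *)
Lemma integral_lines_eq0 n (k : 'I_n) (h : n.-tuple (measurableTypeR R) -> \bar R) :
  (lebesgue_tuple R n).-integrable setT h ->
  (forall y, (forall i, i != k -> tnth y i != 0%R) ->
    leb.-integrable setT (fun a => h (tset k a y)) ->
    \int[leb]_a h (tset k a y) = 0) ->
  \int[lebesgue_tuple R n]_t h t = 0.
Proof.
elim: n k h => [[]//|n IH] k h hi hl.
have hi2 := integrable_tcons hi.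
case: (unliftP ord0 k) hl => [j ->|->] hl.
  rewrite integral_lebesgue_tupleS//.
  transitivity (\int[leb]_a 0 : \bar R); last by rewrite integral0.
  apply: ae_eq_integral => //.
  - exact: (measurable_fubini_F hi2).
  - have a0 : {ae leb, forall a, a != 0%R}.
      exists [set 0%R]; split; [exact: measurable_set1|exact: lebesgue_measure_set1|].
      by move=> a /= /negP/negPn/eqP.
    apply: (@filterS2 _ _ (ae_filter_ringOfSetsType leb) _ _ _ _ a0 (ae_integrable1 hi2)) => a an0 hai _ /=.
    apply: (IH j) => // y yn0 hyi.
    have E b : h (tset (lift ord0 j) b (tcons (a, y))) = h (tcons (a, tset j b y)).
      by rewrite tset_tconsS.
    under eq_integral do rewrite -E.
    apply: hl; last by under eq_fun do rewrite E.
    move=> i; case: (unliftP ord0 i) => [l ->|->]; last by rewrite tnth_tcons0.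
    by rewrite tnth_tconsS (inj_eq lift_inj); exact: yn0.
rewrite integral_lebesgue_tupleS2//.
transitivity (\int[lebesgue_tuple R n]_t 0 : \bar R); last by rewrite integral0.
apply: ae_eq_integral => //.
- exact: (measurable_fubini_G hi2).
- apply: (@filterS2 _ _ (ae_filter_ringOfSetsType (lebesgue_tuple R n)) _ _ _ _
  (ae_coords_neq0 predT) (ae_integrable2 hi2)) => t tn0 hti _ /=.
  (* The head 0 is a placeholder, overwritten by [tset ord0]. *)
  have E b : h (tset ord0 b (tcons (0%R, t))) = h (tcons (b, t)).
    by rewrite tset_tcons0.
  under eq_integral do rewrite -E.
  apply: hl; last by under eq_fun do rewrite E.
  move=> i; case: (unliftP ord0 i) => [l ->|->]; last by rewrite eqxx.
  by rewrite tnth_tconsS => _; exact: tn0.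
Qed.

End lebesgue_tuple_fubini.

(** * Integrals over the line, an integrable weight, and measurability *)

Section real_line.
Context (R : realType).
Let leb : {sigma_finite_measure set (measurableTypeR R) -> \bar R} :=
  @lebesgue_measure R.

Lemma integral_itv_is_derive (F f : R -> R) (a b : R) : a <= b ->
  (forall x, a <= x <= b -> is_derive x 1 F (f x)) ->
  (forall x, a <= x <= b -> {for x, continuous f}) ->
  (\int[leb]_(x in `[a, b]) (f x)%:E = (F b - F a)%:E)%E.
Proof.
rewrite le_eqVlt => /predU1P[->|ab] dF cf.
  by rewrite subrr set_itv1 integral_set1.
have cF x : a <= x <= b -> {for x, continuous F}.
  move=> /dF [+ _]; exact: (fun d => differentiable_continuous ((derivable1_diffP _ _).1 d)).
rewrite EFinB; apply: continuous_FTC2 => //.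
- by apply: continuous_in_subspaceT => x /[!inE] /=; rewrite in_itv; exact: cf.
- split.
  + by move=> x /[!in_itv] /= /andP[/ltW ax /ltW xb]; have [|] := dF x; first by rewrite ax.
  + by apply: cvg_at_right_filter; apply: cF; rewrite lexx ltW.
  + by apply: cvg_at_left_filter; apply: cF; rewrite lexx ltW.
- move=> x /[!in_itv] /= /andP[/ltW ax /ltW xb]; rewrite derive1E.
  by have [|_] := dF x; first by rewrite ax.
Qed.

Lemma integral_symitv_cvg (f : R -> R) : leb.-integrable setT (EFin \o f) ->
  (\int[leb]_(x in `[(- m%:R)%R, (m%:R)%R]) (f x)%:E @[m --> \oo] --> \int[leb]_x (f x)%:E)%E.
Proof.
move=> fi; have mf := measurable_int _ fi.
under eq_cvg do rewrite integral_mkcond.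
have [] // := @dominated_convergence _ _ _ leb setT measurableT
  (fun m => (EFin \o f) \_ `[- m%:R, m%:R]) (EFin \o f) (fun x => `|(f x)%:E|%E).
- by move=> m; apply/(measurable_restrictT _ _).1 => //; exact: measurable_funTS.
- apply: aeW => x _; apply: cvg_near_cst.
  exists (Num.trunc `|x|).+1 => // m /= mx.
  rewrite patchE mem_set//= in_itv/= -ler_norml ltW//.
  by rewrite (lt_le_trans (truncnS_gt _))// ler_nat.
- exact: integrable_abse.
- by apply: aeW => x m _ /=; rewrite patchE; case: ifPn => //; rewrite abse0.
Qed.

(** [Phi] is tied to [f] through integrals over symmetric intervals and not by differentiation, so
    that it may also be a primitive glued from pieces at points where [f] jumps. *)
Lemma integral_eq0_primitive (f Phi : R -> R) : leb.-integrable setT (EFin \o f) ->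
  (\forall m \near \oo,
    (\int[leb]_(x in `[(- m%:R)%R, (m%:R)%R]) (f x)%:E = (Phi m%:R - Phi (- m%:R))%:E)%E) ->
  Phi m%:R @[m --> \oo] --> 0 -> Phi (- m%:R) @[m --> \oo] --> 0 ->
  (\int[leb]_x (f x)%:E = 0)%E.
Proof.
move=> fi fPhi P1 P2; have /cvg_lim <- // := integral_symitv_cvg fi.
apply/cvg_lim => //; apply: (@cvg_trans _ ((Phi m%:R - Phi (- m%:R))%:E @[m --> \oo])).
  by apply: near_eq_cvg; apply: filterS fPhi => m ->.
by apply: cvg_EFin; [exact: nearW|rewrite -(subrr 0); exact: cvgB].
Qed.

(* [singw p t] is comparable to [|t| `^ (p - 1) / (1 + |t|)]; it is chosen as the
   derivative of an explicit bounded function (up to a constant factor). *)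
Definition singw (p t : R) : R := `|t| `^ (p - 1) * (1 + `|t| `^ p) `^ (- p^-1).

Lemma singw_ge0 p t : 0 <= singw p t.
Proof. by rewrite mulr_ge0// powR_ge0. Qed.

Lemma measurable_singw p : measurable_fun [set: measurableTypeR R] (singw p : measurableTypeR R -> R).
Proof.
apply: measurable_funM.
  exact: (measurableT_comp (@measurable_powR R _) (@normr_measurable R setT)).
apply: (measurableT_comp (@measurable_powR R _)).
apply: measurable_funD; first exact: measurable_cst.
exact: (measurableT_comp (@measurable_powR R _) (@normr_measurable R setT)).
Qed.

Lemma is_derive_powR_comp (g : R -> R) (x dg p : R) : 0 < g x ->
  is_derive x 1 g dg ->
  is_derive x 1 (fun t => g t `^ p) (p * g x `^ (p - 1) * dg).
Proof.
by move=> gx dgx; apply: (@is_derive1_comp _ (fun s => s `^ p) g); exact: is_derive1_powR.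
Qed.

(** As 1 - 1/p < 0, this primitive increases from -1 at 0 to 0 at infinity: the mass of [singw p] on
    the half-line is 1/(1 - p). *)
Lemma is_derive_singw (p x : R) : 0 < p < 1 -> 0 < x ->
  is_derive x 1 (fun t : R => - (1 + t `^ p) `^ (1 - p^-1)) ((1 - p) * singw p x).
Proof.
move=> /andP[p0 p1] x0.
have d1 : is_derive x 1 (fun t : R => 1 + t `^ p) (p * x `^ (p - 1)).
  exact: (is_derive_eq (is_deriveD (is_derive_cst (1 : R) x 1) (is_derive1_powR p x0)) (add0r _)).
have g0 : 0 < 1 + x `^ p by rewrite addr_gt0// powR_gt0.
refine (is_derive_eq (is_deriveN (@is_derive_powR_comp (fun t => 1 + t `^ p) x _ (1 - p^-1) g0 d1)) _).
rewrite /singw gtr0_norm//.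
rewrite (_ : 1 - p^-1 - 1 = - p^-1); last by lra.
by field; rewrite gt_eqF.
Qed.

Lemma continuous_singw (p x : R) : 0 < x -> {for x, continuous (singw p)}.
Proof.
move=> x0.
have c q : {for x, continuous (fun t : R => `|t| `^ q)}.
  apply: (@continuous_comp _ _ _ (fun t : R => `|t|) (fun t => t `^ q)).
    exact: norm_continuous.
  apply/differentiable_continuous/derivable1_diffP.
  by apply: derivable_powR; rewrite in_itv/= andbT normr_gt0 gt_eqF.
apply: continuousM; first exact: c.
apply: (@continuous_comp _ _ _ (fun t : R => 1 + `|t| `^ p) (fun t => t `^ (- p^-1))).
  by apply: continuousD; [exact: cst_continuous|exact: c].
apply/differentiable_continuous/derivable1_diffP.
by apply: derivable_powR; rewrite in_itv/= andbT ltr_wpDr// powR_ge0.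
Qed.

Lemma integral_singw_pos (p : R) : 0 < p < 1 ->
  (\int[leb]_(t in `]0%R, +oo[) (singw p t)%:E <= ((1 - p)^-1)%:E)%E.
Proof.
move=> /[dup] p01 /andP[p0 p1].
(* The integral is improper at both ends; on these compact intervals [singw p] is continuous. *)
pose F (m : nat) := `[(m.+1%:R)^-1, m.+1%:R : R]%classic.
have FE : `]0, +oo[%classic = \bigcup_m F m.
  apply/seteqP; split => [x /=|x [m _]]; rewrite /F /= in_itv/= ?andbT.
    move=> x0; exists (maxn (Num.trunc x) (Num.trunc x^-1)) => //=; rewrite in_itv/=.
    apply/andP; split.
      rewrite -[leRHS]invrK lef_pV2 ?posrE ?invr_gt0// ltW//.
      by rewrite (lt_le_trans (truncnS_gt _))// ler_nat ltnS leq_maxr.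
    by rewrite ltW// (lt_le_trans (truncnS_gt _))// ler_nat ltnS leq_maxl.
  by move=> /andP[+ _]; rewrite in_itv/= andbT; apply: lt_le_trans; rewrite invr_gt0.
have nF : nondecreasing_seq F.
  move=> m k mk; apply/subsetPset => x; rewrite /F /= !in_itv/= => /andP[h1 h2].
  rewrite (le_trans _ h1) ?(le_trans h2)// ?ler_nat ?ltnS//.
  by rewrite lef_pV2 ?posrE// ler_nat.
have c : (\int[leb]_(x in F i) (singw p x)%:E @[i --> \oo] -->
    \int[leb]_(x in \bigcup_i F i) (singw p x)%:E)%E.
  apply: (@ge0_nondecreasing_set_cvg_integral _ (measurableTypeR R)) => //.
  - by move=> i; exact: measurable_itv.
  - move=> i; apply: measurable_funTS; apply/measurable_EFinP; exact: measurable_singw.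
  - by move=> i x _; rewrite lee_fin singw_ge0.
rewrite FE -(cvg_lim _ c)//; apply: lime_le; first by apply/cvg_ex; eexists; exact: c.
apply: nearW => m.
have p1' : 1 - p != 0 by rewrite gt_eqF// subr_gt0.
have m1 : (m.+1%:R : R)^-1 <= m.+1%:R.
  by rewrite (@le_trans _ _ 1)// ?invf_le1// ?ler1n//.
have m0 (x : R) : m.+1%:R^-1 <= x <= m.+1%:R -> 0 < x.
  by move=> /andP[+ _]; apply: lt_le_trans; rewrite invr_gt0.
pose G t : R := (1 - p)^-1 *: - (1 + t `^ p) `^ (1 - p^-1).
have -> : (\int[leb]_(x in F m) (singw p x)%:E = (G m.+1%:R - G m.+1%:R^-1)%:E)%E.
  apply: integral_itv_is_derive => [|x /m0 x0|x /m0 x0]; [exact: m1| |exact: continuous_singw].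
  refine (is_derive_eq (is_deriveZ (1 - p)^-1 (is_derive_singw p01 x0)) _).
  by rewrite /GRing.scale/= mulrA mulVf// mul1r.
rewrite lee_fin /G /GRing.scale/= -mulrBr -[leRHS]mulr1.
rewrite ler_pM2l ?invr_gt0 ?subr_gt0// opprK addrC lerBlDr.
rewrite (@le_trans _ _ 1)//; last by rewrite lerDl powR_ge0.
rewrite -[leRHS](powRr0 (1 + m.+1%:R^-1 `^ p)) ler_powR// ?lerDl ?powR_ge0//.
by rewrite subr_le0 invf_ge1// ltW.
Qed.

Lemma singwN (p t : R) : singw p (- t) = singw p t.
Proof. by rewrite /singw normrN. Qed.

Lemma integral_singw (p : R) : 0 < p < 1 -> (\int[leb]_t (singw p t)%:E < +oo)%E.
Proof.
move=> p01; have ms := measurable_singw p.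
have mEs : measurable_fun setT (EFin \o (singw p : measurableTypeR R -> R)).
  exact/measurable_EFinP.
have -> : [set: R] = `]-oo, 0] `|` `]0, +oo[.
  by rewrite -setCitvr setvU.
rewrite ge0_integral_setU//=; last 3 first.
- by rewrite -setCitvr setvU.
- by move=> x _; rewrite lee_fin singw_ge0.
- by rewrite -setCitvr disj_set2E setICl.
under [X in (X + _)%E]eq_integral do rewrite -singwN.
rewrite -(@ge0_integration_by_substitution0 R (EFin \o singw p))//; last first.
  by move=> r; rewrite lee_fin singw_ge0.
rewrite -integral_itv_obnd_cbnd; last exact: measurable_funTS.
have := integral_singw_pos p01.
move=> h; apply: (le_lt_trans (leeD h h)); exact: ltry.
Qed.

(* Functions continuous off one point are pointwise limits of the functions
   [t |-> g (floor (m t) / m)], which take countably many values. *)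
Lemma measurable_continuous_rV n (c : 'rV[R]_n) (g : 'rV[R]_n -> R) :
  (forall y, y != c -> {for y, continuous g}) ->
  measurable_fun [set: n.-tuple (measurableTypeR R)] (g \o @rV_of_tuple R n).
Proof.
(* The approximating grid contains 0, and [q m 0 = 0]: with the exceptional point moved to 0, the
   approximation is exact there and continuity is needed only elsewhere. *)
wlog -> : c g / c = 0 => [hw cg|cg].
  pose g' y := g (y + c).
  have H : measurable_fun [set: n.-tuple (measurableTypeR R)] (g' \o @rV_of_tuple R n).
    apply: (hw 0) => // y y0.
    have : {for y, continuous (g \o (fun y => y + c))}; last by [].
    apply: continuous_comp.
      by apply: continuousD; [exact: cvg_id|exact: cst_continuous].
    by apply: cg; rewrite -subr_eq0 addrK.
  have -> : g \o @rV_of_tuple R n =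
      (g' \o @rV_of_tuple R n) \o tshift (fun i => - c ord0 i).
    apply/funext => t /=; rewrite /g'; congr g; apply/rowP => i.
    by rewrite !mxE tnth_mktuple subrK.
  by apply: measurableT_comp => //; exact: measurable_tshift.
pose q (m : nat) (y : 'rV[R]_n) : 'rV[R]_n :=
  \row_i ((Num.floor (m.+1%:R * y ord0 i))%:~R / m.+1%:R).
apply: (@measurable_fun_cvg _ _ _ _ (fun m => g \o q m \o @rV_of_tuple R n)).
  move=> m _ Y mY; rewrite setTI.
  pose F (v : n.-tuple int) : set (n.-tuple (measurableTypeR R)) :=
    [set t | Y (g (\row_i ((tnth v i)%:~R / m.+1%:R))) /\
      forall i, Num.floor (m.+1%:R * tnth t i) = tnth v i].
  rewrite (_ : _ @^-1` Y = \bigcup_v F v); last first.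
    apply/seteqP; split => [t /= Yt|t [v _ [Yv tv]] /=].
      exists [tuple Num.floor (m.+1%:R * tnth t i) | i < n] => //; split.
        rewrite (_ : (\row_i _) = q m (rV_of_tuple t))//.
        by apply/rowP => i; rewrite !mxE tnth_mktuple.
      by move=> i; rewrite tnth_mktuple.
    rewrite (_ : q m (rV_of_tuple t) = \row_i ((tnth v i)%:~R / m.+1%:R))//.
    by apply/rowP => i; rewrite !mxE tv.
  apply: countable_bigcupT_measurable => [|v]; first exact: countableP.
  have [Yv|nYv] := pselect (Y (g (\row_i ((tnth v i)%:~R / m.+1%:R)))); last first.
    by rewrite (_ : F v = set0)//; apply/seteqP; split => // t [].
  rewrite (_ : F v = \bigcap_(i in [set: 'I_n]) ((fun t => tnth t i) @^-1`
     `[((tnth v i)%:~R / m.+1%:R)%R, ((tnth v i + 1)%:~R / m.+1%:R)%R[)); last first.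
    apply/seteqP; split => [t [_ tv] i _|t tv] /=.
      rewrite in_itv/= ler_pdivrMr// ltr_pdivlMr// [_ * m.+1%:R]mulrC.
      by rewrite -tv; exact: floor_itv.
    split=> // i; have := tv i I; rewrite /= in_itv/= ler_pdivrMr// ltr_pdivlMr//.
    by rewrite [_ * m.+1%:R]mulrC => ?; apply: floor_def.
  apply: fin_bigcap_measurable => [|i _]; first exact: finite_finset.
  by rewrite -[X in measurable X]setTI; apply: measurable_tnth => //; exact: measurable_itv.
move=> t _ /=; set y := rV_of_tuple t.
have [y0|y0] := eqVneq y 0.
  apply: cvg_near_cst; apply: nearW => m; congr g.
  apply/rowP => i; rewrite mxE y0 mxE mulr0 floor0 mul0r//.
apply: cvg_comp; last exact: cg.
apply/cvgrPdist_le => e e0; near=> m.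
rewrite /Num.Def.normr/= mx_normrE (bigmax_le _ (ltW e0))//= => -[i j] _ /=.
rewrite ord1 !mxE /=.
have m0 : (0 : R) < m.+1%:R by [].
have /andP[h1 h2] := floor_itv (m.+1%:R * tnth t j).
rewrite ger0_norm; last by rewrite subr_ge0 ler_pdivrMr// [leRHS]mulrC.
rewrite (@le_trans _ _ m.+1%:R^-1)//; last first.
  by apply: ltW; near: m; exact: (near_infty_natSinv_lt (PosNum e0)).
rewrite lerBlDl -[X in _ + X]mul1r -mulrDl ler_pdivlMr// mulrC.
by move: h2; rewrite intrD => /ltW.
Unshelve. all: by end_near. Qed.

End real_line.

(** * Euclidean inner product and norm *)

Section euclidean.
Context (R : realType) (n : nat).
Implicit Types x y z v : 'rV[R]_n.

Lemma dotpC x y : dotp x y = dotp y x.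
Proof. by apply: eq_bigr => i _; rewrite mulrC. Qed.

Lemma dotpDl x y z : dotp (x + y) z = dotp x z + dotp y z.
Proof. by rewrite /dotp -big_split; apply: eq_bigr => i _; rewrite mxE mulrDl. Qed.

Lemma dotpZl (a : R) x y : dotp (a *: x) y = a * dotp x y.
Proof. by rewrite /dotp mulr_sumr; apply: eq_bigr => i _; rewrite mxE mulrA. Qed.

Lemma dotpDr x y z : dotp z (x + y) = dotp z x + dotp z y.
Proof. by rewrite dotpC dotpDl !(dotpC z). Qed.

Lemma dotpZr (a : R) x y : dotp x (a *: y) = a * dotp x y.
Proof. by rewrite dotpC dotpZl dotpC. Qed.

Lemma dotpNl x y : dotp (- x) y = - dotp x y.
Proof. by rewrite -scaleN1r dotpZl mulN1r. Qed.

Lemma dotpNr x y : dotp x (- y) = - dotp x y.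
Proof. by rewrite dotpC dotpNl dotpC. Qed.

Lemma dotp0l x : dotp 0 x = 0.
Proof. by rewrite -(scale0r x) dotpZl mul0r. Qed.

Lemma dotp_delta i y : dotp y (delta_mx ord0 i) = y ord0 i.
Proof.
rewrite /dotp (bigD1 i)//= big1 ?addr0 => [|j ji]; rewrite mxE !eqxx ?mulr1//.
by rewrite (negbTE ji) andbF mulr0.
Qed.

Lemma dotp_ge0 x : 0 <= dotp x x.
Proof. by apply: sumr_ge0 => i _; rewrite -expr2 sqr_ge0. Qed.

Lemma enorm_sqr x : enorm x ^+ 2 = dotp x x.
Proof. by rewrite sqr_sqrtr// dotp_ge0. Qed.

Lemma enorm_ge0 x : 0 <= enorm x.
Proof. exact: sqrtr_ge0. Qed.

Lemma coord_le_enorm x i : `|x ord0 i| <= enorm x.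
Proof.
rewrite -sqrtr_sqr ler_wsqrtr// /dotp (bigD1 i)//= -expr2 lerDl.
by apply: sumr_ge0 => j _; rewrite -expr2 sqr_ge0.
Qed.

Lemma enorm_eq0 x : (enorm x == 0) = (x == 0).
Proof.
apply/eqP/eqP => [x0|->]; last by rewrite /enorm dotp0l sqrtr0.
apply/rowP => i; rewrite mxE; apply/eqP; rewrite -normr_le0 -x0.
exact: coord_le_enorm.
Qed.

Lemma enorm_gt0 x : (0 < enorm x) = (x != 0).
Proof. by rewrite lt_def enorm_ge0 andbT enorm_eq0. Qed.

Lemma enormZ (a : R) x : enorm (a *: x) = `|a| * enorm x.
Proof. by rewrite /enorm dotpZl dotpZr mulrA -expr2 sqrtrM ?sqr_ge0// sqrtr_sqr. Qed.

Lemma enormN x : enorm (- x) = enorm x.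
Proof. by rewrite /enorm dotpNl dotpNr opprK. Qed.

Lemma enormB x y : enorm (x - y) = enorm (y - x).
Proof. by rewrite -enormN opprB. Qed.

Lemma Cauchy_Schwarz x y : `|dotp x y| <= enorm x * enorm y.
Proof.
have [->|y0] := eqVneq y 0.
  by rewrite dotpC dotp0l normr0 mulr_ge0 ?enorm_ge0.
rewrite -ler_sqr ?nnegrE ?mulr_ge0 ?enorm_ge0// exprMn !enorm_sqr real_normK ?num_real//.
have yy : 0 < dotp y y by rewrite -enorm_sqr exprn_gt0// enorm_gt0.
have := dotp_ge0 (dotp y y *: x - dotp x y *: y).
rewrite !(dotpDl, dotpDr, dotpZl, dotpZr, dotpNl, dotpNr) (dotpC y x).
move=> h; rewrite -subr_ge0 -(pmulr_rge0 _ yy); apply: le_trans h _.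
by rewrite le_eqVlt; apply/orP; left; apply/eqP; ring.
Qed.

Lemma enormD x y : enorm (x + y) <= enorm x + enorm y.
Proof.
rewrite -ler_sqr ?nnegrE ?addr_ge0 ?enorm_ge0// sqrrD !enorm_sqr.
rewrite dotpDl !dotpDr (dotpC y x).
have := le_trans (ler_norm _) (Cauchy_Schwarz x y); lra.
Qed.

Lemma continuous_coord i : continuous (fun y : 'rV[R]_n => y ord0 i).
Proof. exact: coord_continuous. Qed.

Lemma continuous_sumr (T : topologicalType) (I : finType) (F : I -> T -> R) (t : T) :
  (forall i, {for t, continuous (F i)}) ->
  {for t, continuous (fun s => \sum_i F i s)}.
Proof.
move=> cF; elim: (index_enum I) => [|i s IHs].
  rewrite (_ : (fun s => _) = cst 0); first exact: cst_continuous.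
  by apply/funext => s; rewrite big_nil.
rewrite (_ : (fun s => _) = F i \+ (fun s' => \sum_(j <- s) F j s')); first exact: continuousD.
by apply/funext => s'; rewrite big_cons.
Qed.

Lemma continuous_dotp_diag : continuous (fun y : 'rV[R]_n => dotp y y).
Proof.
move=> y; apply: continuous_sumr => i.
by apply: continuousM; exact: continuous_coord.
Qed.

Lemma continuous_enorm : continuous (@enorm R n).
Proof.
move=> y; apply: continuous_comp; first exact: continuous_dotp_diag.
exact: sqrt_continuous.
Qed.

Lemma continuous_dotp v : continuous (fun y : 'rV[R]_n => dotp y v).
Proof.
move=> y; apply: continuous_sumr => i.
by apply: continuousM; [exact: continuous_coord|exact: cst_continuous].
Qed.

End euclidean.

(** * Integrable weights on R^n *)

Section weight.
Context (R : realType).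

(** The power p - 1 of |t| decreases with |t|, and 1 + |t|^p is at most 2 (1 + r)^p, whose power
    -1/p supplies the factors 2^(-1/p) and 1/(1 + r). It is applied to a coordinate [t] of a vector
    of norm [r]. *)
Lemma singw_ge (p t r : R) : 0 < p < 1 -> t != 0 -> `|t| <= r ->
  2 `^ (- p^-1) * (r `^ (p - 1) * (1 + r)^-1) <= singw p t.
Proof.
move=> /andP[p0 p1] t0 tr; rewrite /singw.
have t'0 : 0 < `|t| by rewrite normr_gt0.
have r0 : 0 < r by rewrite (lt_le_trans t'0).
rewrite mulrCA; apply: ler_pM.
- exact: powR_ge0.
- by rewrite mulr_ge0 ?powR_ge0// invr_ge0 addr_ge0// ltW.
- rewrite -opprB !powRN lef_pV2 ?posrE ?powR_gt0//.
  by apply: ge0_ler_powR; rewrite ?nnegrE ?subr_ge0 ?(ltW r0) ?normr_ge0 ?(ltW p1).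
rewrite !powRN -invfM lef_pV2 ?posrE ?mulr_gt0 ?powR_gt0 ?ltr_wpDr ?powR_ge0 ?(ltW r0)//.
have -> : 2 `^ p^-1 * (1 + r) = (2 * (1 + r) `^ p) `^ p^-1.
  rewrite powRM ?powR_ge0// -powRrM mulfV ?gt_eqF// powRr1//.
  by rewrite addr_ge0 ?ltW.
apply: ge0_ler_powR; rewrite ?nnegrE ?invr_ge0 ?(ltW p0) ?addr_ge0 ?mulr_ge0 ?powR_ge0//.
rewrite mulr2n mulrDl mul1r lerD//.
  rewrite -[leLHS](powRr0 (1 + r)) ler_powR ?(ltW p0)// lerDl ltW//.
apply: ge0_ler_powR; rewrite ?nnegrE ?(ltW p0) ?normr_ge0 ?addr_ge0 ?(ltW r0)//.
by rewrite (le_trans tr)// lerDr.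
Qed.

(** Model of all majorants: a singularity of order [a] at [c] and decay of order n + a at infinity,
    both integrable when 0 < a < n. *)
Definition wgt n (a : R) (c y : 'rV[R]_n) : R :=
  enorm (y - c) `^ (- a) * ((1 + enorm (y - c)) ^+ n)^-1.

Lemma wgt_ge0 n a (c y : 'rV[R]_n) : 0 <= wgt a c y.
Proof. by rewrite mulr_ge0 ?powR_ge0 ?invr_ge0 ?exprn_ge0 ?addr_ge0 ?enorm_ge0. Qed.

(** With p = 1 - a/n one has n (p - 1) = -a, so the weight is the n-th power of r^(p-1) / (1 + r) at
    r = |y|. One factor goes to each coordinate, which is at most r in absolute value. *)
Lemma wgt_prod n (a : R) (y : 'rV[R]_n) : (0 < n)%N -> 0 < a < n%:R ->
  (forall i, y ord0 i != 0) ->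
  wgt a 0 y <= (2 `^ ((1 - a / n%:R)^-1)) ^+ n * \prod_(i < n) singw (1 - a / n%:R) (y ord0 i).
Proof.
move=> n0 /andP[a0 an] y0; set p := 1 - a / n%:R.
have nR : (0 : R) < n%:R by rewrite ltr0n.
have p01 : 0 < p < 1.
  by rewrite subr_gt0 ltr_pdivrMr// mul1r an ltrBlDr ltrDl divr_gt0.
have r0 : 0 < enorm y.
  by rewrite enorm_gt0; apply: contra_neq (y0 (Ordinal n0)) => ->; rewrite mxE.
rewrite /wgt subr0 -[X in _ ^+ X * _]card_ord -prodr_const -big_split /=.
apply: (@le_trans _ _ (\prod_(i < n) (enorm y `^ (p - 1) * (1 + enorm y)^-1))).
  rewrite prodr_const card_ord exprMn exprVn.
  rewrite -(@powR_mulrn _ (_ `^ _)) ?powR_ge0// -powRrM.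
  rewrite (_ : (p - 1) * n%:R = - a)//.
  by rewrite /p addrAC subrr add0r mulNr divfK// gt_eqF.
apply: ler_prod => i _.
rewrite mulr_ge0 ?powR_ge0 ?invr_ge0 ?addr_ge0 ?enorm_ge0//=.
rewrite -ler_pdivrMl ?powR_gt0// -powRN.
by apply: singw_ge => //; exact: coord_le_enorm.
Qed.

Lemma measurable_wgt n a (c : 'rV[R]_n) :
  measurable_fun [set: n.-tuple (measurableTypeR R)] (wgt a c \o @rV_of_tuple R n).
Proof.
have me : measurable_fun [set: n.-tuple (measurableTypeR R)]
    (fun t => enorm (rV_of_tuple t - c)).
  apply: (@measurable_continuous_rV _ _ 0 (fun y => enorm (y - c))) => y _.
  have : {for y, continuous (@enorm R n \o (fun y => y - c))}; last by [].
  apply: continuous_comp.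
    by apply: continuousB; [exact: cvg_id|exact: cst_continuous].
  exact: continuous_enorm.
apply: measurable_funM.
  exact: (measurableT_comp (@measurable_powR R _) me).
under eq_fun do rewrite -powR_invn ?addr_ge0 ?enorm_ge0//.
apply: (measurableT_comp (@measurable_powR R _)).
by apply: measurable_funD; first exact: measurable_cst.
Qed.

(** After translation to [c = 0], the product of [wgt_prod] dominates, and its integral is a product
    of finite integrals of [singw]. The domination is only almost everywhere: [singw] takes the
    value 0 at 0, so it can fail on the coordinate hyperplanes. *)
Lemma integrable_wgt n (a : R) (c : 'rV[R]_n) : (0 < n)%N -> 0 < a < n%:R ->
  (lebesgue_tuple R n).-integrable setT (EFin \o (wgt a c \o @rV_of_tuple R n)).
Proof.
move=> n0 an; apply/integrableP; split.
  by apply/measurable_EFinP; exact: measurable_wgt.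
have m0 : measurable_fun setT (EFin \o (wgt a (0 : 'rV[R]_n) \o @rV_of_tuple R n)).
  by apply/measurable_EFinP; exact: measurable_wgt.
apply: (@le_lt_trans _ _ (\int[lebesgue_tuple R n]_t (wgt a 0 (rV_of_tuple t))%:E)%E).
  rewrite -(@ge0_integral_tshift _ _ (fun i => - c ord0 i)
    (EFin \o (wgt a (0 : 'rV[R]_n) \o @rV_of_tuple R n)))//.
    rewrite le_eqVlt; apply/orP; left; apply/eqP.
    apply: eq_integral => t _ /=; rewrite ger0_norm ?wgt_ge0// /wgt subr0.
    suff -> : rV_of_tuple (tshift (fun i => - c ord0 i) t) = rV_of_tuple t - c by [].
    by apply/rowP => i; rewrite !mxE tnth_mktuple.
  by move=> t; rewrite lee_fin wgt_ge0.
set p := 1 - a / n%:R; pose C := (2 `^ p^-1) ^+ n : R.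
have C0 : 0 <= C by rewrite exprn_ge0// powR_ge0.
pose w (i : 'I_n) (t : measurableTypeR R) := (singw p t)%:E.
have p01 : 0 < p < 1.
  move: an => /andP[a0 an]; have nR : (0 : R) < n%:R by rewrite ltr0n.
  by rewrite subr_gt0 ltr_pdivrMr// mul1r an ltrBlDr ltrDl divr_gt0.
have mw i : measurable_fun setT (w i) by apply/measurable_EFinP; exact: measurable_singw.
have mp : measurable_fun [set: n.-tuple (measurableTypeR R)]
    (fun t => \prod_(i < n) w i (tnth t i))%E.
  elim: (index_enum _) => [|i s IHs].
    by under eq_fun do rewrite big_nil; exact: measurable_cst.
  under eq_fun do rewrite big_cons; apply: emeasurable_funM => //.
  by apply: measurableT_comp => //; exact: measurable_tnth.
have p0 (t : n.-tuple (measurableTypeR R)) : (0 <= \prod_(i < n) w i (tnth t i))%E.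
  by apply: prode_ge0 => i _; rewrite lee_fin singw_ge0.
apply: (@le_lt_trans _ _
   (\int[lebesgue_tuple R n]_t (C%:E * \prod_(i < n) w i (tnth t i)))%E).
  apply: ae_ge0_le_integral => //.
  - by move=> t _; rewrite lee_fin wgt_ge0.
  - by move=> t _; rewrite mule_ge0.
  - by apply: emeasurable_funM => //; exact: measurable_cst.
  - apply: (@filterS _ _ (ae_filter_ringOfSetsType (lebesgue_tuple R n)) _ _ _
      (@ae_coords_neq0 R n predT)) => t t0 _.
    rewrite prodEFin -EFinM lee_fin.
    have -> : \prod_i singw p (tnth t i) = \prod_i singw p (rV_of_tuple t ord0 i).
      by apply: eq_bigr => i _; rewrite mxE.
    by apply: wgt_prod => // i; rewrite mxE t0.
rewrite ge0_integralZl//.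
rewrite ge0_integral_lebesgue_tuple_prod//; last by move=> i t; rewrite lee_fin singw_ge0.
apply: lte_mul_pinfty => //.
have Ifin : (\int[lebesgue_measure]_t w (Ordinal n0) t)%E \is a fin_num.
  rewrite ge0_fin_numE; first exact: integral_singw.
  by apply: integral_ge0 => t _; rewrite lee_fin singw_ge0.
rewrite (_ : (\prod_(i < n) _)%E = (\prod_(i < n) (fine (\int[lebesgue_measure]_t w i t))%:E)%E).
  by rewrite prodEFin ltry.
by apply: eq_bigr => i _; rewrite fineK.
Qed.

End weight.

(** * Rules for directional derivatives *)

Section derivatives.
Context (R : realType).

(** Only a derivative of [f] along [v] is assumed, so the chain rule is applied on the line through
    [x] in the direction [v]. *)
Lemma is_derive_comp1 (V : normedModType R) (f : V -> R) (g : R -> R) (x v : V) (df dg : R) :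
  is_derive x v f df -> is_derive (f x) 1 g dg ->
  is_derive x v (g \o f) (dg * df).
Proof.
move=> [fd fE] gd.
have lineE (W : normedModType R) (h : V -> W) : 'D_v h x = 'D_1 (fun t : R => h (t *: v + x)) 0.
  rewrite /derive; congr (lim (_ @ 0^')); apply/funext => t /=.
  by rewrite addr0 scale0r add0r [_%:A]mulr1.
have d1 : is_derive (0 : R) 1 (fun t : R => f (t *: v + x)) df.
  by split; [exact: (derivable1P _ _ _).1|rewrite -lineE].
have d2 : is_derive (f (0 *: v + x)) 1 g dg by rewrite scale0r add0r.
have [d3 d3E] := @is_derive1_comp _ g (fun t : R => f (t *: v + x)) 0 _ _ d2 d1.
by split; [exact: (derivable1P _ _ _).2|rewrite lineE].
Qed.

Lemma is_derive_translate (V W : normedModType R) (f : V -> W) (x c v : V) (df : W) :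
  is_derive (x - c) v f df -> is_derive x v (fun y => f (y - c)) df.
Proof.
move=> [fd fE].
have E : (fun h => h^-1 *: (((fun y => f (y - c)) \o shift x) (h *: v) - f (x - c))) =
         (fun h => h^-1 *: ((f \o shift (x - c)) (h *: v) - f (x - c))) :> (R -> W).
  by apply/funext => h /=; rewrite addrA.
by split; rewrite /derivable /derive E.
Qed.

Lemma is_derive_coord n (x v : 'rV[R]_n) i :
  is_derive x v (fun y : 'rV[R]_n => y ord0 i) (v ord0 i).
Proof.
have := derive_mx (@derivable_id R 'rV[R]_n x v).
rewrite derive_id => /matrixP/(_ ord0 i); rewrite mxE => vE.
split; last by rewrite vE.
by have /derivable_mxP := @derivable_id R 'rV[R]_n x v; apply.
Qed.

Lemma is_derive_sumr (V : normedModType R) (I : finType) (F : I -> V -> R) (dF : I -> R) (x v : V) :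
  (forall i, is_derive x v (F i) (dF i)) ->
  is_derive x v (fun y => \sum_i F i y) (\sum_i dF i).
Proof.
move=> FdF; elim: (index_enum I) => [|i s IHs].
  rewrite big_nil (_ : (fun y => _) = cst 0); first exact: is_derive_cst.
  by apply/funext => y; rewrite big_nil.
rewrite big_cons (_ : (fun y => _) = F i \+ (fun y => \sum_(j <- s) F j y)).
  exact: is_deriveD.
by apply/funext => y; rewrite big_cons.
Qed.

Lemma is_derive_mulr (V : normedModType R) (f g : V -> R) (x v : V) (df dg d : R) :
  is_derive x v f df -> is_derive x v g dg -> f x * dg + g x * df = d ->
  is_derive x v (fun y => f y * g y) d.
Proof. by move=> fd gd <-; exact: is_deriveM. Qed.

Lemma is_derive_dotp n (x v w : 'rV[R]_n) :
  is_derive x v (fun y => dotp y w) (dotp v w).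
Proof.
apply: is_derive_sumr => i.
apply: is_derive_mulr (is_derive_coord x v i) (is_derive_cst (w ord0 i) x v) _.
by rewrite /cst mulr0 add0r mulrC.
Qed.

Lemma is_derive_dotp_diag n (x v : 'rV[R]_n) :
  is_derive x v (fun y => dotp y y) (2 * dotp x v).
Proof.
rewrite mulr_sumr; apply: is_derive_sumr => i.
apply: is_derive_mulr (is_derive_coord x v i) (is_derive_coord x v i) _.
by ring.
Qed.

End derivatives.

(** * The regularized kernel: derivatives, trace and bounds *)

Section regularized_kernel.
Context (R : realType) (n : nat).
Implicit Types (e : R) (z u v s : 'rV[R]_n).

(** At [e = 0] this is the Euclidean norm: the regularized and the singular kernel share their
    formulas, which are used wherever [rho e z] is positive. *)
Definition rho e z : R := Num.sqrt (dotp z z + e ^+ 2).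

Lemma rho_ge0 e z : 0 <= rho e z. Proof. exact: sqrtr_ge0. Qed.

Lemma rho_sqr e z : rho e z ^+ 2 = dotp z z + e ^+ 2.
Proof. by rewrite sqr_sqrtr// addr_ge0 ?dotp_ge0 ?sqr_ge0. Qed.

Lemma rho_gt0 e z : (e != 0) || (z != 0) -> 0 < rho e z.
Proof.
move=> ez; rewrite sqrtr_gt0.
case/orP: ez => [e0|z0].
  by rewrite ltr_wpDl ?dotp_ge0// exprn_even_gt0.
by rewrite ltr_wpDr ?sqr_ge0// -enorm_sqr exprn_gt0// enorm_gt0.
Qed.

Lemma rho0 z : rho 0 z = enorm z.
Proof. by rewrite /rho expr0n addr0. Qed.

Lemma enorm_le_rho e z : enorm z <= rho e z.
Proof. by rewrite ler_wsqrtr// lerDl sqr_ge0. Qed.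

Lemma le_rho e z : 0 <= e -> e <= rho e z.
Proof.
by move=> e0; rewrite -[leLHS](ger0_norm e0) -sqrtr_sqr ler_wsqrtr// lerDr dotp_ge0.
Qed.

Lemma continuous_rho e : continuous (rho e).
Proof.
move=> y; have : {for y, continuous (Num.sqrt \o (fun z => dotp z z + e ^+ 2))}; last by [].
apply: continuous_comp; last exact: sqrt_continuous.
by apply: continuousD; [exact: continuous_dotp_diag|exact: cst_continuous].
Qed.

Lemma is_derive_rho e z s : 0 < rho e z ->
  is_derive z s (rho e) (dotp z s / rho e z).
Proof.
move=> r0.
have p0 : 0 < dotp z z + e ^+ 2 by rewrite -rho_sqr exprn_gt0.
have d1 : is_derive z s (fun y => dotp y y + e ^+ 2) (2 * dotp z s).
  exact: (is_derive_eq (is_deriveD (is_derive_dotp_diag z s) (is_derive_cst (e ^+ 2) z s)) (addr0 _)).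
refine (is_derive_eq (is_derive_comp1 d1 (is_derive1_sqrt p0)) _).
by rewrite -/(rho e z); field; rewrite gt_eqF.
Qed.

Lemma is_derive_rhoV e z s : 0 < rho e z ->
  is_derive z s (fun y => (rho e y)^-1) (- dotp z s * (rho e z)^-1 ^+ 3).
Proof.
move=> r0; have rn0 : rho e z != 0 by rewrite gt_eqF.
have [d dE] := is_derive_rho s r0.
split; first exact: derivableV.
by rewrite deriveV// dE /GRing.scale/= -exprVn; field.
Qed.

Definition rpow e k z : R := (rho e z)^-1 ^+ k.

Arguments rpow : simpl never.

Lemma rpow_ge0 e k z : 0 <= rpow e k z.
Proof. by rewrite exprn_ge0// invr_ge0 rho_ge0. Qed.

Lemma continuous_rpow e k z : 0 < rho e z -> {for z, continuous (rpow e k)}.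
Proof.
move=> r0; have : {for z, continuous ((fun t : R => t ^+ k) \o (fun t => t^-1) \o rho e)}; last by [].
apply: continuous_comp; first exact: continuous_rho.
apply: continuous_comp; last exact: exprn_continuous.
by apply: inv_continuous; rewrite gt_eqF.
Qed.

Lemma is_derive_rpow e k z s : 0 < rho e z ->
  is_derive z s (rpow e k) (- k%:R * dotp z s * rpow e k.+2 z).
Proof.
move=> r0; have rn0 : rho e z != 0 by rewrite gt_eqF.
case: k => [|k].
  rewrite (_ : rpow e 0 = cst 1); last by apply/funext => y; rewrite /rpow expr0.
  by apply: is_derive_eq; rewrite mulr0n oppr0 !mul0r.
rewrite (_ : rpow e k.+1 = (fun y => (rho e y)^-1) ^+ k.+1); last first.
  by apply/funext => y; rewrite exprfctE.
refine (is_derive_eq (is_deriveX k.+1 (is_derive_rhoV s r0)) _).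
by rewrite /rpow /GRing.scale/= -[k.+3]addn3 exprD; ring.
Qed.

(* Second and third derivatives, along [u], [v] and [s], of a radial potential
   with gradient [z / rho e z ^+ n], which regularizes the fundamental solution
   of the Laplacian. *)
Definition aker e u v z : R :=
  dotp u v * rpow e n z - n%:R * dotp z u * dotp z v * rpow e n.+2 z.

Definition cker e u v s z : R :=
  n%:R * (n.+2)%:R * dotp z u * dotp z v * dotp z s * rpow e n.+4 z
  - n%:R * (dotp u v * dotp z s + dotp s u * dotp z v + dotp z u * dotp s v) * rpow e n.+2 z.

Lemma aker_sym e u v z : aker e u v z = aker e v u z.
Proof. by rewrite /aker (dotpC u v); ring. Qed.

(** Third derivatives of a single potential do not depend on their order; this symmetry produces the
    cancellations when derivatives are exchanged. *)
Lemma cker_sym e u v s z : cker e u v s z = cker e u s v z.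
Proof. by rewrite /cker (dotpC s u) (dotpC s v) (dotpC v u); ring. Qed.

Lemma is_derive_aker e u v s z : 0 < rho e z ->
  is_derive z s (aker e u v) (cker e u v s z).
Proof.
move=> r0.
have d1 : is_derive z s (fun y => dotp u v * rpow e n y)
    (- n%:R * dotp u v * dotp z s * rpow e n.+2 z).
  apply: is_derive_mulr (is_derive_cst (dotp u v) z s) (is_derive_rpow n s r0) _.
  by rewrite /cst; ring.
have d2 : is_derive z s (fun y => n%:R * dotp y u) (n%:R * dotp s u).
  apply: is_derive_mulr (is_derive_cst (n%:R : R) z s) (is_derive_dotp z s u) _.
  by rewrite /cst; ring.
have d3 := is_derive_mulr d2 (is_derive_dotp z s v) erefl.
have d4 := is_derive_mulr d3 (is_derive_rpow n.+2 s r0) erefl.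
refine (is_derive_eq (is_deriveB d1 d4) _).
by rewrite /cker; ring.
Qed.

Lemma continuous_aker e u v z : 0 < rho e z -> {for z, continuous (aker e u v)}.
Proof.
move=> r0; apply: continuousB; apply: continuousM; try exact: continuous_rpow.
  exact: cst_continuous.
apply: continuousM; last exact: continuous_dotp.
by apply: continuousM; [exact: cst_continuous|exact: continuous_dotp].
Qed.

Lemma continuous_cker e u v s z : 0 < rho e z -> {for z, continuous (cker e u v s)}.
Proof.
move=> r0; apply: continuousB; apply: continuousM; try exact: continuous_rpow.
  apply: continuousM; last exact: continuous_dotp.
  apply: continuousM; last exact: continuous_dotp.
  by apply: continuousM; [exact: cst_continuous|exact: continuous_dotp].
apply: continuousM; first exact: cst_continuous.
apply: continuousD; last first.
  by apply: continuousM; [exact: continuous_dotp|exact: cst_continuous].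
by apply: continuousD; apply: continuousM;
  try exact: cst_continuous; exact: continuous_dotp.
Qed.

Lemma rho_rpow e k z : 0 < rho e z -> rho e z * rpow e k.+1 z = rpow e k z.
Proof. by move=> r0; rewrite /rpow exprS mulrA mulfV ?mul1r// gt_eqF. Qed.

(** The trace is n (rho^2 - |z|^2) / rho^(n+2), and rho^2 - |z|^2 = e^2. For [e = 0] it says that
    the potential is harmonic off the origin. *)
Lemma aker_trace e z : 0 < rho e z ->
  \sum_k aker e (delta_mx ord0 k) (delta_mx ord0 k) z = n%:R * e ^+ 2 * rpow e n.+2 z.
Proof.
move=> r0; rewrite /aker sumrB.
under eq_bigr do rewrite dotp_delta mxE !eqxx mul1r.
rewrite sumr_const card_ord.
under [X in _ - X]eq_bigr do rewrite !dotp_delta -!mulrA mulrCA.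
under [X in _ - X]eq_bigr do rewrite [X in _ * X]mulrCA mulrA.
rewrite -mulr_suml -/(dotp z z) -mulr_natl.
rewrite (_ : rpow e n z = rho e z ^+ 2 * rpow e n.+2 z); first by rewrite rho_sqr; ring.
by rewrite expr2 -mulrA !rho_rpow.
Qed.

(** By Cauchy-Schwarz each factor [dotp z u] uses up one power of 1/rho; hence [aker] is of order -n
    and [cker] of order -(n+1) in rho. *)
Lemma dotp_rpow_le e k u z : 0 < rho e z ->
  `|dotp z u| * rpow e k.+1 z <= enorm u * rpow e k z.
Proof.
move=> r0; rewrite -(rho_rpow k r0) mulrA ler_wpM2r ?rpow_ge0//.
rewrite (le_trans (Cauchy_Schwarz _ _))// mulrC ler_wpM2l ?enorm_ge0//.
exact: enorm_le_rho.
Qed.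

Lemma aker_le e u v z : 0 < rho e z ->
  `|aker e u v z| <= (n.+1)%:R * (enorm u * enorm v) * rpow e n z.
Proof.
move=> r0; rewrite /aker (le_trans (ler_normB _ _))//.
have rp k : 0 <= rpow e k z by exact: rpow_ge0.
rewrite (normrM (dotp u v)) (normrM (_ * _ * _) (rpow e n.+2 z)) !(normrM (_ * _) (dotp z v)).
rewrite (normrM n%:R) (ger0_norm (rp n)) (ger0_norm (rp _)) (ger0_norm (ler0n _ n)).
have hu := dotp_rpow_le n u r0; have hv := dotp_rpow_le n.+1 v r0.
have c := Cauchy_Schwarz u v.
have h1 : `|dotp u v| * rpow e n z <= enorm u * enorm v * rpow e n z by rewrite ler_wpM2r.
have h2 : `|dotp z u| * `|dotp z v| * rpow e n.+2 z <= enorm u * enorm v * rpow e n z.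
  rewrite -mulrA; apply: (le_trans (ler_wpM2l (normr_ge0 _) hv)).
  by rewrite mulrCA [enorm u * _]mulrC -[leRHS]mulrA ler_wpM2l// enorm_ge0.
have := ler_wpM2l (ler0n R n) h2.
have -> : n%:R * `|dotp z u| * `|dotp z v| * rpow e n.+2 z =
    n%:R * (`|dotp z u| * `|dotp z v| * rpow e n.+2 z) by ring.
have -> : n.+1%:R * (enorm u * enorm v) * rpow e n z =
    enorm u * enorm v * rpow e n z + n%:R * (enorm u * enorm v * rpow e n z).
  by rewrite -natr1; ring.
lra.
Qed.

Lemma cker_le e u v s z : 0 < rho e z ->
  `|cker e u v s z| <=
  (n%:R * n.+2%:R + 3 * n%:R) * (enorm u * enorm v * enorm s) * rpow e n.+1 z.
Proof.
move=> r0; rewrite /cker.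
have rp k : 0 <= rpow e k z by exact: rpow_ge0.
have D k (a b : 'rV[R]_n) : `|dotp a b * rpow e k z| = `|dotp a b| * rpow e k z.
  by rewrite normrM (ger0_norm (rp k)).
have E (a : 'rV[R]_n) : 0 <= enorm a by exact: enorm_ge0.
have hu := dotp_rpow_le n.+1 u r0; have hv := dotp_rpow_le n.+2 v r0.
have hs := dotp_rpow_le n.+3 s r0.
have T0 : `|dotp z u * dotp z v * dotp z s * rpow e n.+4 z| <=
    enorm u * enorm v * enorm s * rpow e n.+1 z.
  rewrite 3!normrM (ger0_norm (rp _)).
  rewrite -mulrA; apply: (le_trans (ler_wpM2l _ hs)) => //.
  rewrite [leLHS]mulrCA [_ * enorm s]mulrC -[leRHS]mulrA ler_wpM2l//.
  rewrite -[leLHS]mulrA; apply: (le_trans (ler_wpM2l (normr_ge0 (dotp z u)) hv)).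
  by rewrite [leLHS]mulrCA [enorm u * _]mulrC -[leRHS]mulrA ler_wpM2l.
have T1 (a b c : 'rV[R]_n) : `|dotp a b * dotp z c * rpow e n.+2 z| <=
    enorm a * enorm b * enorm c * rpow e n.+1 z.
  rewrite 2!normrM (ger0_norm (rp _)) -mulrA -[leRHS]mulrA.
  apply: (ler_pM (normr_ge0 _) _ (Cauchy_Schwarz a b) (dotp_rpow_le n.+1 c r0)).
  by rewrite mulr_ge0.
have t0 := T0; have t1 := T1 u v s; have t2 := T1 s u v; have t3 := T1 s v u.
set A := enorm u * enorm v * enorm s * rpow e n.+1 z in t0 t1.
rewrite (_ : enorm s * enorm u * enorm v * _ = A) in t2; last by rewrite /A; ring.
rewrite (_ : enorm s * enorm v * enorm u * _ = A) in t3; last by rewrite /A; ring.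
rewrite (_ : _ - _ = n%:R * n.+2%:R * (dotp z u * dotp z v * dotp z s * rpow e n.+4 z)
  - n%:R * (dotp u v * dotp z s * rpow e n.+2 z + dotp s u * dotp z v * rpow e n.+2 z
  + dotp s v * dotp z u * rpow e n.+2 z)); last by ring.
have : 0 <= n.+2%:R :> R by exact: ler0n.
move: (n.+2%:R) => M M0; have N0 : 0 <= n%:R :> R by exact: ler0n.
rewrite (le_trans (ler_normB _ _))// (normrM (n%:R * M)) (normrM n%:R (_ + _)).
rewrite (ger0_norm N0) (ger0_norm (mulr_ge0 N0 M0)).
rewrite (_ : (_ + _) * _ * _ = n%:R * M * A + n%:R * (3 * A)); last by rewrite /A; ring.
apply: lerD; first by apply: ler_wpM2l => //; exact: mulr_ge0.
rewrite ler_wpM2l// (le_trans (ler_normD _ _))//.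
have := ler_normD (dotp u v * dotp z s * rpow e n.+2 z) (dotp s u * dotp z v * rpow e n.+2 z).
lra.
Qed.

End regularized_kernel.

(** * Integrals on R^n, and the vanishing integral of a partial derivative *)

Section parts.
Context (R : realType) (n : nat).
Let leb : {sigma_finite_measure set (measurableTypeR R) -> \bar R} :=
  @lebesgue_measure R.
Let lebn := lebesgue_tuple R n.
Local Notation rV := (@rV_of_tuple R n).

Definition integrable_rV (h : 'rV[R]_n -> R) :=
  lebn.-integrable setT (EFin \o (h \o rV)).

Lemma ae_rV_neq (c : 'rV[R]_n) : (0 < n)%N ->
  {ae lebn, forall t, rV t != c}.
Proof.
move=> n0; pose k := Ordinal n0.
change (lebn.-negligible (~` [set t | rV t != c])).
apply: negligibleS (coord0_negligible k (c ord0 k)) => t /= /negP/negPn/eqP <-.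
by rewrite mxE.
Qed.

(** Two exceptional points are allowed: 0, where the homogeneous functions are singular, and [c],
    which serves as the centre of the singular kernel. *)
Lemma integrable_rV_dominated (h g : 'rV[R]_n -> R) (c : 'rV[R]_n) : (0 < n)%N ->
  measurable_fun [set: n.-tuple (measurableTypeR R)] (h \o rV) ->
  integrable_rV g -> (forall y, y != 0 -> y != c -> `|h y| <= g y) ->
  integrable_rV h.
Proof.
move=> n0 mh gi hg; have mg := measurable_int _ gi.
apply/integrableP; split; first exact/measurable_EFinP.
have /integrableP[_] := gi; apply: le_lt_trans.
apply: ae_ge0_le_integral => //.
- by apply: measurableT_comp => //; exact/measurable_EFinP.
- exact: measurableT_comp.
- apply: (@filterS2 _ _ (ae_filter_ringOfSetsType lebn) _ _ _ _
    (ae_rV_neq 0 n0) (ae_rV_neq c n0)) => t t0 tc _ /=.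
  by rewrite lee_fin (le_trans (hg _ t0 tc))// ler_norm.
Qed.

Lemma integrable_rVD (h g : 'rV[R]_n -> R) :
  integrable_rV h -> integrable_rV g -> integrable_rV (fun y => h y + g y).
Proof. by move=> hi gi; exact: (integrableD measurableT hi gi). Qed.

Lemma integrable_rVZ (a : R) (h : 'rV[R]_n -> R) :
  integrable_rV h -> integrable_rV (fun y => a * h y).
Proof. by move=> hi; exact: (integrableZl measurableT a hi). Qed.

Lemma integral_rVD (h g : 'rV[R]_n -> R) : integrable_rV h -> integrable_rV g ->
  integral_rV (fun y => h y + g y) = integral_rV h + integral_rV g.
Proof. by move=> hi gi; rewrite /integral_rV -RintegralD. Qed.

Lemma integral_rVZ (a : R) (h : 'rV[R]_n -> R) : integrable_rV h ->
  integral_rV (fun y => a * h y) = a * integral_rV h.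
Proof. by move=> hi; rewrite /integral_rV RintegralZl. Qed.

Lemma ae_eq_integral_rV (h g : 'rV[R]_n -> R) (c : 'rV[R]_n) : (0 < n)%N ->
  measurable_fun [set: n.-tuple (measurableTypeR R)] (h \o rV) ->
  measurable_fun [set: n.-tuple (measurableTypeR R)] (g \o rV) ->
  (forall y, y != 0 -> y != c -> h y = g y) -> integral_rV h = integral_rV g.
Proof.
move=> n0 mh mg hg; rewrite /integral_rV /Rintegral; congr fine.
apply: ae_eq_integral => //; try exact/measurable_EFinP.
apply: (@filterS2 _ _ (ae_filter_ringOfSetsType lebn) _ _ _ _
  (ae_rV_neq 0 n0) (ae_rV_neq c n0)) => t t0 tc _ /=.
by rewrite (hg _ t0 tc).
Qed.

Lemma le_norm_integral_rV (h g : 'rV[R]_n -> R) (c : 'rV[R]_n) : (0 < n)%N ->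
  integrable_rV h -> integrable_rV g ->
  (forall y, y != 0 -> y != c -> `|h y| <= g y) -> `|integral_rV h| <= integral_rV g.
Proof.
(* The bound may fail at 0 and at [c], whereas monotonicity of the integral is used pointwise: [k]
   repairs [g] there without changing its integral. *)
move=> n0 hi gi hg; pose k y := Num.max (g y) `|h y|.
have kg y : y != 0 -> y != c -> k y = g y.
  by move=> y0 yc; rewrite /k; apply/max_idPl; exact: hg.
have mh : measurable_fun [set: n.-tuple (measurableTypeR R)] (h \o rV).
  by have /measurable_EFinP := measurable_int _ hi.
have mg : measurable_fun [set: n.-tuple (measurableTypeR R)] (g \o rV).
  by have /measurable_EFinP := measurable_int _ gi.
have mk : measurable_fun [set: n.-tuple (measurableTypeR R)] (k \o rV).
  apply: measurable_maxr => //.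
  by apply: measurableT_comp mh; exact: normr_measurable.
have ki : integrable_rV k.
  apply: (integrable_rV_dominated (g := fun y => `|g y|) (c := c) n0 mk (integrable_abse gi)) => y y0 yc /=.
  by rewrite kg.
rewrite (ae_eq_integral_rV n0 mg mk (fun y y0 yc => esym (kg y y0 yc))).
apply: (le_trans (le_normr_Rintegral measurableT hi)).
apply: le_Rintegral => //; first exact: integrable_abse hi.
by move=> t _; rewrite /k/= le_max lexx orbT.
Qed.

(** Integrability is included because [integral_rV] also returns 0 when the extended integral is
    infinite, and because additivity depends on it. *)
Definition null_rV (h : 'rV[R]_n -> R) := integrable_rV h /\ integral_rV h = 0.

Lemma null_rVD h g : null_rV h -> null_rV g -> null_rV (fun y => h y + g y).
Proof.
move=> [hi h0] [gi g0]; split; first exact: integrable_rVD.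
by rewrite integral_rVD// h0 g0 addr0.
Qed.

Lemma null_rVZ a h : null_rV h -> null_rV (fun y => a * h y).
Proof.
move=> [hi h0]; split; first exact: integrable_rVZ.
by rewrite integral_rVZ// h0 mulr0.
Qed.

Lemma null_rVB h g : null_rV h -> null_rV g -> null_rV (fun y => h y - g y).
Proof.
move=> hn gn; rewrite (_ : (fun y => _) = (fun y => h y + -1 * g y)).
  by apply: null_rVD => //; exact: null_rVZ.
by apply/funext => y; rewrite mulN1r.
Qed.

Lemma null_rV_sum (I : finType) (F : I -> 'rV[R]_n -> R) :
  (forall i, null_rV (F i)) -> null_rV (fun y => \sum_i F i y).
Proof.
move=> FN; elim: (index_enum I) => [|i s IHs].
  rewrite (_ : (fun y => _) = fun=> 0); last by apply/funext => y; rewrite big_nil.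
  split; first exact: integrable0.
  by rewrite /integral_rV Rintegral_cst// mul0r.
rewrite (_ : (fun y => _) = fun y => F i y + \sum_(j <- s) F j y).
  exact: null_rVD.
by apply/funext => y; rewrite big_cons.
Qed.

Lemma rV_tset (k : 'I_n) a t :
  rV (tset k a t) = a *: delta_mx ord0 k + rV (tset k 0 t).
Proof.
apply/rowP => i; rewrite !mxE !tnth_mktuple eqxx/=.
by case: eqP; rewrite ?mulr1 ?mulr0 ?addr0 ?add0r.
Qed.

Lemma is_derive_line (V : normedModType R) (f : V -> R) (v z : V) (a df : R) :
  is_derive (a *: v + z) v f df -> is_derive a 1 (fun t : R => f (t *: v + z)) df.
Proof.
move=> [fd fE].
have E : (fun h => h^-1 *: (((fun t => f (t *: v + z)) \o shift a) (h *: (1 : R)) - f (a *: v + z))) =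
         (fun h => h^-1 *: ((f \o shift (a *: v + z)) (h *: v) - f (a *: v + z))) :> (R -> R).
  by apply/funext => h /=; rewrite [_%:A]mulr1 scalerDl addrA.
by split; rewrite /derivable /derive E.
Qed.

Lemma cvg0_le_inv (u : nat -> R) (C : R) :
  (forall m, (0 < m)%N -> `|u m| <= C / m%:R) -> u m @[m --> \oo] --> 0.
Proof.
move=> uC; apply/cvgrPdist_le => e e0; near=> m.
have m0 : (0 < m)%N by near: m; exact: nbhs_infty_gt.
rewrite sub0r normrN (le_trans (uC _ m0))// ler_pdivrMr ?ltr0n// mulrC -ler_pdivrMr//.
by near: m; exact: nbhs_infty_ger.
Unshelve. all: by end_near. Qed.

Lemma line_neq0 (k : 'I_n) (y : n.-tuple (measurableTypeR R)) (a : R) : (1 < n)%N ->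
  (forall i, i != k -> tnth y i != 0) -> rV (tset k a y) != 0.
Proof.
move=> n1 yk.
have [i ik] : exists i : 'I_n, i != k.
  pose i0 := Ordinal (ltnW n1); pose i1 := Ordinal n1.
  by have [->|?] := eqVneq k i0; [exists i1|exists i0; rewrite eq_sym].
apply: contra_neq (yk i ik) => /rowP/(_ i).
by rewrite !mxE tnth_mktuple (negbTE ik).
Qed.

(** On a line of direction [k] that misses the origin, [phi] is a primitive of [h] and is O(1/|a|)
    at both ends. A blow-up of [phi] at the origin is harmless, since almost every such line misses
    it and [h] is integrable. *)
Lemma null_rV_partial (k : 'I_n) (phi h : 'rV[R]_n -> R) (C : R) : (1 < n)%N ->
  (forall y, y != 0 -> is_derive y (delta_mx ord0 k) phi (h y)) ->
  (forall y, y != 0 -> {for y, continuous h}) ->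
  (forall y, y != 0 -> `|phi y| <= C / enorm y) ->
  integrable_rV h -> null_rV h.
Proof.
move=> n1 dphi ch phiC hi; split => //.
rewrite /integral_rV /Rintegral.
rewrite (_ : (\int[_]_x _)%E = 0%E)//.
apply: (integral_lines_eq0 (k := k) hi) => y yk.
have P0 a := line_neq0 a n1 yk.
under eq_fun do rewrite /= rV_tset.
set v := delta_mx ord0 k; set z := rV (tset k 0 y) => hli.
have P1 a : a *: v + z != 0 by rewrite -rV_tset.
have Pk (a : R) : `|a| <= enorm (a *: v + z).
  apply: le_trans (coord_le_enorm _ k).
  by rewrite !mxE !eqxx tnth_mktuple eqxx mulr1 addr0.
have C0 : 0 <= C.
  have := le_trans (normr_ge0 _) (phiC _ (P1 0)).
  by rewrite pmulr_lge0// invr_gt0 enorm_gt0.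
have phi_le (a : R) : a != 0 -> `|phi (a *: v + z)| <= C / `|a|.
  move=> a0; rewrite (le_trans (phiC _ (P1 a)))// ler_wpM2l//.
  by rewrite lef_pV2 ?posrE ?enorm_gt0 ?normr_gt0.
apply: (@integral_eq0_primitive _ (fun a => h (a *: v + z)) (fun a => phi (a *: v + z))) => //.
- apply: nearW => m.
  apply: (@integral_itv_is_derive _ (fun a => phi (a *: v + z)) (fun a => h (a *: v + z))).
  + by rewrite (@le_trans _ _ 0)// oppr_le0.
  + by move=> x _; apply: is_derive_line; exact: dphi.
  + move=> x _; have : {for x, continuous (h \o (fun a : R => a *: v + z))}; last by [].
    apply: continuous_comp; last exact: ch.
    apply: continuousD; last exact: cst_continuous.
    by apply: scalel_continuous.
- apply: (@cvg0_le_inv _ C) => m m0.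
  by rewrite (le_trans (phi_le _ _)) ?pnatr_eq0 -?lt0n// ger0_norm.
- apply: (@cvg0_le_inv _ C) => m m0.
  by rewrite (le_trans (phi_le _ _)) ?oppr_eq0 ?pnatr_eq0 -?lt0n// normrN ger0_norm.
Qed.

(** Both e and |y - x| are at most rho, so 1 + |y| <= (1 + |x|) + |y - x| is at most ((1 + |x|)/e +
    1) rho. *)
Lemma rpow_shift_le e k (x y : 'rV[R]_n) : 0 < e ->
  rpow e k (y - x) <= ((1 + enorm x) / e + 1) ^+ k / (1 + enorm y) ^+ k.
Proof.
move=> e0; have r0 : 0 < rho e (y - x) by rewrite rho_gt0// gt_eqF.
have y1 : 0 < 1 + enorm y by rewrite ltr_pwDl// enorm_ge0.
rewrite /rpow -expr_div_n; apply: lerXn2r; rewrite ?nnegrE ?invr_ge0 ?(ltW r0)//.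
  by rewrite divr_ge0 ?(ltW y1)// addr_ge0 ?divr_ge0 ?addr_ge0 ?enorm_ge0// ltW.
rewrite ler_pdivlMr// mulrC ler_pdivrMr// mulrDl mul1r.
have h1 : 1 + enorm x <= (1 + enorm x) / e * rho e (y - x).
  rewrite mulrAC ler_pdivlMr// ler_wpM2l ?addr_ge0 ?enorm_ge0//.
  by rewrite le_rho// ltW.
have h2 := enorm_le_rho e (y - x).
have h3 : enorm y <= enorm x + enorm (y - x) by rewrite -{1}(subrKC x y) enormD.
lra.
Qed.

Lemma wgt1E (y : 'rV[R]_n) : wgt 1 0 y = (enorm y)^-1 / (1 + enorm y) ^+ n.
Proof. by rewrite /wgt subr0 powR_inv1// enorm_ge0. Qed.

End parts.

(** * Exchange of derivatives between the kernel and a homogeneous function *)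

Section swap.
Context (R : realType) (n : nat) (x : 'rV[R]_n) (e : R).
Hypotheses (n1 : (1 < n)%N) (e0 : 0 < e).
Local Notation rV := (@rV_of_tuple R n).
Let rho_pos (z : 'rV[R]_n) : 0 < rho e z. Proof. by rewrite rho_gt0// gt_eqF. Qed.
Let n0 : (0 < n)%N. Proof. exact: ltnW. Qed.

Let cont_sub (g : 'rV[R]_n -> R) (y : 'rV[R]_n) : (forall z, {for z, continuous g}) ->
  {for y, continuous (fun y : 'rV[R]_n => g (y - x))}.
Proof.
move=> cg; have : {for y, continuous (g \o (fun y => y - x))}; last by [].
apply: continuous_comp; last exact: cg.
by apply: continuousB; [exact: cvg_id|exact: cst_continuous].
Qed.

(** The integrand is the k-th partial derivative of [aker e u v (y - x) * B y]: this is one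
    integration by parts. Its singularity of order 1 at the origin comes from [dB], its decay is of
    order n + 1, and [wgt 1 0] has exactly these two orders. *)
Lemma null_rV_aker_partial (u v : 'rV[R]_n) (k : 'I_n) (B dB : 'rV[R]_n -> R) (C : R) :
  (forall y, y != 0 -> is_derive y (delta_mx ord0 k) B (dB y)) ->
  (forall y, y != 0 -> {for y, continuous B}) ->
  (forall y, y != 0 -> {for y, continuous dB}) ->
  (forall y, y != 0 -> `|B y| <= C) ->
  (forall y, y != 0 -> `|dB y| <= C / enorm y) ->
  null_rV (fun y => cker e u v (delta_mx ord0 k) (y - x) * B y + aker e u v (y - x) * dB y).
Proof.
move=> dBB cB cdB BC dBC.
pose h y := cker e u v (delta_mx ord0 k) (y - x) * B y + aker e u v (y - x) * dB y.
(* [c] is the constant of [rpow_shift_le]; [K1] and [K2] combine its powers with the constants of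
   [aker_le] and [cker_le]. *)
pose c := (1 + enorm x) / e + 1.
pose K1 := n.+1%:R * (enorm u * enorm v) * c ^+ n.
pose K2 := (n%:R * n.+2%:R + 3 * n%:R) * (enorm u * enorm v * enorm (delta_mx ord0 k : 'rV[R]_n)) * c ^+ n.+1.
have c0 : 0 <= c by rewrite addr_ge0// divr_ge0 ?addr_ge0 ?enorm_ge0 ?(ltW e0).
have uv0 : 0 <= enorm u * enorm v by rewrite mulr_ge0 ?enorm_ge0.
have M0 : 0 <= n%:R * n.+2%:R + 3 * n%:R :> R by rewrite addr_ge0// mulr_ge0// ler0n.
have K10 : 0 <= K1 by rewrite mulr_ge0 ?exprn_ge0// mulr_ge0.
have K20 : 0 <= K2.
  by apply: mulr_ge0; [apply: mulr_ge0 M0 _; rewrite mulr_ge0 ?enorm_ge0|rewrite exprn_ge0].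
have y1 (y : 'rV[R]_n) : 0 < 1 + enorm y by rewrite ltr_pwDl// enorm_ge0.
have aK y : `|aker e u v (y - x)| <= K1 / (1 + enorm y) ^+ n.
  rewrite (le_trans (aker_le _ _ (rho_pos _)))// /K1 -[leRHS]mulrA ler_wpM2l//.
    by rewrite mulr_ge0.
  exact: rpow_shift_le.
have cK y : `|cker e u v (delta_mx ord0 k) (y - x)| <= K2 / (1 + enorm y) ^+ n.+1.
  rewrite (le_trans (cker_le _ _ _ (rho_pos _)))// /K2 -[leRHS]mulrA ler_wpM2l//.
    by apply: mulr_ge0 M0 _; rewrite mulr_ge0 ?enorm_ge0.
  exact: rpow_shift_le.
have yn (y : 'rV[R]_n) : y != 0 -> 0 < enorm y by rewrite enorm_gt0.
have C0 : 0 <= C.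
  have d0 : (delta_mx ord0 k : 'rV[R]_n) != 0.
    by apply/eqP => /rowP/(_ k)/eqP; rewrite !mxE !eqxx oner_eq0.
  exact: le_trans (normr_ge0 _) (BC _ d0).
have ch y : y != 0 -> {for y, continuous h}.
  move=> y0; apply: continuousD; apply: continuousM; try exact: cB; try exact: cdB.
    by apply: cont_sub => z; exact: continuous_cker.
  by apply: cont_sub => z; exact: continuous_aker.
apply: (@null_rV_partial R n k (fun y => aker e u v (y - x) * B y) h (K1 * C)) => //.
- move=> y y0.
  apply: is_derive_mulr (is_derive_translate (is_derive_aker u v _ (rho_pos _))) (dBB _ y0) _.
  by rewrite addrC mulrC.
- move=> y y0; rewrite normrM [leRHS]mulrAC; apply: ler_pM => //; last exact: BC.
  rewrite (le_trans (aK y))// ler_wpM2l// lef_pV2 ?posrE ?exprn_gt0// ?yn//.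
  rewrite (@le_trans _ _ (1 + enorm y))// ?lerDr//.
  by rewrite -[leLHS]expr1 ler_weXn2l// lerDl enorm_ge0.
- apply: (@integrable_rV_dominated R n h (fun y => (K2 * C + K1 * C) * wgt 1 0 y) 0) => //.
  + exact: (measurable_continuous_rV ch).
  + apply: integrable_rVZ; apply: integrable_wgt => //.
    by rewrite ltr01 ltr1n.
  move=> y y0 _; rewrite wgt1E mulrDl (le_trans (ler_normD _ _))// !normrM lerD//.
    rewrite (le_trans (ler_pM _ _ (cK y) (BC _ y0)))// mulrAC (ler_wpM2l (mulr_ge0 K20 C0))//.
    rewrite exprS invfM ler_wpM2r ?invr_ge0 ?exprn_ge0 ?(ltW (y1 _))//.
    by rewrite lef_pV2 ?posrE ?yn ?y1// lerDr.
  rewrite (le_trans (ler_pM _ _ (aK y) (dBC _ y0)))//.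
  by rewrite le_eqVlt; apply/orP; left; apply/eqP; ring.
Qed.

(* Two exchanges of a pair of derivatives, each an integration by parts. *)
Lemma integral_aker_laplacian (xi : 'rV[R]_n) (B : 'I_n -> 'rV[R]_n -> R)
    (H : 'I_n -> 'I_n -> 'rV[R]_n -> R) (C : R) :
  (forall k j y, y != 0 -> is_derive y (delta_mx ord0 j) (B k) (H k j y)) ->
  (forall k y, y != 0 -> {for y, continuous (B k)}) ->
  (forall k j y, y != 0 -> {for y, continuous (H k j)}) ->
  (forall k j y, y != 0 -> H k j y = H j k y) ->
  (forall k y, y != 0 -> `|B k y| <= C) ->
  (forall k j y, y != 0 -> `|H k j y| <= C / enorm y) ->
  null_rV (fun y => aker e xi xi (y - x) * (\sum_k H k k y)
    - n%:R * e ^+ 2 * rpow e n.+2 (y - x) *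
      (\sum_i \sum_j xi ord0 i * xi ord0 j * H i j y)).
Proof.
move=> dB cB cH symH BC HC.
pose d (k : 'I_n) : 'rV[R]_n := delta_mx ord0 k.
pose D (p q k l : 'I_n) y :=
  cker e (d p) (d q) (d l) (y - x) * B k y + aker e (d p) (d q) (y - x) * H k l y.
have DN p q k l : null_rV (D p q k l).
  exact: (null_rV_aker_partial (d p) (d q) (dB k l) (cB k) (cH k l) (BC k) (HC k l)).
(* Write A_pq for the kernel along the axes p and q. In the first difference the [cker] terms cancel
   and A_ij H_kk - A_ik H_kj remains; in the second A_ki H_jk - A_kk H_ji remains. By symmetry of A
   and H the sum is A_ij H_kk - A_kk H_ij. *)
pose F y := \sum_i \sum_j \sum_k (xi ord0 i * xi ord0 j) *
    ((D i j k k y - D i k k j y) + (D k i j k y - D k k j i y)).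
have FN : null_rV F.
  do 3!apply: null_rV_sum => ?; apply: null_rVZ.
  by apply: null_rVD; apply: null_rVB.
have akerE z : aker e xi xi z = \sum_i \sum_j xi ord0 i * xi ord0 j * aker e (d i) (d j) z.
  rewrite /aker {1}/dotp mulr_suml -mulrA -mulrA [dotp z xi * _]mulrA.
  rewrite {1 2}/dotp big_distrlr/= mulr_suml mulr_sumr -sumrB; apply: eq_bigr => i _.
  rewrite mulr_suml mulr_sumr (bigD1 i)//= [RHS](bigD1 i)//= opprD addrA; congr (_ + _).
    by rewrite /d !dotp_delta mxE !eqxx/=; ring.
  rewrite -sumrN; apply: eq_bigr => j ji.
  by rewrite /d !dotp_delta mxE eqxx/= (negbTE ji)/=; ring.
set h := (X in null_rV X).
have hE y : y != 0 -> F y = h y.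
  move=> y0; rewrite /F /h akerE -aker_trace//; set S := \sum_k H k k y.
  set T := \sum_k aker _ _ _ _; rewrite mulr_suml mulr_sumr -sumrB.
  apply: eq_bigr => i _; rewrite mulr_suml mulr_sumr -sumrB; apply: eq_bigr => j _.
  rewrite /S /T mulr_sumr mulr_suml -sumrB; apply: eq_bigr => k _.
  have e1 := cker_sym e (d i) (d k) (d j) (y - x).
  have e2 := cker_sym e (d k) (d i) (d k) (y - x).
  have e3 := aker_sym e (d k) (d i) (y - x).
  have e4 := symH j k _ y0; have e5 := symH j i _ y0.
  by rewrite /D e1 e2 e3 e4 e5; ring.
have mh : measurable_fun [set: n.-tuple (measurableTypeR R)] (h \o rV).
  apply: (@measurable_continuous_rV _ _ 0) => y y0.
  apply: continuousB; apply: continuousM.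
  - by apply: cont_sub => z; exact: continuous_aker.
  - by apply: continuous_sumr => k; exact: cH.
  - apply: continuousM; first exact: cst_continuous.
    by apply: cont_sub => z; exact: continuous_rpow.
  - apply: continuous_sumr => i; apply: continuous_sumr => j.
    by apply: continuousM; [exact: cst_continuous|exact: cH].
case: FN => Fi F0; split.
  apply: (@integrable_rV_dominated R n h (fun y => `|F y|) 0 n0 mh (integrable_abse Fi)) => y y0 _ /=.
  by rewrite hE.
rewrite -F0; apply: (@ae_eq_integral_rV _ _ _ _ 0) => //.
  by have /measurable_EFinP := measurable_int _ Fi.
by move=> y y0 _; rewrite hE.
Qed.

End swap.

(** * Comparison of the regularized kernel with the unit ball, line by line *)

Section ball_volume.
Context (R : realType) (n : nat) (e : R).
Hypotheses (n1 : (1 < n)%N) (e0 : 0 < e).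
Let leb : {sigma_finite_measure set (measurableTypeR R) -> \bar R} :=
  @lebesgue_measure R.
Local Notation rV := (@rV_of_tuple R n).
Let n0 : (0 < n)%N. Proof. exact: ltnW. Qed.
Let rho_pos (z : 'rV[R]_n) : 0 < rho e z. Proof. by rewrite rho_gt0// gt_eqF. Qed.
Let rho0_pos (z : 'rV[R]_n) : z != 0 -> 0 < rho 0 z.
Proof. by move=> z0; rewrite rho_gt0// z0 orbT. Qed.

Lemma is_derive_coord_rpow d (k : 'I_n) (y : 'rV[R]_n) : 0 < rho d y ->
  is_derive y (delta_mx ord0 k) (fun y => y ord0 k * rpow d n y)
    (aker d (delta_mx ord0 k) (delta_mx ord0 k) y).
Proof.
move=> r0.
apply: is_derive_mulr (is_derive_coord y _ k) (is_derive_rpow n _ r0) _.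
by rewrite /aker !dotp_delta mxE !eqxx/=; ring.
Qed.

Lemma rho_le_add (z : 'rV[R]_n) : rho e z <= rho 0 z + e.
Proof.
rewrite -ler_sqr ?nnegrE ?rho_ge0 ?addr_ge0 ?rho_ge0 ?(ltW e0)//.
rewrite sqrrD !rho_sqr expr0n/= addr0.
by rewrite lerD2r lerDl mulrn_wge0// mulr_ge0 ?rho_ge0 ?(ltW e0).
Qed.

(** For a = 1/rho_0 and b = 1/rho_e, the bound rho_e <= rho_0 + e gives a - b <= e a^2; the powers
    follow by induction. Replacing the regularized kernel by the singular one thus gains one order
    of decay. *)
Lemma rpow_diff k (z : 'rV[R]_n) : z != 0 ->
  0 <= rpow 0 k z - rpow e k z <= k%:R * e * rpow 0 k.+1 z.
Proof.
move=> z0; rewrite /rpow.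
have r0 := rho0_pos z0; have r1 := rho_pos z.
have rr : rho 0 z <= rho e z by rewrite rho0 enorm_le_rho.
set a := (rho 0 z)^-1; set b := (rho e z)^-1.
have a0 : 0 < a by rewrite invr_gt0.
have b0 : 0 < b by rewrite invr_gt0.
have ab : b <= a by rewrite lef_pV2.
have ba : a - b <= e * a ^+ 2.
  have -> : a - b = (rho e z - rho 0 z) * (a * b).
    by rewrite /a /b; field; rewrite !gt_eqF.
  have := rho_le_add z; rewrite -lerBlDl => h.
  apply: ler_pM => //; first by rewrite subr_ge0.
    by rewrite mulr_ge0// ltW.
  by rewrite expr2 ler_wpM2l// ltW.
elim: k => [|k /andP[IH0 IH]]; first by rewrite !expr0 subrr mul0r mul0r lexx.
have -> : a ^+ k.+1 - b ^+ k.+1 = a * (a ^+ k - b ^+ k) + b ^+ k * (a - b).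
  by rewrite !exprS; ring.
have bk : b ^+ k <= a ^+ k by rewrite -subr_ge0.
have b0k : 0 <= b ^+ k by rewrite exprn_ge0// ltW.
apply/andP; split.
  by rewrite addr_ge0// mulr_ge0// ?subr_ge0// ltW.
have h1 := ler_wpM2l (ltW a0) IH.
have h2 : b ^+ k * (a - b) <= a ^+ k * (e * a ^+ 2).
  by apply: ler_pM => //; rewrite subr_ge0.
apply: (le_trans (lerD h1 h2)).
by rewrite -[k.+1%:R]natr1 !exprS expr0 mulr1 le_eqVlt; apply/orP; left; apply/eqP; ring.
Qed.

(* The kernel [ballker k] integrates to 0 along almost every line of direction
   [k], and the sum over [k] is the Laplacian of the potential minus [n] on the
   unit ball; this gives the mass of that Laplacian without polar coordinates. *)
Definition ballker (k : 'I_n) (y : 'rV[R]_n) : R :=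
  aker e (delta_mx ord0 k) (delta_mx ord0 k) y -
  (if enorm y <= 1 then 1 else aker 0 (delta_mx ord0 k) (delta_mx ord0 k) y).

Lemma enorm_delta (k : 'I_n) : enorm (delta_mx ord0 k : 'rV[R]_n) = 1.
Proof. by rewrite /enorm dotp_delta mxE !eqxx sqrtr1. Qed.

Lemma measurable_enorm_le1 :
  measurable_fun [set: n.-tuple (measurableTypeR R)] (fun t => enorm (rV t) <= 1).
Proof.
apply: measurable_fun_ler; last exact: measurable_cst.
apply: (@measurable_continuous_rV _ _ 0 (@enorm R n)) => y _.
exact: continuous_enorm.
Qed.

(** Far away both kernels are of order -n, too slow to be integrable separately; their difference is
    of order -(n+1) by [rpow_diff]. In the unit ball both terms are bounded. *)
Lemma integrable_ballker k : integrable_rV (ballker k).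
Proof.
(* [C1] serves in the ball and [C2] outside. The factor 2^n compares with [wgt 1 0]: 1 + |y| is at
   most 2 in the ball and at most 2|y| outside. *)
pose C1 : R := (n.+1%:R * e^-1 ^+ n + 1) * 2 ^+ n.
pose C2 : R := (n%:R * e + n%:R * (n.+2%:R * e)) * 2 ^+ n.
have C10 : 0 <= C1.
  by rewrite mulr_ge0 ?exprn_ge0// addr_ge0// mulr_ge0// exprn_ge0// invr_ge0 ltW.
have C20 : 0 <= C2.
  by rewrite mulr_ge0 ?exprn_ge0// addr_ge0// mulr_ge0 ?mulr_ge0// ltW.
apply: (@integrable_rV_dominated R n _ (fun y => (C1 + C2) * wgt 1 0 y) 0) => //.
- apply: measurable_funB.
    apply: (@measurable_continuous_rV _ _ 0) => y _.
    exact: continuous_aker.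
  apply: measurable_fun_ifT; first exact: measurable_enorm_le1.
    exact: measurable_cst.
  apply: (@measurable_continuous_rV _ _ 0) => y y0.
  by apply: continuous_aker; exact: rho0_pos.
- apply: integrable_rVZ; apply: integrable_wgt => //.
  by rewrite ltr01 ltr1n.
move=> y y0 _; rewrite wgt1E /ballker.
have r0 : 0 < enorm y by rewrite enorm_gt0.
have w0 : 0 <= (enorm y)^-1 / (1 + enorm y) ^+ n.
  by rewrite divr_ge0 ?exprn_ge0 ?addr_ge0 ?invr_ge0 ?(ltW r0).
case: ifPn => [y1|]; last rewrite -ltNge => y1.
  rewrite mulrDl -[leLHS]addr0; apply: lerD; last exact: mulr_ge0 C20 w0.
  rewrite (le_trans (ler_normB _ _))// normr1.
  have h : 2 ^- n <= (enorm y)^-1 / (1 + enorm y) ^+ n.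
    rewrite -[leLHS]mul1r ler_pM ?invr_ge0 ?exprn_ge0//.
      by rewrite invf_ge1.
    rewrite lef_pV2 ?posrE ?exprn_gt0 ?addr_gt0//.
    by apply: lerXn2r; rewrite ?nnegrE ?addr_ge0 ?(ltW r0)// -[leRHS]/(1 + 1) lerD2l.
  have := ler_wpM2l C10 h; rewrite {1}/C1 mulfK ?expf_neq0//; apply: le_trans.
  rewrite lerD2r (le_trans (aker_le _ _ (rho_pos _)))// enorm_delta !mulr1 ler_wpM2l//.
  rewrite /rpow; apply: lerXn2r; rewrite ?nnegrE ?invr_ge0 ?(ltW e0) ?rho_ge0//.
  by rewrite lef_pV2 ?posrE// le_rho// ltW.
rewrite mulrDl -[leLHS]add0r; apply: lerD; first exact: mulr_ge0 C10 w0.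
have /andP[p1 p2] := rpow_diff n y0; have /andP[q1 q2] := rpow_diff n.+2 y0.
rewrite /aker !dotp_delta mxE !eqxx/= !mul1r.
set yk := y ord0 k.
have -> : rpow e n y - n%:R * yk * yk * rpow e n.+2 y - (rpow 0 n y - n%:R * yk * yk * rpow 0 n.+2 y)
  = - (rpow 0 n y - rpow e n y) + n%:R * ((yk ^+ 2) * (rpow 0 n.+2 y - rpow e n.+2 y)) by ring.
rewrite (le_trans (ler_normD _ _))// normrN (ger0_norm p1) !normrM (ger0_norm q1) normr_nat.
have yk2 : `|yk| ^+ 2 <= enorm y ^+ 2.
  by apply: lerXn2r; rewrite ?nnegrE ?enorm_ge0//; exact: coord_le_enorm.
rewrite -(expr2 `|yk|).
have rE m : enorm y ^+ 2 * rpow 0 m.+2 y = rpow 0 m y.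
  by rewrite -rho0 expr2 -mulrA !rho_rpow ?rho0_pos.
have nn : 0 <= n.+2%:R * e by rewrite mulr_ge0 ?ler0n// ltW.
have nn1 : 0 <= n%:R * e by rewrite mulr_ge0 ?ler0n// ltW.
have t1 : `|yk| ^+ 2 * (rpow 0 n.+2 y - rpow e n.+2 y) <= n.+2%:R * e * rpow 0 n.+1 y.
  rewrite -(rE n.+1) mulrCA; apply: ler_pM => //; exact: exprn_ge0.
apply: (le_trans (lerD p2 (ler_wpM2l (ler0n R n) t1))).
have -> : n%:R * e * rpow 0 n.+1 y + n%:R * (n.+2%:R * e * rpow 0 n.+1 y) =
   (n%:R * e + n%:R * (n.+2%:R * e)) * rpow 0 n.+1 y by ring.
rewrite /C2 -[leRHS]mulrA ler_wpM2l//.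
  by rewrite addr_ge0// mulr_ge0.
rewrite /rpow rho0 exprS mulrCA ler_wpM2l ?invr_ge0 ?(ltW r0)//.
rewrite -expr_div_n; apply: lerXn2r; rewrite ?nnegrE ?invr_ge0 ?(ltW r0)//.
  by rewrite divr_ge0// addr_ge0// ltW.
rewrite ler_pdivlMr ?addr_gt0// mulrC ler_pdivrMr//.
by rewrite mulr2n mulrDl mul1r lerD2r ltW.
Qed.

Lemma line_rho0 (k : 'I_n) (z : 'rV[R]_n) (a : R) : z ord0 k = 0 ->
  enorm (a *: delta_mx ord0 k + z) ^+ 2 = a ^+ 2 + enorm z ^+ 2.
Proof.
move=> zk; rewrite !enorm_sqr dotpDl !dotpDr !dotpZl !dotpZr.
rewrite (dotpC (delta_mx _ _) z) !dotp_delta zk mxE !eqxx/= -!enorm_sqr; ring.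
Qed.

(** [F d] is a primitive of [aker d v v] along the line, and [a] is one of the constant 1. Where the
    line crosses the unit sphere, [F 0 a = a] because the norm is 1; so the pieces glue and
    [Phi = F e - F 0], which is O(1/|a|), accounts for the whole line. *)
Lemma integral_ballker_line (k : 'I_n) (z : 'rV[R]_n) :
  z != 0 -> z ord0 k = 0 ->
  leb.-integrable setT (fun a => (ballker k (a *: delta_mx ord0 k + z))%:E) ->
  (\int[leb]_a (ballker k (a *: delta_mx ord0 k + z))%:E = 0)%E.
Proof.
move=> z0 zk hi; set v := delta_mx ord0 k in hi *.
pose P (a : R) := a *: v + z.
have Pk a : P a ord0 k = a by rewrite !mxE !eqxx mulr1 zk addr0.
have Pn a : enorm (P a) ^+ 2 = a ^+ 2 + enorm z ^+ 2 by exact: line_rho0.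
have zn : 0 < enorm z by rewrite enorm_gt0.
have P0 a : P a != 0.
  rewrite -enorm_gt0 -(@ltr_pXn2r _ 2)// ?nnegrE ?enorm_ge0// expr0n/= Pn.
  by rewrite ltr_wpDl ?sqr_ge0// exprn_gt0.
pose F d (a : R) := P a ord0 k * rpow d n (P a).
have dF d (a : R) : 0 < rho d (P a) -> is_derive a 1 (F d) (aker d v v (P a)).
  by move=> r0; exact: (is_derive_line (is_derive_coord_rpow k r0)).
have cP (a : R) : {for a, continuous P}.
  by apply: continuousD; [exact: scalel_continuous|exact: cst_continuous].
have cF d (a : R) : 0 < rho d (P a) -> {for a, continuous (fun a => aker d v v (P a))}.
  move=> r0; have : {for a, continuous (aker d v v \o P)}; last by [].
  by apply: continuous_comp => //; exact: continuous_aker.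
pose Phi a := F e a - F 0 a.
(* Half the length of the chord cut by the unit ball. If the line misses the ball, the square root
   of a negative number is 0, and the middle interval reduces to a null point. *)
pose q := Num.sqrt (1 - enorm z ^+ 2).
have q0 : 0 <= q by exact: sqrtr_ge0.
have q1 : q < 1.
  by rewrite -[ltRHS]sqrtr1 ltr_sqrt// ltrBlDr ltrDl exprn_gt0.
have aE (a : R) : a ^+ 2 = `|a| ^+ 2 by rewrite real_normK// num_real.
have out a : q < `|a| -> 1 < enorm (P a).
  move=> qa; rewrite -(@ltr_pXn2r _ 2)// ?nnegrE ?enorm_ge0// expr1n Pn -ltrBlDr.
  have [h|h] := leP (1 - enorm z ^+ 2) 0.
    rewrite (le_lt_trans h)// aE exprn_gt0//.
    exact: le_lt_trans qa.
  by rewrite (aE a) -(sqr_sqrtr (ltW h)) ltr_pXn2r ?nnegrE.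
have inside a : 0 < q -> `|a| <= q -> enorm (P a) <= 1.
  move=> q2 qa; rewrite -(@ler_pXn2r _ 2)// ?nnegrE ?enorm_ge0// expr1n Pn -lerBrDr.
  rewrite sqrtr_gt0 in q2.
  by rewrite (aE a) -(sqr_sqrtr (ltW q2)) ler_pXn2r ?nnegrE.
have bd a : 0 < q -> `|a| = q -> F 0 a = a.
  move=> q2 qa; rewrite /F Pk /rpow rho0.
  rewrite sqrtr_gt0 in q2.
  have : enorm (P a) ^+ 2 = 1.
    by rewrite Pn (aE a) qa sqr_sqrtr ?(ltW q2)// subrK.
  move/eqP; rewrite -[X in _ == X](expr1n _ 2) eqrXn2 ?enorm_ge0// => /eqP ->.
  by rewrite invr1 expr1n mulr1.
have mh A : measurable A -> measurable_fun A (fun a : measurableTypeR R => (ballker k (P a))%:E).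
  by move=> mA; apply: (measurable_funS measurableT) => //; exact: measurable_int hi.
have piece (a b : R) : a <= b -> (forall t, a < t < b -> q < `|t|) ->
    (\int[leb]_(t in `]a, b[) (ballker k (P t))%:E = (Phi b - Phi a)%:E)%E.
  move=> ab abq; pose g (t : R) := aker e v v (P t) - aker 0 v v (P t).
  have cg (t : R) : {for t, continuous g}.
    by apply: continuousB; apply: cF; [exact: rho_pos|exact: rho0_pos].
  have mg : measurable_fun [set: measurableTypeR R] (EFin \o (g : measurableTypeR R -> R)).
    by apply/measurable_EFinP; apply: continuous_measurable_fun; exact: cg.
  transitivity (\int[leb]_(t in `]a, b[) (g t)%:E)%E.
    apply: eq_integral => t; rewrite inE/= in_itv/= => /abq/out.
    by rewrite /ballker ltNge => /negbTE ->.
  rewrite integral_itv_obnd_cbnd; last exact: measurable_funTS.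
  rewrite integral_itv_bndo_bndc; last exact: measurable_funTS.
  apply: integral_itv_is_derive => // t _.
  by apply: is_deriveB; apply: dF; [exact: rho_pos|exact: rho0_pos].
have mid : (\int[leb]_(t in `[(- q)%R, q]) (ballker k (P t))%:E = (Phi q - Phi (- q))%:E)%E.
  have := q0; rewrite le_eqVlt => /predU1P[<-|q2].
    by rewrite oppr0 set_itv1 integral_set1 subrr.
  transitivity (\int[leb]_(t in `[(- q)%R, q]) (aker e v v (P t) - 1)%:E)%E.
    apply: eq_integral => t; rewrite inE/= in_itv/= -ler_norml => /(inside t q2).
    by rewrite /ballker => ->.
  have -> : Phi q - Phi (- q) = (F e q - q) - (F e (- q) - - q).
    by rewrite /Phi !bd// ?normrN ger0_norm.
  apply: (@integral_itv_is_derive _ (fun a => F e a - a)).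
  - by rewrite (@le_trans _ _ 0)// oppr_le0.
  - by move=> t _; apply: is_deriveB; apply: dF; exact: rho_pos.
  - move=> t _; apply: continuousB; last exact: cst_continuous.
    by apply: cF; exact: rho_pos.
have Phi_le (a : R) : 1 <= `|a| -> `|Phi a| <= n%:R * e / `|a|.
  move=> a1; have a0 : 0 < `|a| by exact: lt_le_trans a1.
  have aP : `|a| <= enorm (P a) by rewrite -{1}(Pk a) coord_le_enorm.
  have /andP[p1 p2] := rpow_diff n (P0 a).
  rewrite /Phi /F Pk -mulrBr normrM distrC (ger0_norm p1).
  apply: (le_trans (ler_wpM2l (ltW a0) p2)); rewrite mulrCA ler_wpM2l//.
    by rewrite mulr_ge0// ltW.
  rewrite /rpow rho0; apply: (@le_trans _ _ (`|a| * `|a|^-1 ^+ n.+1)).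
    rewrite ler_wpM2l ?(ltW a0)//; apply: lerXn2r; rewrite ?nnegrE ?invr_ge0 ?enorm_ge0//.
    by rewrite lef_pV2 ?posrE ?(lt_le_trans a0 aP).
  rewrite exprS mulrA mulfV ?mul1r ?gt_eqF//.
  by rewrite ler_iXnr// ?invr_ge0// invf_le1.
apply: (@integral_eq0_primitive _ (fun a => ballker k (P a)) Phi) => //.
- near=> m; have m1 : 1 <= m%:R :> R by rewrite ler1n; near: m; exact: nbhs_infty_gt.
  have qm : q <= m%:R by rewrite (le_trans (ltW q1)).
  have qq : - q <= q by rewrite (@le_trans _ _ 0)// oppr_le0.
  rewrite (@itv_bndbnd_setU _ _ (BLeft (- m%:R)) (BLeft (- q)) (BRight m%:R)) ?bnd_simp ?lerN2//; last first.
    by rewrite (le_trans qq).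
  rewrite integral_setU//=; last 2 first.
  - by apply: mh; apply: measurableU.
  - rewrite disj_set2E; apply/eqP/seteqP; split => // t [] /=; rewrite !in_itv/=.
    by move=> /andP[? t1] /andP[t2 ?]; move: t1; rewrite ltNge t2.
  rewrite (@itv_bndbnd_setU _ _ (BLeft (- q)) (BRight q) (BRight m%:R)) ?bnd_simp//.
  rewrite integral_setU//=; last 2 first.
  - by apply: mh; apply: measurableU.
  - rewrite disj_set2E; apply/eqP/seteqP; split => // t [] /=; rewrite !in_itv/=.
    by move=> /andP[? t1] /andP[t2 ?]; move: t2; rewrite ltNge t1.
  rewrite -integral_itv_obnd_cbnd; last by apply: mh.
  rewrite -[X in (_ + (_ + X))%E]integral_itv_bndo_bndc; last by apply: mh.
  rewrite mid !piece ?lerN2// -?EFinD.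
  + by congr EFin; ring.
  + by move=> t /andP[qt _]; rewrite (lt_le_trans qt)// ler_norm.
  + by move=> t /andP[_ tq]; rewrite ltrNr in tq; rewrite (lt_le_trans tq)// -normrN ler_norm.
- apply: (@cvg0_le_inv _ _ (n%:R * e)) => m m0; rewrite (le_trans (Phi_le _ _))//.
    by rewrite ger0_norm// ler1n.
  by rewrite ger0_norm.
- apply: (@cvg0_le_inv _ _ (n%:R * e)) => m m0; rewrite (le_trans (Phi_le _ _))//.
    by rewrite normrN ger0_norm// ler1n.
  by rewrite normrN ger0_norm.
Unshelve. all: by end_near. Qed.

End ball_volume.

(** * Total mass of the regularized Laplacian, and [omega] *)

Section ball_volume_integral.
Context (R : realType) (n : nat).
Hypothesis n1 : (1 < n)%N.
Let leb : {sigma_finite_measure set (measurableTypeR R) -> \bar R} :=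
  @lebesgue_measure R.
Let lebn := lebesgue_tuple R n.
Local Notation rV := (@rV_of_tuple R n).
Let n0 : (0 < n)%N. Proof. exact: ltnW. Qed.

Lemma null_ballker (e : R) (k : 'I_n) : 0 < e -> null_rV (ballker (n := n) e k).
Proof.
move=> e0; have hi := integrable_ballker n1 e0 k; split => //.
rewrite /integral_rV /Rintegral.
rewrite (_ : (\int[_]_x _)%E = 0%E)//.
apply: (integral_lines_eq0 (k := k) hi) => y yk.
under eq_fun do rewrite /= rV_tset.
move=> hli; apply: integral_ballker_line => //; first exact: line_neq0.
by rewrite mxE tnth_mktuple eqxx.
Qed.

(* The Laplacian of that potential, by [aker_trace]. *)
Definition lapker (e : R) (y : 'rV[R]_n) : R := n%:R * e ^+ 2 * rpow e n.+2 y.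

Lemma lapker_ge0 (e : R) y : 0 <= lapker e y.
Proof. by rewrite mulr_ge0 ?rpow_ge0// mulr_ge0 ?ler0n ?sqr_ge0. Qed.

Lemma continuous_lapker (e : R) : 0 < e -> continuous (lapker e).
Proof.
move=> e0 y.
have : {for y, continuous (fun z => (n%:R * e ^+ 2) * rpow e n.+2 z)}; last by [].
apply: continuousM; first exact: cst_continuous.
by apply: continuous_rpow; rewrite rho_gt0// gt_eqF.
Qed.

Lemma measurable_lapker (e : R) (x : 'rV[R]_n) : 0 < e ->
  measurable_fun [set: n.-tuple (measurableTypeR R)] ((fun y => lapker e (y - x)) \o rV).
Proof.
move=> e0; apply: (@measurable_continuous_rV _ _ 0 (fun y => lapker e (y - x))) => y _.
have : {for y, continuous (lapker e \o (fun y => y - x))}; last by [].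
apply: continuous_comp; last exact: continuous_lapker.
by apply: continuousB; [exact: cvg_id|exact: cst_continuous].
Qed.

Lemma integrable_lapker (e : R) (x : 'rV[R]_n) : 0 < e -> integrable_rV (fun y => lapker e (y - x)).
Proof.
move=> e0; pose c := (1 + enorm x) / e + 1.
have c0 : 0 <= c by rewrite addr_ge0// divr_ge0 ?addr_ge0 ?enorm_ge0 ?(ltW e0).
apply: (@integrable_rV_dominated R n _ (fun y => (n%:R * e ^+ 2 * c ^+ n.+2) * wgt 1 0 y) 0) => //.
- exact: measurable_lapker.
- by apply: integrable_rVZ; apply: integrable_wgt => //; rewrite ltr01 ltr1n.
move=> y y0 _; rewrite ger0_norm ?lapker_ge0// /lapker wgt1E -[leRHS]mulrA.
have y1 : 0 < enorm y by rewrite enorm_gt0.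
apply: ler_wpM2l; first by rewrite mulr_ge0 ?ler0n ?sqr_ge0.
rewrite (le_trans (rpow_shift_le _ _ _ e0))// ler_wpM2l ?exprn_ge0//.
rewrite -addn2 addnC exprD invfM ler_wpM2r ?invr_ge0 ?exprn_ge0 ?addr_ge0 ?(ltW y1)//.
rewrite lef_pV2 ?posrE ?exprn_gt0 ?addr_gt0// (@le_trans _ _ (1 + enorm y))// ?lerDr//.
by rewrite -[leLHS]expr1 ler_weXn2l// lerDl enorm_ge0.
Qed.

Definition ball_indic (y : 'rV[R]_n) : R := if enorm y <= 1 then 1 else 0.

Definition unit_ball_vol : R := fine (lebn [set t | enorm (rV t) <= 1]).

Lemma measurable_unit_ball : measurable [set t | enorm (rV t) <= 1].
Proof. by have := @measurable_enorm_le1 R n measurableT [set true] I; rewrite setTI. Qed.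

Lemma unit_ball_vol_pos : (0 < lebn [set t | (enorm (rV t) <= 1)%R] < +oo)%E.
Proof.
have nR : (0 : R) < n%:R by rewrite ltr0n.
apply/andP; split.
  (* The cube of half-side 1/n lies in the ball: the squared norm is at most n (1/n)^2 = 1/n. *)
  pose A (i : 'I_n) : set (measurableTypeR R) := `[- n%:R^-1, n%:R^-1]%classic.
  apply: (@lt_le_trans _ _ (lebn [set t | forall i, A i (tnth t i)])).
    rewrite lebesgue_tuple_box; last by move=> i; exact: measurable_itv.
    have -> : (\prod_(i < n) lebesgue_measure (A i) = \prod_(i < n) (n%:R^-1 + n%:R^-1)%:E)%E.
      apply: eq_bigr => i _; rewrite lebesgue_measure_itv/= lte_fin.
      by rewrite gtrN ?invr_gt0// -EFinB opprK.
    by rewrite prodEFin lte_fin prodr_gt0// => i _; rewrite addr_gt0 ?invr_gt0.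
  apply: le_measure; rewrite ?inE.
  - rewrite [X in measurable X](_ : _ = \bigcap_(i in [set: 'I_n])
      ((fun t => tnth t i) @^-1` A i)); last first.
      by apply/seteqP; split => t /= H i; [move=> _; exact: H|exact: (H i I)].
    apply: fin_bigcap_measurable => [|i _]; first exact: finite_finset.
    by rewrite -[X in measurable X]setTI; apply: measurable_tnth => //; exact: measurable_itv.
  - exact: measurable_unit_ball.
  - move=> t /= tA; rewrite -[leRHS]sqrtr1 ler_wsqrtr//.
    apply: (@le_trans _ _ (\sum_(i < n) (n%:R^-1) ^+ 2)).
      apply: ler_sum => i _; rewrite mxE -expr2.
      have := tA i; rewrite /A/= in_itv/= -ler_norml => h.
      by rewrite -[leLHS]real_normK ?num_real//; apply: lerXn2r; rewrite ?nnegrE ?invr_ge0.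
    rewrite sumr_const card_ord -(mulr_natl (n%:R^-1 ^+ 2)) expr2 mulrA mulfV ?gt_eqF// mul1r.
    by rewrite invf_le1// ler1n.
pose A (i : 'I_n) : set (measurableTypeR R) := `[- 1, 1]%classic.
apply: (@le_lt_trans _ _ (lebn [set t | forall i, A i (tnth t i)])); last first.
  rewrite lebesgue_tuple_box; last by move=> i; exact: measurable_itv.
  have -> : (\prod_(i < n) lebesgue_measure (A i) = \prod_(i < n) (1 + 1 : R)%:E)%E.
    apply: eq_bigr => i _; rewrite lebesgue_measure_itv/= lte_fin.
    by rewrite gtrN// -EFinB opprK.
  by rewrite prodEFin ltry.
apply: le_measure; rewrite ?inE.
- exact: measurable_unit_ball.
- rewrite [X in measurable X](_ : _ = \bigcap_(i in [set: 'I_n])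
    ((fun t => tnth t i) @^-1` A i)); last first.
    by apply/seteqP; split => t /= H i; [move=> _; exact: H|exact: (H i I)].
  apply: fin_bigcap_measurable => [|i _]; first exact: finite_finset.
  by rewrite -[X in measurable X]setTI; apply: measurable_tnth => //; exact: measurable_itv.
- move=> t /= t1 i; rewrite /A/= in_itv/= -ler_norml.
  by have := coord_le_enorm (rV t) i; rewrite mxE => /le_trans; apply.
Qed.

Lemma integral_ball_indic : integral_rV ball_indic = unit_ball_vol.
Proof.
rewrite /integral_rV /Rintegral /unit_ball_vol; congr fine.
pose S := [set t | enorm (rV t) <= 1].
transitivity (\int[lebn]_t (\1_S t)%:E)%E; last first.
  by rewrite integral_indic ?setIT//; exact: measurable_unit_ball.
apply: eq_integral => t _; rewrite /ball_indic indicE; congr EFin.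
by case: ifPn => h; [rewrite mem_set|rewrite memNset//= ; apply/negP].
Qed.

Lemma integral_lapker (e : R) (x : 'rV[R]_n) : 0 < e ->
  integral_rV (fun y => lapker e (y - x)) = n%:R * unit_ball_vol.
Proof.
move=> e0.
transitivity (integral_rV (lapker e)).
  rewrite /integral_rV /Rintegral; congr fine.
  have m0 := measurable_lapker 0 e0.
  rewrite -(@ge0_integral_tshift _ _ (fun i => - x ord0 i) (EFin \o (lapker e \o rV))).
  - apply: eq_integral => t _ /=; congr (lapker e _)%:E.
    by apply/rowP => i; rewrite !mxE tnth_mktuple.
  - apply/measurable_EFinP; move: m0; congr measurable_fun.
    by apply/funext => t /=; rewrite subr0.
  - by move=> t; rewrite lee_fin lapker_ge0.
have ei : integrable_rV (lapker e).
  have := integrable_lapker 0 e0; congr integrable_rV.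
  by apply/funext => t /=; rewrite subr0.
have := null_rV_sum (fun k => null_ballker k e0).
move=> [Si S0].
have di : integrable_rV (fun y : 'rV[R]_n => lapker e y + -1 * \sum_k ballker e k y).
  by apply: integrable_rVD => //; exact: integrable_rVZ.
have mi : measurable_fun [set: n.-tuple (measurableTypeR R)] (ball_indic \o rV).
  apply: measurable_fun_ifT; first exact: measurable_enorm_le1.
    exact: measurable_cst.
  exact: measurable_cst.
(* The trace at parameter 0 vanishes off the origin, so outside the ball the sum of the [ballker] is
   [lapker] itself. *)
have E (y : 'rV[R]_n) : y != 0 -> n%:R * ball_indic y = lapker e y + -1 * \sum_k ballker e k y.
  move=> y0; rewrite /ballker sumrB aker_trace; last by rewrite rho_gt0// gt_eqF.
  rewrite -/(lapker e y) mulN1r opprB addrCA subrr addr0 /ball_indic.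
  case: ifPn => _; first by rewrite sumr_const card_ord mulr1.
  rewrite aker_trace; last by rewrite rho_gt0// y0 orbT.
  by rewrite expr0n/= !mulr0 mul0r.
have ii : integrable_rV (fun y : 'rV[R]_n => n%:R^-1 * `|lapker e y + -1 * \sum_k ballker e k y|).
  by apply: integrable_rVZ; exact: integrable_abse di.
have bi : integrable_rV ball_indic.
  apply: (@integrable_rV_dominated R n _ _ 0 n0 mi ii) => y y0 _.
  rewrite -E// normrM normr_nat mulrA mulVf ?mul1r// pnatr_eq0 -lt0n//.
rewrite -integral_ball_indic -integral_rVZ//.
have -> : integral_rV (lapker e) = integral_rV (fun y : 'rV[R]_n => lapker e y + -1 * \sum_k ballker e k y).
  by rewrite (integral_rVD ei (integrable_rVZ (-1) Si)) (integral_rVZ (-1) Si) S0 mulr0 addr0.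
apply: (@ae_eq_integral_rV _ _ _ _ 0) => //.
- by have /measurable_EFinP := measurable_int _ di.
- by apply: measurable_funM => //; exact: measurable_cst.
- by move=> y y0 _; rewrite E.
Qed.

End ball_volume_integral.

(** The cone over the whole sphere is the closed unit ball without its centre, which is a null
    set. *)
Lemma omegaE (R : realType) (n : nat) : (0 < n)%N ->
  omega R n = n.+1%:R * unit_ball_vol R n.+1.
Proof.
move=> n0; rewrite /omega /sphere_area /unit_ball_vol.
set S := _ @^-1` _; pose B := [set t : n.+1.-tuple (measurableTypeR R) | enorm (rV_of_tuple t) <= 1].
have /andP[B0 Boo] := @unit_ball_vol_pos R n.+1 n0.
have SE : S = B `\` [set t | rV_of_tuple t = 0].
  apply/seteqP; split => t /=; rewrite /S /unit_cone/= /unit_sphere/= enorm_gt0.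
    by move=> [/andP[t0 t1] _]; split => //; apply/eqP.
  move=> [t1 /eqP t0]; rewrite t0 t1; split => //.
  by rewrite /sproj enormZ ger0_norm ?invr_ge0 ?enorm_ge0// mulVf// enorm_eq0.
rewrite (_ : lebesgue_tuple R n.+1 S = lebesgue_tuple R n.+1 B).
  rewrite fineM//= ge0_fin_numE//; exact: Boo.
rewrite SE.
have mB := @measurable_unit_ball R n.+1.
have N : (lebesgue_tuple R n.+1).-negligible [set t | rV_of_tuple t = 0].
  have := @ae_rV_neq R n.+1 0 isT.
  change ((lebesgue_tuple R n.+1).-negligible (~` [set t | rV_of_tuple t != 0]) ->
    (lebesgue_tuple R n.+1).-negligible [set t | rV_of_tuple t = 0]).
  by apply: negligibleS => t /= ->; rewrite eqxx.
have mZ : measurable [set t : n.+1.-tuple (measurableTypeR R) | rV_of_tuple t = 0].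
  have me : measurable_fun [set: n.+1.-tuple (measurableTypeR R)] (@enorm R n.+1 \o @rV_of_tuple R n.+1).
    by apply: (@measurable_continuous_rV _ _ 0) => y _; exact: continuous_enorm.
  have := me measurableT [set 0] (measurable_set1 0); rewrite setTI.
  congr measurable; apply/seteqP; split => t /=.
    by move/eqP; rewrite enorm_eq0 => /eqP.
  by move=> ->; apply/eqP; rewrite enorm_eq0.
rewrite [RHS](measureDI _ mB mZ) [X in (_ + X)%E](_ : _ = 0%E) ?adde0//.
apply/negligibleP; first exact: measurableI.
exact: negligibleS (@subIsetr _ _ _) N.
Qed.

(** * The regularized Laplacian as an approximate identity *)

Section approximation.
Context (R : realType) (n : nat).
Hypothesis n1 : (1 < n)%N.
Local Notation rV := (@rV_of_tuple R n).
Let n0 : (0 < n)%N. Proof. exact: ltnW. Qed.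

Let ei (m : nat) : R := m.+1%:R^-1.
Let ei0 m : 0 < ei m. Proof. by rewrite invr_gt0. Qed.
Let ei1 m : ei m <= 1. Proof. by rewrite invf_le1// ler1n. Qed.

Lemma mx_norm_le_enorm (y : 'rV[R]_n) : `|y| <= enorm y.
Proof.
rewrite /Num.Def.normr/= mx_normrE (bigmax_le _ (enorm_ge0 _))//= => -[i j] _ /=.
by rewrite ord1 coord_le_enorm.
Qed.

Lemma enorm_shift_le (x y : 'rV[R]_n) (r : R) : 0 < r -> r <= enorm (y - x) ->
  1 + enorm y <= ((1 + enorm x) / r + 1) * enorm (y - x).
Proof.
move=> r0 ry; rewrite mulrDl mul1r.
have h1 : 1 + enorm x <= (1 + enorm x) / r * enorm (y - x).
  by rewrite mulrAC ler_pdivlMr// ler_wpM2l ?addr_ge0 ?enorm_ge0.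
have h3 : enorm y <= enorm x + enorm (y - x) by rewrite -{1}(subrKC x y) enormD.
lra.
Qed.

(** As in [rpow_shift_le], with the lower bound [r] on |y - x| in the role of [e]: away from [x] the
    estimate is uniform in [e]. *)
Lemma rpow_far_le (e : R) k (x y : 'rV[R]_n) (r : R) : 0 < r -> r <= enorm (y - x) ->
  rpow e k (y - x) <= ((1 + enorm x) / r + 1) ^+ k / (1 + enorm y) ^+ k.
Proof.
move=> r0 ry.
have z0 : 0 < enorm (y - x) by exact: lt_le_trans ry.
have r1 : 0 < rho e (y - x) by rewrite (lt_le_trans z0)// enorm_le_rho.
have y1 : 0 < 1 + enorm y by rewrite ltr_pwDl// enorm_ge0.
rewrite /rpow -expr_div_n; apply: lerXn2r; rewrite ?nnegrE ?invr_ge0 ?(ltW r1)//.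
  by rewrite divr_ge0 ?(ltW y1)// addr_ge0 ?divr_ge0 ?addr_ge0 ?enorm_ge0// ltW.
rewrite ler_pdivlMr// mulrC ler_pdivrMr//.
apply: (le_trans (enorm_shift_le r0 ry)); rewrite ler_wpM2l ?enorm_le_rho//.
by rewrite addr_ge0 ?divr_ge0 ?addr_ge0 ?enorm_ge0// ltW.
Qed.

Lemma wgt1_ge k (y : 'rV[R]_n) : y != 0 -> ((1 + enorm y) ^+ (n + k.+1))^-1 <= wgt 1 0 y.
Proof.
move=> y0; rewrite wgt1E; have y1 : 0 < enorm y by rewrite enorm_gt0.
rewrite exprD invfM mulrC ler_wpM2r ?invr_ge0 ?exprn_ge0 ?addr_ge0 ?(ltW y1)//.
rewrite lef_pV2 ?posrE ?exprn_gt0 ?addr_gt0// (@le_trans _ _ (1 + enorm y))// ?lerDr//.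
by rewrite -[leLHS]expr1 ler_weXn2l// lerDl enorm_ge0.
Qed.

Section approximate_identity.
Variables (x : 'rV[R]_n) (Q : 'rV[R]_n -> R) (C : R).
Hypotheses (x0 : x != 0) (cQ : forall y, y != 0 -> {for y, continuous Q})
  (QC : forall y, y != 0 -> `|Q y| <= C / enorm y).

Let C0 : 0 <= C.
Proof.
have := le_trans (normr_ge0 _) (QC x0).
by rewrite pmulr_lge0// invr_gt0 enorm_gt0.
Qed.

Let mQ : measurable_fun [set: n.-tuple (measurableTypeR R)] (Q \o rV).
Proof. exact: measurable_continuous_rV cQ. Qed.

Lemma integrable_lapkerM (e : R) : 0 < e -> integrable_rV (fun y => lapker e (y - x) * Q y).
Proof.
move=> e0; pose c := (1 + enorm x) / e + 1.
have c0 : 0 <= c by rewrite addr_ge0// divr_ge0 ?addr_ge0 ?enorm_ge0 ?(ltW e0).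
apply: (@integrable_rV_dominated R n _
  (fun y => (n%:R * e ^+ 2 * c ^+ n.+2 * C) * wgt 1 0 y) 0) => //.
- by apply: measurable_funM => //; exact: measurable_lapker.
- by apply: integrable_rVZ; apply: integrable_wgt => //; rewrite ltr01 ltr1n.
move=> y y0 _; rewrite normrM (ger0_norm (lapker_ge0 _ _)) /lapker wgt1E.
have y1 : 0 < enorm y by rewrite enorm_gt0.
have h1 := rpow_shift_le n.+2 x y e0; rewrite -/c in h1.
have h2 : c ^+ n.+2 / (1 + enorm y) ^+ n.+2 <= c ^+ n.+2 / (1 + enorm y) ^+ n.
  rewrite ler_wpM2l ?exprn_ge0// lef_pV2 ?posrE ?exprn_gt0 ?addr_gt0//.
  by rewrite ler_weXn2l ?lerDl ?enorm_ge0// -addn2 leq_addr.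
have k0 : 0 <= n%:R * e ^+ 2 by rewrite mulr_ge0 ?ler0n ?sqr_ge0.
apply: (@le_trans _ _ ((n%:R * e ^+ 2 * (c ^+ n.+2 / (1 + enorm y) ^+ n)) * (C / enorm y))).
  apply: ler_pM => //; last exact: QC.
    by rewrite mulr_ge0// rpow_ge0.
  by rewrite ler_wpM2l// (le_trans h1).
by rewrite le_eqVlt; apply/orP; left; apply/eqP; ring.
Qed.

(** Within [r] of [x] the oscillation of [Q] is at most [d]. Farther away [lapker] carries the
    factor e^2, and the remaining decay together with the singularity C/|y| of [Q] is absorbed by
    [wgt 1 0]. *)
Lemma lapker_diff_le (d r e : R) (y : 'rV[R]_n) : 0 < r -> 0 <= d ->
  (forall y, enorm (y - x) <= r -> `|Q x - Q y| <= d) -> y != 0 ->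
  `|lapker e (y - x) * (Q x - Q y)| <= d * lapker e (y - x) +
    e ^+ 2 * (n%:R * ((1 + enorm x) / r + 1) ^+ n.+2 * (`|Q x| + C)) * wgt 1 0 y.
Proof.
move=> r0 d0 Qd y0; rewrite normrM (ger0_norm (lapker_ge0 _ _)).
set c := (1 + enorm x) / r + 1.
have c0 : 0 <= c by rewrite addr_ge0// divr_ge0 ?addr_ge0 ?enorm_ge0 ?(ltW r0).
have [zr|zr] := leP (enorm (y - x)) r.
  rewrite -[leLHS]addr0 lerD//; first by rewrite mulrC ler_wpM2r ?lapker_ge0// Qd.
  apply: mulr_ge0; last exact: wgt_ge0.
  apply: mulr_ge0; first exact: sqr_ge0.
  by apply: mulr_ge0; [rewrite mulr_ge0 ?exprn_ge0// ler0n|exact: addr_ge0].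
rewrite -[leLHS]add0r lerD//; first by rewrite mulr_ge0 ?lapker_ge0.
have h := rpow_far_le e n.+2 r0 (ltW zr); rewrite -/c in h.
have y1 : 0 < enorm y by rewrite enorm_gt0.
have w1 : ((1 + enorm y) ^+ n.+2)^-1 <= wgt 1 0 y by have := wgt1_ge 1 y0; rewrite addn2.
have w2 : ((1 + enorm y) ^+ n.+2)^-1 / enorm y <= wgt 1 0 y.
  rewrite wgt1E mulrC ler_wpM2l ?invr_ge0 ?(ltW y1)// lef_pV2 ?posrE ?exprn_gt0 ?addr_gt0//.
  by rewrite ler_weXn2l ?lerDl ?enorm_ge0// -addn2 leq_addr.
have k0 : 0 <= n%:R * e ^+ 2 by rewrite mulr_ge0 ?ler0n ?sqr_ge0.
have q0 : 0 <= c ^+ n.+2 by rewrite exprn_ge0.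
apply: (@le_trans _ _ ((n%:R * e ^+ 2 * (c ^+ n.+2 / (1 + enorm y) ^+ n.+2)) * (`|Q x| + C / enorm y))).
  apply: ler_pM => //; first exact: lapker_ge0.
    by rewrite /lapker ler_wpM2l.
  by rewrite (le_trans (ler_normB _ _))// lerD2l QC.
have -> : (n%:R * e ^+ 2 * (c ^+ n.+2 / (1 + enorm y) ^+ n.+2)) * (`|Q x| + C / enorm y) =
  (n%:R * e ^+ 2 * c ^+ n.+2) * (`|Q x| * ((1 + enorm y) ^+ n.+2)^-1 +
     C * (((1 + enorm y) ^+ n.+2)^-1 / enorm y)) by ring.
have -> : e ^+ 2 * (n%:R * c ^+ n.+2 * (`|Q x| + C)) * wgt 1 0 y =
  (n%:R * e ^+ 2 * c ^+ n.+2) * (`|Q x| * wgt 1 0 y + C * wgt 1 0 y) by ring.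
apply: ler_wpM2l; first exact: mulr_ge0.
by apply: lerD; apply: ler_wpM2l.
Qed.

Lemma lapker_approximate_identity :
  integral_rV (fun y => lapker (ei m) (y - x) * Q y) @[m --> \oo] -->
  n%:R * unit_ball_vol R n * Q x.
Proof.
apply/cvgrPdist_le => eps eps0.
pose vol := n%:R * unit_ball_vol R n.
have v0 : 0 <= vol.
  by rewrite mulr_ge0// fine_ge0.
(* Near [x] the error is at most [d * vol], hence at most eps/2; adding 1 keeps the denominator
   positive. *)
pose d := eps / 2 / (vol + 1).
have d0 : 0 < d by rewrite !divr_gt0// ltr_wpDl.
have [r r0 Qr] : exists2 r, 0 < r & forall y, enorm (y - x) <= r -> `|Q x - Q y| <= d.
  (* The neighbourhood is a ball of the sup norm, which [enorm] dominates; halving the radius passes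
     to a non-strict inequality. *)
  have /cvgrPdist_le/(_ _ d0)/nbhs_ballP[r /= r0 rQ] := cQ x0.
  exists (r / 2); first by rewrite divr_gt0.
  move=> y yr; apply: rQ; rewrite -ball_normE/= distrC.
  rewrite (le_lt_trans (mx_norm_le_enorm _))// (le_lt_trans yr)//.
  by rewrite ltr_pdivrMr// ltr_pMr// ltr1n.
pose K := n%:R * ((1 + enorm x) / r + 1) ^+ n.+2 * (`|Q x| + C).
have wi : integrable_rV (wgt 1 (0 : 'rV[R]_n)).
  by apply: integrable_wgt => //; rewrite ltr01 ltr1n.
pose W := integral_rV (wgt 1 (0 : 'rV[R]_n)).
have K0 : 0 <= K.
  apply: mulr_ge0; last exact: addr_ge0.
  apply: mulr_ge0; first exact: ler0n.
  by rewrite exprn_ge0// addr_ge0// divr_ge0 ?addr_ge0 ?enorm_ge0 ?(ltW r0).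
have W0 : 0 <= W by apply: Rintegral_ge0 => t _; exact: wgt_ge0.
have KW : 0 < K * W + 1 by rewrite ltr_wpDl// mulr_ge0.
have q0 : 0 < eps / 2 / (K * W + 1) by rewrite !divr_gt0.
near=> m.
have e0 := ei0 m; set e := ei m in e0 *.
have hei := integrable_lapker n1 x e0.
have hQi := integrable_lapkerM e0.
rewrite -(integral_lapker n1 x e0) mulrC -(integral_rVZ (Q x) hei).
rewrite -mulN1r -(integral_rVZ (-1) hQi) -integral_rVD; last 2 first.
- exact: integrable_rVZ.
- exact: integrable_rVZ.
have E : (fun y => Q x * lapker e (y - x) + -1 * (lapker e (y - x) * Q y)) =
    (fun y => lapker e (y - x) * (Q x - Q y)) by apply/funext => y; ring.
have di : integrable_rV (fun y => lapker e (y - x) * (Q x - Q y)).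
  by rewrite -E; apply: integrable_rVD; exact: integrable_rVZ.
rewrite E.
pose g y := d * lapker e (y - x) + e ^+ 2 * K * wgt 1 0 y.
have gi : integrable_rV g by apply: integrable_rVD; exact: integrable_rVZ.
have Eg : integral_rV g = d * vol + e ^+ 2 * K * W.
  rewrite /g integral_rVD; [|exact: integrable_rVZ|exact: integrable_rVZ].
  by rewrite (integral_rVZ d hei) (integral_rVZ (e ^+ 2 * K) wi) integral_lapker.
apply: (@le_trans _ _ (integral_rV g)).
  by apply: (@le_norm_integral_rV R n _ _ 0) => // y y0 _; exact: (lapker_diff_le e r0 (ltW d0) Qr y0).
rewrite Eg [leRHS]splitr lerD//.
  rewrite /d mulrAC ler_pdivrMr ?ltr_wpDl// ler_wpM2l ?divr_ge0 ?(ltW eps0)//.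
  by rewrite lerDl.
rewrite -mulrA (@le_trans _ _ (e * (K * W)))//.
  apply: ler_wpM2r; first exact: mulr_ge0.
  by rewrite expr2 ler_piMr ?(ltW e0)// ei1.
have eKW : e <= eps / 2 / (K * W + 1).
  apply: ltW; rewrite /e /ei; near: m.
  exact: (near_infty_natSinv_lt (PosNum q0)).
apply: (@le_trans _ _ (e * (K * W + 1))); first by rewrite ler_wpM2l ?(ltW e0)// lerDl.
by rewrite -ler_pdivlMr.
Unshelve. all: by end_near. Qed.

End approximate_identity.
End approximation.

(** * Passage to the limit: second derivatives from the Laplacian *)

Section representation.
Context (R : realType) (n : nat).
Hypothesis n1 : (1 < n)%N.
Local Notation rV := (@rV_of_tuple R n).
Let n0 : (0 < n)%N. Proof. exact: ltnW. Qed.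
Variables (x xi : 'rV[R]_n) (B : 'I_n -> 'rV[R]_n -> R)
  (H : 'I_n -> 'I_n -> 'rV[R]_n -> R) (C : R).
Hypotheses (x0 : x != 0)
  (dB : forall k j y, y != 0 -> is_derive y (delta_mx ord0 j) (B k) (H k j y))
  (cB : forall k y, y != 0 -> {for y, continuous (B k)})
  (cH : forall k j y, y != 0 -> {for y, continuous (H k j)})
  (symH : forall k j y, y != 0 -> H k j y = H j k y)
  (BC : forall k y, y != 0 -> `|B k y| <= C)
  (HC : forall k j y, y != 0 -> `|H k j y| <= C / enorm y).

Let G y := \sum_k H k k y.
Let Q y := \sum_i \sum_j xi ord0 i * xi ord0 j * H i j y.

Variables (r a C' : R).
Hypotheses (r0 : 0 < r) (a01 : 0 < a < 1)
  (GC' : forall y, y != 0 -> enorm (y - x) <= r -> `|G y| <= C' * enorm (y - x) `^ a).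

Let cG y : y != 0 -> {for y, continuous G}.
Proof. by move=> y0; apply: continuous_sumr => k; exact: cH. Qed.

Let cQ y : y != 0 -> {for y, continuous Q}.
Proof.
move=> y0; apply: continuous_sumr => i; apply: continuous_sumr => j.
by apply: continuousM; [exact: cst_continuous|exact: cH].
Qed.

Let CG : R := n%:R * C.
Let G_le y : y != 0 -> `|G y| <= CG / enorm y.
Proof.
move=> y0; rewrite (le_trans (ler_norm_sum _ _ _))//.
apply: (@le_trans _ _ (\sum_(k < n) C / enorm y)); first by apply: ler_sum => k _; exact: HC.
by rewrite sumr_const card_ord -mulr_natl mulrA.
Qed.

Let CQ : R := \sum_i \sum_j `|xi ord0 i * xi ord0 j| * C.
Let Q_le y : y != 0 -> `|Q y| <= CQ / enorm y.
Proof.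
move=> y0; rewrite (le_trans (ler_norm_sum _ _ _))// /CQ mulr_suml ler_sum// => i _.
rewrite (le_trans (ler_norm_sum _ _ _))// mulr_suml ler_sum// => j _.
by rewrite normrM -mulrA ler_wpM2l// HC.
Qed.

Let C0 : 0 <= C.
Proof.
exact: le_trans (normr_ge0 _) (BC (Ordinal n0) x0).
Qed.

Let CG0 : 0 <= CG. Proof. by rewrite mulr_ge0 ?ler0n. Qed.

Let mG : measurable_fun [set: n.-tuple (measurableTypeR R)] (G \o rV).
Proof. exact: measurable_continuous_rV cG. Qed.

Lemma measurable_aker_shift e :
  measurable_fun [set: n.-tuple (measurableTypeR R)] ((fun y => aker e xi xi (y - x)) \o rV).
Proof.
apply: (@measurable_continuous_rV _ _ x) => y yx.
have : {for y, continuous (aker e xi xi \o (fun y => y - x))}; last by [].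
apply: continuous_comp.
  by apply: continuousB; [exact: cvg_id|exact: cst_continuous].
by apply: continuous_aker; rewrite rho_gt0// subr_eq0 yx orbT.
Qed.

Let K : R := n.+1%:R * (enorm xi * enorm xi).
Let K0 : 0 <= K. Proof. by rewrite mulr_ge0 ?ler0n// mulr_ge0 ?enorm_ge0. Qed.
Let c : R := (1 + enorm x) / r + 1.
Let c0 : 0 <= c.
Proof. by rewrite addr_ge0// divr_ge0 ?addr_ge0 ?enorm_ge0 ?(ltW r0). Qed.
(** Dominates kernel times [G] for all [e] at once. Within [r] of [x] the kernel is O(|y - x|^-n)
    and [G] gives back |y - x|^a; farther away the kernel is O((1 + |y|)^-n) and [G] is O(1/|y|). *)
Let D y : R := K * `|C'| * (1 + r) ^+ n * wgt (n%:R - a) x y + K * c ^+ n * CG * wgt 1 0 y.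

Let D_int : integrable_rV D.
Proof.
have /andP[a0 a1] := a01.
apply: integrable_rVD; apply: integrable_rVZ; apply: integrable_wgt => //.
  rewrite subr_gt0 (lt_le_trans a1) ?ler1n//=.
  by rewrite ltrBlDr ltrDl.
by rewrite ltr01 ltr1n.
Qed.

Let dom e y : y != 0 -> y != x -> `|aker e xi xi (y - x) * G y| <= D y.
Proof.
move=> y0 yx; have y1 : 0 < enorm y by rewrite enorm_gt0.
have z0 : 0 < enorm (y - x) by rewrite enorm_gt0 subr_eq0.
have rz : 0 < rho e (y - x) by rewrite rho_gt0// subr_eq0 yx orbT.
rewrite normrM.
have hA : `|aker e xi xi (y - x)| <= K * rpow e n (y - x) by exact: aker_le.
have [zr|zr] := leP (enorm (y - x)) r.
  rewrite /D -[leLHS]addr0 lerD//; last first.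
    by apply: mulr_ge0 (wgt_ge0 _ _ _); apply: mulr_ge0 CG0; rewrite mulr_ge0 ?exprn_ge0.
  have hr : rpow e n (y - x) <= (enorm (y - x))^-1 ^+ n.
    apply: lerXn2r; rewrite ?nnegrE ?invr_ge0 ?(ltW rz) ?(ltW z0)//.
    by rewrite lef_pV2// enorm_le_rho.
  have hG : `|G y| <= `|C'| * enorm (y - x) `^ a.
    by rewrite (le_trans (GC' y0 zr))// ler_wpM2r ?powR_ge0// ler_norm.
  apply: (@le_trans _ _ (K * (enorm (y - x))^-1 ^+ n * (`|C'| * enorm (y - x) `^ a))).
    by apply: ler_pM => //; rewrite (le_trans hA)// ler_wpM2l.
  rewrite /wgt opprB powRD; last by rewrite (gt_eqF z0) implybT.
  rewrite powRN powR_mulrn ?(ltW z0)//.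
  rewrite (_ : K * (enorm (y - x))^-1 ^+ n * (`|C'| * enorm (y - x) `^ a) =
    K * `|C'| * (enorm (y - x) `^ a / enorm (y - x) ^+ n)); last by rewrite exprVn; ring.
  rewrite -[leRHS]mulrA (ler_wpM2l (mulr_ge0 K0 (normr_ge0 C')))//.
  rewrite [leRHS]mulrCA ler_peMr ?divr_ge0 ?powR_ge0 ?exprn_ge0 ?(ltW z0)//.
  rewrite ler_pdivlMr ?exprn_gt0 ?addr_gt0// mul1r.
  by apply: lerXn2r; rewrite ?nnegrE ?addr_ge0 ?(ltW z0) ?(ltW r0)// lerD2l.
rewrite /D -[leLHS]add0r lerD//.
  apply: mulr_ge0 (wgt_ge0 _ _ _); apply: mulr_ge0; first exact: mulr_ge0.
  by rewrite exprn_ge0// addr_ge0// ltW.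
have hf := rpow_far_le e n r0 (ltW zr); rewrite -/c in hf.
apply: (@le_trans _ _ (K * (c ^+ n / (1 + enorm y) ^+ n) * (CG / enorm y))).
  apply: ler_pM => //; last exact: G_le.
  by rewrite (le_trans hA)// ler_wpM2l.
by rewrite wgt1E le_eqVlt; apply/orP; left; apply/eqP; ring.
Qed.

Lemma integrable_akerM e : integrable_rV (fun y => aker e xi xi (y - x) * G y).
Proof.
apply: (@integrable_rV_dominated R n _ D x) => //; last exact: dom.
by apply: measurable_funM => //; exact: measurable_aker_shift.
Qed.

Let ei (m : nat) : R := m.+1%:R^-1.
Let ei0 m : 0 < ei m. Proof. by rewrite invr_gt0. Qed.

Lemma continuous_aker_param z : z != 0 -> {for 0, continuous (fun e => aker e xi xi z)}.
Proof.
move=> z0; have r0z : rho 0 z != 0 by rewrite gt_eqF// rho_gt0// z0 orbT.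
have cr k : {for 0, continuous (fun e => rpow e k z)}.
  have : {for 0, continuous ((fun t : R => t ^+ k) \o (fun t => t^-1) \o
    (Num.sqrt \o (fun e : R => dotp z z + e ^+ 2)))}; last by [].
  apply: continuous_comp; last first.
    by apply: continuous_comp; [exact: inv_continuous|exact: exprn_continuous].
  apply: continuous_comp; last exact: sqrt_continuous.
  by apply: continuousD; [exact: cst_continuous|exact: exprn_continuous].
by apply: continuousB; apply: continuousM; try exact: cst_continuous; exact: cr.
Qed.

Lemma cvg_integral_aker :
  integral_rV (fun y => aker (ei m) xi xi (y - x) * G y) @[m --> \oo] -->
  integral_rV (fun y => aker 0 xi xi (y - x) * G y).
Proof.
have mA e : measurable_fun [set: n.-tuple (measurableTypeR R)]
    (EFin \o ((fun y => aker e xi xi (y - x) * G y) \o rV)).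
  by apply/measurable_EFinP; apply: measurable_funM => //; exact: measurable_aker_shift.
have [] // := @dominated_convergence _ _ _ (lebesgue_tuple R n) setT measurableT
  (fun m => EFin \o ((fun y => aker (ei m) xi xi (y - x) * G y) \o rV))
  (EFin \o ((fun y => aker 0 xi xi (y - x) * G y) \o rV)) (EFin \o (D \o rV)).
- apply: (@filterS _ _ (ae_filter_ringOfSetsType (lebesgue_tuple R n)) _ _ _
    (ae_rV_neq x n0)) => t tx _ /=.
  apply: cvg_EFin; first exact: nearW.
  apply: cvgM; last exact: cvg_cst.
  have e_cvg : ei m @[m --> \oo] --> (0 : R) by exact: cvg_harmonic.
  apply: (@cvg_comp _ _ _ ei (fun e => aker e xi xi (rV t - x)) _ _ _ e_cvg).
  by apply: continuous_aker_param; rewrite subr_eq0.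
- apply: (@filterS2 _ _ (ae_filter_ringOfSetsType (lebesgue_tuple R n)) _ _ _ _
    (ae_rV_neq 0 n0) (ae_rV_neq x n0)) => t t0 tx m _ /=.
  by rewrite lee_fin dom.
move=> _ _ h; rewrite /integral_rV /Rintegral.
apply: fine_cvg; rewrite fineK; first exact: h.
by apply: integrable_fin_num => //; exact: integrable_akerM.
Qed.

Lemma second_derivative_representation :
  integral_rV (fun y => aker 0 xi xi (y - x) * G y) = n%:R * unit_ball_vol R n * Q x.
Proof.
have cv1 := cvg_integral_aker.
have cv2 := lapker_approximate_identity n1 x0 cQ Q_le.
rewrite -(cvg_lim _ cv1)// -(cvg_lim _ cv2)//; congr (lim (_ @ \oo)); apply/funext => m.
have [Ni N0] := integral_aker_laplacian x n1 (ei0 m) xi dB cB cH symH BC HC.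
have i1 := integrable_akerM (ei m).
have i2 := integrable_lapkerM n1 x cQ Q_le (ei0 m).
apply/eqP; rewrite -subr_eq0 -mulN1r -(integral_rVZ (-1) i2) -integral_rVD//; last exact: integrable_rVZ.
rewrite -[X in _ == X]N0; apply/eqP; congr integral_rV.
by apply/funext => y; rewrite /lapker /G /Q; ring.
Qed.

End representation.

(** * Symmetry of mixed second derivatives *)

Section mixed_derivatives.
Context (R : realType) (V : normedModType R).

Lemma MVT_line (f : V -> R) (y v : V) (t : R) : 0 < t ->
  (forall a, 0 <= a <= t -> derivable f (a *: v + y) v) ->
  exists2 a, 0 <= a <= t & f (t *: v + y) - f y = t * 'D_v f (a *: v + y).
Proof.
move=> t0 df.
have d1 (a : R) : 0 <= a <= t ->
    is_derive a 1 (fun a => f (a *: v + y)) ('D_v f (a *: v + y)).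
  by move=> /df dfa; apply: is_derive_line; exact: derivableP.
have [||a] := @MVT_segment R (fun a => f (a *: v + y)) (fun a => 'D_v f (a *: v + y)) 0 t (ltW t0).
- by move=> a /[!in_itv]/= /andP[/ltW a0 /ltW at']; apply: d1; rewrite a0.
- apply: continuous_in_subspaceT => a /[!inE]/= /[!in_itv]/= /d1[dfa _].
  exact/differentiable_continuous/derivable1_diffP.
rewrite in_itv/= scale0r add0r subr0 mulrC => a0t E.
by exists a.
Qed.

(** The mean value theorem twice: along [s] for the increment in the direction [v], then along [v]
    for the derivative along [s]. *)
Lemma second_difference (f : V -> R) (y s v : V) (t : R) : 0 < t ->
  (forall a b : R, 0 <= a <= t -> 0 <= b <= t ->
    derivable f (a *: s + (b *: v + y)) s /\
    derivable ('D_s f) (b *: v + (a *: s + y)) v) ->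
  exists a b : R, [/\ 0 <= a <= t, 0 <= b <= t &
    f (t *: s + (t *: v + y)) - f (t *: s + y) - f (t *: v + y) + f y =
    t * (t * 'D_v ('D_s f) (b *: v + (a *: s + y)))].
Proof.
move=> t0 df; have tt : 0 <= t <= t by rewrite lexx ltW.
have zt : (0 : R) <= 0 <= t by rewrite lexx ltW.
pose g p := f (t *: v + p) - f p.
have gd (a : R) : 0 <= a <= t ->
    is_derive (a *: s + y) s g ('D_s f (t *: v + (a *: s + y)) - 'D_s f (a *: s + y)).
  move=> at'; apply: is_deriveB; last first.
    by have [d _] := df a 0 at' zt; rewrite scale0r add0r in d; exact: derivableP.
  have [d _] := df a t at' tt; rewrite addrCA in d.
  rewrite (_ : (fun p => f (t *: v + p)) = (fun p => f (p - - (t *: v)))); last first.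
    by apply/funext => p; rewrite opprK addrC.
  apply: is_derive_translate; rewrite opprK addrC.
  exact: derivableP.
have [a at' gE] := MVT_line t0 (fun a h => @ex_derive _ _ _ _ _ _ _ (gd a h)).
have [b bt hE] := @MVT_line ('D_s f) (a *: s + y) v t t0 (fun b hb => (df a b at' hb).2).
exists a, b; split => //.
rewrite -hE; have [_ <-] := gd a at'; rewrite -gE /g.
by rewrite addrCA; ring.
Qed.

(** The second difference is symmetric in [s] and [v], so the two mixed derivatives agree at two
    possibly different points close to [y]; continuity brings both values back to [y]. *)
Lemma derive_comm (f : V -> R) (y s v : V) :
  (\forall p \near y, [/\ derivable f p s, derivable f p v,
     derivable ('D_s f) p v & derivable ('D_v f) p s]) ->
  {for y, continuous ('D_v ('D_s f))} -> {for y, continuous ('D_s ('D_v f))} ->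
  'D_v ('D_s f) y = 'D_s ('D_v f) y.
Proof.
move=> df c1 c2; apply/eqP; rewrite -subr_eq0 -normr_eq0 eq_le normr_ge0 andbT.
apply/ler_addgt0Pl => e e0; rewrite addr0.
have e2 : 0 < e / 2 by rewrite divr_gt0.
have /cvgrPdist_le/(_ _ e2) n1 := c1; have /cvgrPdist_le/(_ _ e2) n2 := c2.
have [d /= d0 dP] := (nbhs_ballP _ _).1 (filterI df (filterI n1 n2)).
(* With this choice t (|s| + |v| + 1) = d/2, so the whole parallelogram lies in the ball of radius
   [d]. *)
pose t := d / 2 / (`|s| + `|v| + 1).
have sv : 0 < `|s| + `|v| + 1 by rewrite ltr_wpDl// addr_ge0.
have t0 : 0 < t by rewrite !divr_gt0.
have near_y (a b : R) : 0 <= a <= t -> 0 <= b <= t -> ball y d (a *: s + (b *: v + y)).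
  move=> /andP[a0 at'] /andP[b0 bt]; rewrite -ball_normE/= addrA opprD addrCA subrr addr0 normrN.
  rewrite (le_lt_trans (ler_normD _ _))// !normrZ (ger0_norm a0) (ger0_norm b0).
  apply: (@le_lt_trans _ _ (t * (`|s| + `|v| + 1))).
    rewrite -addrA 2!mulrDr lerD ?ler_wpM2r// -[leLHS]addr0 lerD ?ler_wpM2r// mulr1 ltW//.
  by rewrite /t divfK ?gt_eqF// ltr_pdivrMr// ltr_pMr// ltr1n.
have [|a [b [at' bt E1]]] := @second_difference f y s v t t0.
  move=> a b at' bt; have [[h1 _ h3 _] _] := dP _ (near_y a b at' bt); split; first exact: h1.
  by rewrite addrCA; exact: h3.
have [|b' [a' [bt' at2 E2]]] := @second_difference f y v s t t0.
  move=> b' a' bt' at2; have [[_ h2 _ h4] _] := dP _ (near_y a' b' at2 bt'); split; last exact: h4.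
  by rewrite addrCA; exact: h2.
have E : 'D_v ('D_s f) (b *: v + (a *: s + y)) = 'D_s ('D_v f) (a' *: s + (b' *: v + y)).
  apply: (mulfI (lt0r_neq0 t0)); apply: (mulfI (lt0r_neq0 t0)).
  refine (etrans (esym E1) (etrans _ E2)).
  by rewrite (addrCA (t *: s)); congr (_ + _); exact: addrAC.
have [_ [h1 _]] := dP _ (near_y a b at' bt).
have [_ [_ h2]] := dP _ (near_y a' b' at2 bt').
rewrite addrCA in h1.
rewrite /= E in h1.
rewrite /= in h2; move: h1 h2.
move: ('D_v ('D_s f) y) ('D_s ('D_v f) y) ('D_s ('D_v f) (a' *: s + _)) => A A' M h1 h2.
rewrite (_ : A - A' = (A - M) - (A' - M)); last by ring.
by apply: (le_trans (ler_normB _ _)); rewrite [leRHS]splitr; exact: lerD.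
Qed.

End mixed_derivatives.

(** * Derivatives of homogeneous functions *)

Section homogeneous.
Context (R : realType) (V : normedModType R).

Lemma near_neq0 (y : V) : y != 0 -> \forall p \near y, p != 0.
Proof. by move=> y0; apply: (@cvgr_neq0 _ _ _ _ _ id y). Qed.

Lemma is_derive_scale (f : V -> R) (c : R) (x v : V) (df : R) :
  is_derive (c *: x) (c *: v) f df -> is_derive x v (fun p => f (c *: p)) df.
Proof.
move=> [fd fE].
have E : (fun h => h^-1 *: (((fun p => f (c *: p)) \o shift x) (h *: v) - f (c *: x))) =
         (fun h => h^-1 *: ((f \o shift (c *: x)) (h *: (c *: v)) - f (c *: x))) :> (R -> R).
  by apply/funext => h /=; congr (_ *: (f _ - _)); rewrite scalerDr !scalerA mulrC.
by split; rewrite /derivable /derive E.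
Qed.

Lemma derive_homogeneous (g : V -> R) (l m : R) (y v : V) : l != 0 -> y != 0 ->
  (forall q, q != 0 -> g (l *: q) = m * g q) -> differentiable g y ->
  is_derive (l *: y) v g (m / l * 'D_v g y).
Proof.
move=> l0 y0 gl dg.
have d1 : is_derive (l^-1 *: (l *: y)) (l^-1 *: v) g (l^-1 * 'D_v g y).
  rewrite scalerA mulVf// scale1r; split; first exact: diff_derivable.
  by rewrite !deriveE// linearZ.
have d2 := is_deriveZ m (is_derive_scale d1).
rewrite -mulrA; apply: near_eq_is_derive d2; near=> q.
change (m * g (l^-1 *: q) = g q); rewrite -gl; first by rewrite scalerA mulfV// scale1r.
rewrite scaler_eq0 invr_eq0 negb_or l0/=; near: q; apply: near_neq0.
by rewrite scaler_eq0 negb_or l0.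
Unshelve. all: by end_near. Qed.

Lemma derive_radial0 (W : normedModType R) (g : V -> W) (y : V) :
  (forall l, 0 < l -> g (l *: y) = g y) -> 'D_y g y = 0.
Proof.
move=> gl; apply: cvg_lim => //.
apply: cvg_near_cst; near=> h.
rewrite /= -[X in _ *: _ + X]scale1r -scalerDl gl ?subrr ?scaler0//.
have h1 : `|h| < 1 by near: h; exact: dnbhs0_lt.
by move: h1; rewrite ltr_norml => /andP[h1 _]; rewrite -ltrBlDr sub0r.
Unshelve. all: by end_near. Qed.

End homogeneous.

(** * Gradient and Hessian of the degree-one extension *)

Section sphere_function.
Context (R : realType) (n : nat) (u : 'rV[R]_n.+1 -> R).
Hypothesis C2u : C2_sphere u.
Local Notation E := 'rV[R]_n.+1.
Local Notation d_ i := (delta_mx ord0 i : E).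

Let w : E -> R := ext0 u.
Let w1 i : E -> R := 'D_(d_ i) w.
Let w2 i j : E -> R := 'D_(d_ j) (w1 i).

Let w_diff y : y != 0 -> differentiable w y.
Proof. by have [[h _] _] := C2u; exact: h. Qed.
Let w1_cont i y : y != 0 -> {for y, continuous (w1 i)}.
Proof. by have [[_ h] _] := C2u; exact: h. Qed.
Let w1_diff i y : y != 0 -> differentiable (w1 i) y.
Proof. by have [_ h] := C2u; have [h1 _] := h (d_ i); exact: h1. Qed.
Let w2_cont i j y : y != 0 -> {for y, continuous (w2 i j)}.
Proof. by have [_ h] := C2u; have [_ h1] := h (d_ i); exact: h1. Qed.

Let w_cont y : y != 0 -> {for y, continuous w}.
Proof. by move=> /w_diff /differentiable_continuous. Qed.

Let w2_sym i j y : y != 0 -> w2 i j y = w2 j i y.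
Proof.
move=> y0; apply: derive_comm; [|exact: w2_cont|exact: w2_cont].
apply: filterS (near_neq0 y0) => p p0.
split; apply: diff_derivable; [exact: w_diff|exact: w_diff|exact: w1_diff|exact: w1_diff].
Qed.

Lemma sprojZ (l : R) (y : E) : 0 < l -> sproj (l *: y) = sproj y.
Proof.
move=> l0; rewrite /sproj enormZ gtr0_norm// scalerA invfM mulrAC mulVf ?mul1r//.
by rewrite gt_eqF.
Qed.

Lemma sproj_neq0 (y : E) : y != 0 -> sproj y != 0.
Proof. by move=> y0; rewrite /sproj scaler_eq0 invr_eq0 enorm_eq0 negb_or y0. Qed.

Lemma enorm_sproj (y : E) : y != 0 -> enorm (sproj y) = 1.
Proof.
move=> y0; rewrite /sproj enormZ ger0_norm ?invr_ge0 ?enorm_ge0//.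
by rewrite mulVf// enorm_eq0.
Qed.

Lemma sprojK (y : E) : y != 0 -> enorm y *: sproj y = y.
Proof. by move=> y0; rewrite /sproj scalerA mulfV ?scale1r// enorm_eq0. Qed.

Lemma sproj_id (y : E) : enorm y = 1 -> sproj y = y.
Proof. by rewrite /sproj => ->; rewrite invr1 scale1r. Qed.

Let wZ (l : R) (y : E) : 0 < l -> w (l *: y) = w y.
Proof. by move=> l0; rewrite /w /ext0 sprojZ. Qed.

Lemma partial_ext0Z i (l : R) (y : E) : 0 < l -> y != 0 -> w1 i (l *: y) = l^-1 * w1 i y.
Proof.
move=> l0 y0; have ln0 : l != 0 by rewrite gt_eqF.
have [_ H] := @derive_homogeneous _ _ w l 1 y (d_ i) ln0 y0
  (fun q _ => etrans (wZ q l0) (esym (mul1r _))) (w_diff y0).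
by rewrite /w1 H mul1r.
Qed.

Let w2Z i j (l : R) (y : E) : 0 < l -> y != 0 -> w2 i j (l *: y) = l^-1 ^+ 2 * w2 i j y.
Proof.
move=> l0 y0; have ln0 : l != 0 by rewrite gt_eqF.
have [_ H] := @derive_homogeneous _ _ (w1 i) l l^-1 y (d_ j) ln0 y0
  (fun q q0 => partial_ext0Z i l0 q0) (w1_diff i y0).
by rewrite /w2 H expr2.
Qed.

Lemma derive_sum_coord (g : E -> R) (y v : E) : differentiable g y ->
  'D_v g y = \sum_i v ord0 i * 'D_(d_ i) g y.
Proof.
move=> dg; rewrite deriveE// [X in 'd g y X]row_sum_delta linear_sum.
by apply: eq_bigr => i _; rewrite linearZ deriveE.
Qed.

Lemma euler (y : E) : y != 0 -> \sum_i y ord0 i * w1 i y = 0.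
Proof.
move=> y0; rewrite -derive_sum_coord; last exact: w_diff.
by apply: derive_radial0 => l l0; exact: wZ.
Qed.

Section with_constant.
Variable c : R.

(* First and second derivatives of the degree-one extension of [u - c]. *)
Definition gradV (k : 'I_n.+1) (y : E) : R :=
  (w y - c) * (y ord0 k * rpow 0 1 y) + enorm y * w1 k y.

Definition hessV (k j : 'I_n.+1) (y : E) : R :=
  w1 j y * (y ord0 k * rpow 0 1 y)
  + (w y - c) * ((k == j)%:R * rpow 0 1 y - y ord0 k * y ord0 j * rpow 0 3 y)
  + y ord0 j * rpow 0 1 y * w1 k y + enorm y * w2 k j y.

Lemma is_derive_enorm (y v : E) : y != 0 ->
  is_derive y v (@enorm R n.+1) (dotp y v * rpow 0 1 y).
Proof.
move=> y0; have r0 : 0 < rho 0 y by rewrite rho_gt0// y0 orbT.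
have -> : @enorm R n.+1 = rho 0 by apply/funext => z; rewrite rho0.
by rewrite /rpow expr1; exact: is_derive_rho.
Qed.

Lemma is_derive_gradV k j y : y != 0 -> is_derive y (d_ j) (gradV k) (hessV k j y).
Proof.
move=> y0; have r0 : 0 < rho 0 y by rewrite rho_gt0// y0 orbT.
have dw : is_derive y (d_ j) (fun y => w y - c) (w1 j y).
  have h : is_derive y (d_ j) w (w1 j y) by apply: derivableP; apply: diff_derivable; exact: w_diff.
  exact: (is_derive_eq (is_deriveB h (is_derive_cst c y (d_ j))) (subr0 _)).
have d1 := is_derive_mulr (is_derive_coord y (d_ j) k) (is_derive_rpow 1 (d_ j) r0) erefl.
have dw1 : is_derive y (d_ j) (w1 k) (w2 k j y).
  by apply: derivableP; apply: diff_derivable; exact: w1_diff.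
have d2 := is_derive_mulr dw d1 erefl.
have d3 := is_derive_mulr (is_derive_enorm (d_ j) y0) dw1 erefl.
refine (is_derive_eq (is_deriveD d2 d3) _).
rewrite /hessV !dotp_delta mxE eqxx/=.
move: (w y - c) (w1 j y) (w1 k y) (w2 k j y) (enorm y) (rpow 0 1 y) (rpow 0 3 y).
move: (y ord0 j) (y ord0 k) => *; ring.
Qed.

Lemma hessV_sym k j y : y != 0 -> hessV k j y = hessV j k y.
Proof. move=> y0; rewrite /hessV (w2_sym k j y0) (eq_sym k).
move: (w y - c) (w1 j y) (w1 k y) (w2 j k y) (enorm y) (rpow 0 1 y) (rpow 0 3 y).
move: (y ord0 j) (y ord0 k) => *; ring. Qed.

Lemma continuous_gradV k y : y != 0 -> {for y, continuous (gradV k)}.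
Proof.
move=> y0; have r0 : 0 < rho 0 y by rewrite rho_gt0// y0 orbT.
apply: continuousD; apply: continuousM.
- by apply: continuousB; [exact: w_cont|exact: cst_continuous].
- by apply: continuousM; [exact: coord_continuous|exact: continuous_rpow].
- exact: continuous_enorm.
- exact: w1_cont.
Qed.

Lemma continuous_hessV k j y : y != 0 -> {for y, continuous (hessV k j)}.
Proof.
move=> y0; have r0 : 0 < rho 0 y by rewrite rho_gt0// y0 orbT.
have cc i : {for y, continuous (fun y : E => y ord0 i)} by exact: coord_continuous.
have cr m : {for y, continuous (rpow 0 m : E -> R)} by exact: continuous_rpow.
apply: continuousD; last by apply: continuousM; [exact: continuous_enorm|exact: w2_cont].
apply: continuousD; last first.
  by apply: continuousM; [exact: continuousM|exact: w1_cont].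
apply: continuousD.
  by apply: continuousM; [exact: w1_cont|exact: continuousM].
apply: continuousM; first by apply: continuousB; [exact: w_cont|exact: cst_continuous].
apply: continuousB; first by apply: continuousM; [exact: cst_continuous|].
by apply: continuousM => //; exact: continuousM.
Qed.

Lemma rpowZ (l : R) m (y : E) : 0 < l -> rpow 0 m (l *: y) = l^-1 ^+ m * rpow 0 m y.
Proof. by move=> l0; rewrite /rpow !rho0 enormZ gtr0_norm// invfM exprMn. Qed.

Lemma gradVZ k (l : R) y : 0 < l -> y != 0 -> gradV k (l *: y) = gradV k y.
Proof.
move=> l0 y0; rewrite /gradV wZ// partial_ext0Z// rpowZ// enormZ gtr0_norm// mxE.
by field; rewrite gt_eqF.
Qed.

Lemma hessVZ k j (l : R) y : 0 < l -> y != 0 -> hessV k j (l *: y) = l^-1 * hessV k j y.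
Proof.
move=> l0 y0; rewrite /hessV wZ// !partial_ext0Z// w2Z// !rpowZ// enormZ gtr0_norm// !mxE.
have ln0 : l != 0 by rewrite gt_eqF.
move: (w y - c) (w1 j y) (w1 k y) (w2 k j y) (enorm y) (rpow 0 1 y) (rpow 0 3 y).
by move: (y ord0 j) (y ord0 k) => *; field.
Qed.

(** By the convention 0^-1 = 0, the Hessian formula also has a value at the origin; the trace
    identity then holds there too, and integrands can be rewritten everywhere. *)
Lemma hessV0 k j : hessV k j 0 = 0.
Proof.
have r m : rpow 0 m.+1 (0 : E) = 0.
  by rewrite /rpow rho0 (eqP (_ : enorm 0 == 0)) ?enorm_eq0// invr0 expr0n.
rewrite /hessV !r (eqP (_ : enorm (0 : E) == 0)) ?enorm_eq0// !mulr0 subrr !mulr0 !mul0r !addr0.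
by [].
Qed.

(** The first-order terms vanish by [euler], and the tangential projection delta_kj - y_k y_j has
    trace (n + 1) - 1 = n. *)
Lemma sum_hessV_sphere y : enorm y = 1 ->
  \sum_k hessV k k y = n%:R * (w y - c) + \sum_k w2 k k y.
Proof.
move=> y1; have y0 : y != 0 by rewrite -enorm_gt0 y1.
have r1 m : rpow 0 m y = 1 by rewrite /rpow rho0 y1 invr1 expr1n.
under eq_bigr do rewrite /hessV !r1 y1 eqxx !mulr1 mul1r.
rewrite 3!big_split/= -mulr_sumr sumrB sumr_const card_ord.
under eq_bigr do rewrite mulrC.
rewrite euler// -/(dotp y y) -enorm_sqr y1 expr1n add0r addr0 mulrC; congr (_ + _).
by congr (_ * _); rewrite -[1 *+ n.+1]/(n.+1%:R) -natr1 addrK.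
Qed.

(** Every term of [hessV] with a factor y_i or y_j drops out because [xi] is orthogonal to [y]. *)
Lemma quad_hessV_sphere (xi y : E) : enorm y = 1 -> dotp xi y = 0 ->
  \sum_i \sum_j xi ord0 i * xi ord0 j * hessV i j y =
  (w y - c) * dotp xi xi + \sum_i \sum_j xi ord0 i * xi ord0 j * w2 i j y.
Proof.
move=> y1 xy; have r1 m : rpow 0 m y = 1 by rewrite /rpow rho0 y1 invr1 expr1n.
rewrite dotpC in xy.
pose A := \sum_j xi ord0 j * w1 j y.
have inner i : \sum_j xi ord0 i * xi ord0 j * hessV i j y =
    y ord0 i * xi ord0 i * A + (w y - c) * (xi ord0 i * xi ord0 i)
    + \sum_j xi ord0 i * xi ord0 j * w2 i j y.
  transitivity (\sum_j (y ord0 i * xi ord0 i * (xi ord0 j * w1 j y)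
      + (w y - c) * xi ord0 i * ((i == j)%:R * xi ord0 j)
      + (xi ord0 i * w1 i y - (w y - c) * xi ord0 i * y ord0 i) * (y ord0 j * xi ord0 j)
      + xi ord0 i * xi ord0 j * w2 i j y)).
    apply: eq_bigr => j _; rewrite /hessV !r1 y1.
    move: (w y - c) (w1 j y) (w1 i y) (w2 i j y).
    by move: (y ord0 j) (y ord0 i) (xi ord0 i) (xi ord0 j) => *; ring.
  rewrite !big_split/= -!mulr_sumr -/A -/(dotp y xi) xy mulr0 addr0.
  rewrite (bigD1 i)//= eqxx mul1r big1 ?addr0 ?mulrA// => j ji.
  by rewrite eq_sym (negbTE ji) mul0r.
under eq_bigr do rewrite inner.
by rewrite !big_split/= -mulr_suml -mulr_sumr -/(dotp y xi) xy mul0r add0r.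
Qed.

End with_constant.
End sphere_function.

(** * The covariant Hessian in ambient coordinates *)

Section sphere_hessian.
Context (R : realType) (n : nat) (u : 'rV[R]_n.+1 -> R).
Hypothesis C2u : C2_sphere u.
Local Notation E := 'rV[R]_n.+1.
Local Notation d_ i := (delta_mx ord0 i : E).
Local Notation w1 i := ('D_(d_ i) (ext0 u)).
Local Notation w2 i j := ('D_(d_ j) (w1 i)).
Local Notation S := (ext0 (sgrad u)).

Lemma differentiable_row (V : normedModType R) (g : V -> E) (x : V) :
  (forall i, differentiable (fun y => g y ord0 i : R) x) -> differentiable g x.
Proof.
move=> dg; have -> : g = \sum_i (fun y => g y ord0 i *: d_ i).
  by apply/funext => y; rewrite fct_sumE [LHS]row_sum_delta.
by apply: differentiable_sum => i; exact: differentiableZl.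
Qed.

Lemma differentiable_enorm (y : E) : y != 0 -> differentiable (@enorm R n.+1) y.
Proof.
move=> y0.
have dd : differentiable (fun z : E => dotp z z) y.
  have -> : (fun z : E => dotp z z) =
      \sum_i ((fun z : E => z ord0 i : R) * (fun z : E => z ord0 i : R)).
    by apply/funext => z; rewrite fct_sumE.
  by apply: differentiable_sum => i; apply: differentiableM; exact: differentiable_coord.
apply: (@differentiable_comp _ _ _ _ (fun z : E => dotp z z) (@Num.sqrt R)) => //.
apply/derivable1_diffP; apply: (@ex_derive _ _ _ _ _ _ _ _).
by apply: is_derive1_sqrt; rewrite -enorm_sqr exprn_gt0// enorm_gt0.
Qed.

Lemma differentiable_sproj (y : E) : y != 0 -> differentiable (@sproj R n.+1) y.
Proof.
move=> y0; apply: differentiable_row => i.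
have -> : (fun z : E => sproj z ord0 i : R) =
    (fun z => (enorm z)^-1 * z ord0 i) by apply/funext => z; rewrite /sproj mxE.
apply: differentiableM; last exact: differentiable_coord.
by apply: differentiableV; [exact: differentiable_enorm|rewrite enorm_eq0].
Qed.

Lemma differentiable_sgrad (y : E) : y != 0 -> differentiable S y.
Proof.
move=> y0; apply: differentiable_row => i.
have -> : (fun z : E => S z ord0 i : R) = w1 i \o @sproj R n.+1.
  by apply/funext => z; rewrite /ext0 /sgrad /= mxE.
apply: differentiable_comp; first exact: differentiable_sproj.
have [_ h] := C2u; have [h1 _] := h (d_ i); apply: h1.
exact: sproj_neq0.
Qed.

(** First derivatives of [ext0 u] are homogeneous of degree -1, so the degree-0 extension of the
    gradient is |y| times the Euclidean gradient of [ext0 u]. Differentiating the factor |y| yields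
    the extra rank-one term. *)
Lemma jacobian_sgrad (x : E) : enorm x = 1 ->
  jacobian S x = \matrix_(j, i) (x ord0 j * w1 i x + w2 i j x).
Proof.
move=> x1; have x0 : x != 0 by rewrite -enorm_gt0 x1.
have dS := differentiable_sgrad x0.
apply/matrixP => j i; rewrite [RHS]mxE.
transitivity ((d_ j *m jacobian S x) ord0 i); first by rewrite -rowE [RHS]mxE.
rewrite -deriveEjacobian// derive_mx; last exact: diff_derivable.
rewrite mxE; apply: derive_val.
have dw : is_derive x (d_ j) (w1 i) (w2 i j x).
  apply: derivableP; apply: diff_derivable.
  by have [_ h] := C2u; have [h1 _] := h (d_ i); apply: h1.
have d := is_derive_mulr (is_derive_enorm (d_ j) x0) dw erefl.
apply: near_eq_is_derive (is_derive_eq d _).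
  apply: filterS (near_neq0 x0) => y y0.
  rewrite /ext0 /sgrad mxE -[in LHS](sprojK y0).
  rewrite (partial_ext0Z C2u); last 2 first.
  - by rewrite enorm_gt0.
  - exact: sproj_neq0.
  by rewrite (sprojK y0) mulVKf// enorm_eq0.
rewrite /rpow rho0 x1 invr1 expr1n mulr1 mul1r dotp_delta addrC; congr (_ + _); exact: mulrC.
Qed.

Lemma dotp_mulmx (x y : E) : (x *m y^T) = (dotp x y)%:M.
Proof.
apply/matrixP => i j; rewrite !ord1 !mxE eqxx mulr1n.
by apply: eq_bigr => k _; rewrite mxE.
Qed.

Lemma quad_shess (x xi : E) : enorm x = 1 -> dotp xi x = 0 ->
  dotp (xi *m shess u x) xi = \sum_i \sum_j xi ord0 i * xi ord0 j * w2 i j x.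
Proof.
move=> x1 xx.
have xP : xi *m tproj x = xi.
  by rewrite /tproj mulmxBr mulmx1 mulmxA dotp_mulmx xx mul_scalar_mx scale0r subr0.
have Px : tproj x *m xi^T = xi^T.
  by rewrite /tproj mulmxBl mul1mx -mulmxA dotp_mulmx dotpC xx mul_mx_scalar scale0r subr0.
have -> (a b : E) : dotp a b = (a *m b^T) ord0 ord0 by rewrite dotp_mulmx mxE mulr1n.
rewrite /shess !mulmxA xP -mulmxA Px (jacobian_sgrad x1) mxE.
under eq_bigr => i _ do rewrite 2!mxE mulr_suml.
transitivity (\sum_i (xi ord0 i * w1 i x * dotp xi x +
    \sum_j xi ord0 i * xi ord0 j * w2 i j x)).
  apply: eq_bigr => i _; rewrite /dotp mulr_sumr -big_split/=.
  by apply: eq_bigr => j _; rewrite !mxE; ring.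
by under eq_bigr do rewrite xx mulr0 add0r.
Qed.

(** The rows of the Jacobian combined by [x] give its radial derivative, which is 0 for a degree-0
    extension; hence both projections leave the trace unchanged. [euler] removes the rank-one term
    of [jacobian_sgrad]. *)
Lemma laplace_beltramiE (x : E) : enorm x = 1 ->
  laplace_beltrami u x = \sum_k w2 k k x.
Proof.
move=> x1; have x0 : x != 0 by rewrite -enorm_gt0 x1.
have xJ : x *m jacobian S x = 0.
  rewrite -deriveEjacobian; last exact: differentiable_sgrad.
  by apply: derive_radial0 => l l0; rewrite /ext0 sprojZ.
have PJ : tproj x *m jacobian S x = jacobian S x.
  by rewrite /tproj mulmxBl mul1mx -mulmxA xJ mulmx0 subr0.
rewrite /laplace_beltrami /shess PJ /tproj mulmxBr mulmx1 raddfB/= mulmxA.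
rewrite [X in _ - X]mxtrace_mulC mulmxA xJ mul0mx mxtrace0 subr0.
rewrite /mxtrace (jacobian_sgrad x1).
transitivity (\sum_k (x ord0 k * w1 k x + w2 k k x)).
  by apply: eq_bigr => k _; rewrite mxE.
by rewrite big_split/= euler// add0r.
Qed.

End sphere_hessian.

(** * Estimates on and near the sphere *)

Lemma bounded_on_sphere (R : realType) (n : nat) (g : 'rV[R]_n.+1 -> R) :
  (forall y, y != 0 -> {for y, continuous g}) ->
  exists C, forall y, enorm y = 1 -> `|g y| <= C.
Proof.
move=> cg; pose A : set 'rV[R]_n.+1 := [set y | enorm y = 1].
have A0 : A !=set0.
  by exists (delta_mx ord0 ord0); rewrite /A /=; exact: enorm_delta.
have cA : compact A.
  apply: bounded_closed_compact.
    exists 1; split; first exact: num_real.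
    move=> M M1 y /= y1; apply: le_trans (mx_norm_le_enorm y) _.
    by rewrite y1 ltW.
  apply: (@closed_comp _ _ (@enorm R n.+1) [set 1]).
    by move=> ? _; exact: continuous_enorm.
  exact: closed_eq.
have cgA : {within A, continuous (fun y => `|g y|)}.
  apply: continuous_in_subspaceT => y; rewrite inE /A/= => y1.
  have cy : g z @[z --> y] --> g y by apply: cg; rewrite -enorm_gt0 y1.
  exact: (cvg_norm cy).
have [c _ cC] := EVT_max_rV A0 cA cgA.
by exists `|g c| => y y1; apply: cC; rewrite inE.
Qed.

Lemma bounded_family_on_sphere (R : realType) (n : nat) (I : finType)
    (g : I -> 'rV[R]_n.+1 -> R) :
  (forall i y, y != 0 -> {for y, continuous (g i)}) ->
  exists2 C, 0 <= C & forall i y, enorm y = 1 -> `|g i y| <= C.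
Proof.
move=> cg; have [C hC] := choice (fun i => bounded_on_sphere (cg i)).
exists (\sum_i `|C i|); first by apply: sumr_ge0 => i _.
move=> i y y1; apply: (le_trans (hC i y y1)); apply: (le_trans (ler_norm _)).
by rewrite (bigD1 i)//= lerDl; apply: sumr_ge0 => j _.
Qed.

(** The projection moves [y] by | |y| - 1 |, which is at most |y - x| since |x| = 1. *)
Lemma enorm_sproj_sub_le (R : realType) (n : nat) (x y : 'rV[R]_n.+1) :
  enorm x = 1 -> enorm (y - x) <= 1 / 2 -> y != 0 ->
  (enorm y)^-1 <= 2 /\ enorm (sproj y - x) <= 2 * enorm (y - x).
Proof.
move=> x1 d y0; have ey : 0 < enorm y by rewrite enorm_gt0.
have x_le : 1 <= enorm (y - x) + enorm y.
  by rewrite -x1 enormB -[X in enorm X <= _](subrK y x) enormD.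
have y_le : enorm y <= enorm (y - x) + 1.
  by rewrite -x1 -[X in enorm X <= _](subrK x y) enormD.
split; first by rewrite invf_ple ?posrE//; lra.
have e : enorm (sproj y - y) <= enorm (y - x).
  rewrite -[X in _ - X](sprojK y0) -[X in X - _]scale1r -scalerBl enormZ enorm_sproj// mulr1.
  by rewrite ler_norml; apply/andP; split; lra.
have -> : sproj y - x = (sproj y - y) + (y - x) by rewrite addrA subrK.
by apply: (le_trans (enormD _ _)); lra.
Qed.

(** * The representation formula on the sphere and the convexity criterion *)

Section representation_formula.
Context (R : realType) (n : nat) (alpha : R) (f u : 'rV[R]_n.+1 -> R).
Hypotheses (n0 : (0 < n)%N) (alpha0 : 0 < alpha) (hf : holder_sphere alpha f)
  (C2u : C2_sphere u)
  (fE : forall x, unit_sphere x -> laplace_beltrami u x + n%:R * u x = f x).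
Variables (x xi : 'rV[R]_n.+1).
Hypotheses (x1 : enorm x = 1) (xi1 : enorm xi = 1) (xix : dotp xi x = 0).

Let x0 : x != 0. Proof. by rewrite -enorm_gt0 x1. Qed.
Let c := n%:R^-1 * f x.
Let nn0 : n%:R != 0 :> R. Proof. by rewrite pnatr_eq0 -lt0n. Qed.

Let hess_traceE y : \sum_k hessV u c k k y = extN1 f y - f x / enorm y.
Proof.
have [->|y0] := eqVneq y 0.
  have -> : enorm (0 : 'rV[R]_n.+1) = 0 by apply/eqP; rewrite enorm_eq0.
  rewrite /extN1 (_ : enorm (0 : 'rV[R]_n.+1) = 0); last by apply/eqP; rewrite enorm_eq0.
  rewrite invr0 mulr0 mul0r subr0 big1// => k _; exact: hessV0.
have p1 := enorm_sproj y0.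
rewrite -[in LHS](sprojK y0).
transitivity (\sum_k (enorm y)^-1 * hessV u c k k (sproj y)).
  by apply: eq_bigr => k _; rewrite hessVZ// ?enorm_gt0// sproj_neq0.
rewrite -mulr_sumr sum_hessV_sphere// -laplace_beltramiE// /ext0 sproj_id//.
rewrite /extN1 -(fE p1) /c mulrBr mulVKf//.
by move: (laplace_beltrami u _) (u _) (enorm y)^-1 (f x) => *; ring.
Qed.

Let hess_quadE : \sum_i \sum_j xi ord0 i * xi ord0 j * hessV u c i j x =
  dotp (xi *m shess u x) xi + u x * dotp xi xi - c.
Proof.
rewrite quad_hessV_sphere// quad_shess// /ext0 sproj_id// -enorm_sqr xi1.
by rewrite expr1n !mulr1 addrC addrA.
Qed.

(** The exponent is capped at 1/2 because [second_derivative_representation] takes one below 1;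
    within distance 1/2 of [x], lowering the exponent only weakens the bound. *)
Let hess_trace_le : exists C, forall y, y != 0 -> enorm (y - x) <= 1 / 2 ->
  `|\sum_k hessV u c k k y| <= C * enorm (y - x) `^ Num.min alpha (1 / 2).
Proof.
(* The factor 2 bounds 1/|y| and the power of 2 comes from the doubled distance in
   [enorm_sproj_sub_le]; the absolute value is there because the sign of the Hoelder constant is
   unknown. *)
have [C hC] := hf; exists (2 * (`|C| * 2 `^ alpha)) => y y0 yx.
have [yi sy] := enorm_sproj_sub_le x1 yx y0.
have d0 := enorm_ge0 (y - x).
rewrite hess_traceE /extN1 [f x / _]mulrC -mulrBr normrM ger0_norm ?invr_ge0 ?enorm_ge0//.
rewrite -mulrA; apply: ler_pM => //; first by rewrite invr_ge0 enorm_ge0.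
apply: (le_trans (hC _ _ (enorm_sproj y0) x1)).
rewrite -mulrA; apply: (le_trans (ler_norm _)); rewrite normrM.
apply: ler_wpM2l => //; rewrite ger0_norm ?powR_ge0//.
apply: (@le_trans _ _ ((2 * enorm (y - x)) `^ alpha)).
  by apply: ge0_ler_powR; rewrite ?nnegrE ?enorm_ge0 ?mulr_ge0// ltW.
rewrite powRM//; apply: ler_wpM2l; first exact: powR_ge0.
have [->|dn0] := eqVneq (enorm (y - x)) 0.
  by rewrite powR0 ?gt_eqF// powR_ge0.
apply: ger_powR; last by rewrite ge_min lexx.
by rewrite lt_neqAle eq_sym dn0 d0/=; lra.
Qed.

Lemma sphere_representation :
  (omega R n)^-1 *
    integral_rV (fun y : 'rV[R]_n.+1 =>
      (enorm (x - y) ^+ 2 - (n.+1)%:R * dotp xi y ^+ 2) /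
        enorm (x - y) ^+ (n.+3) *
      (extN1 f y - f x / enorm y))
  + n%:R^-1 * f x = dotp (xi *m shess u x) xi + u x * dotp xi xi.
Proof.
have [C1 C10 hC1] := bounded_family_on_sphere (fun k => @continuous_gradV _ _ _ C2u c k).
have [C2 C20 hC2] := bounded_family_on_sphere (g := fun ij : 'I_n.+1 * 'I_n.+1 => hessV u c ij.1 ij.2)
  (fun ij => @continuous_hessV _ _ _ C2u c ij.1 ij.2).
have BC k y : y != 0 -> `|gradV u c k y| <= C1 + C2.
  move=> y0; rewrite -(sprojK y0) gradVZ ?enorm_gt0// ?sproj_neq0//.
  by apply: (le_trans (hC1 k _ (enorm_sproj y0))); rewrite lerDl.
have HC k j y : y != 0 -> `|hessV u c k j y| <= (C1 + C2) / enorm y.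
  move=> y0; rewrite -[in leLHS](sprojK y0) hessVZ ?enorm_gt0// ?sproj_neq0//.
  rewrite normrM ger0_norm ?invr_ge0 ?enorm_ge0// mulrC.
  apply: ler_wpM2r; first by rewrite invr_ge0 enorm_ge0.
  by apply: (le_trans (hC2 (k, j) _ (enorm_sproj y0))); rewrite lerDr.
have [C' hC'] := hess_trace_le.
have a01 : 0 < Num.min alpha (1 / 2) < 1.
  by rewrite lt_min gt_min alpha0/=; apply/andP; split; [|apply/orP; right]; lra.
have r0 : (0 : R) < 1 / 2 by lra.
have n1 : (1 < n.+1)%N by [].
have := second_derivative_representation n1 xi x0
  (fun k j y => @is_derive_gradV _ _ _ C2u c k j y)
  (fun k y => @continuous_gradV _ _ _ C2u c k y)
  (fun k j y => @continuous_hessV _ _ _ C2u c k j y)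
  (fun k j y => @hessV_sym _ _ _ C2u c k j y) BC HC r0 a01 hC'.
rewrite hess_quadE -omegaE// => I.
rewrite [integral_rV _](_ : _ = omega R n * (dotp (xi *m shess u x) xi + u x * dotp xi xi - c)).
  rewrite mulKf ?subrK//.
  have /andP[v0 voo] := unit_ball_vol_pos R n1.
  rewrite omegaE// mulf_neq0 ?pnatr_eq0// gt_eqF//.
  by rewrite /unit_ball_vol fine_gt0// v0.
rewrite -I; congr integral_rV; apply/funext => y; rewrite hess_traceE; congr (_ * _).
rewrite /aker /rpow rho0 enormB -enorm_sqr xi1 expr1n mul1r.
(* Tangency of [xi] turns the translated kernel into the one of the statement, where [xi] is paired
   with [y] alone. *)
have -> : dotp (y - x) xi = dotp xi y.
  by rewrite dotpDl dotpNl [dotp x xi]dotpC xix subr0 dotpC.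
set d := enorm (y - x).
(* At y = x both kernels are 0 by the convention 0^-1 = 0. *)
have [->|d0] := eqVneq d 0; first by rewrite invr0 !expr0n/= !mulr0 subr0 invr0 mulr0.
rewrite mulrBl !exprVn; congr (_ - _); last by rewrite expr2 !mulrA.
by rewrite (exprD d 2 n.+1) invfM mulrA mulfV ?mul1r// expf_neq0.
Qed.

End representation_formula.

Theorem theorem3p1 (R : realType) (n : nat) (alpha : R)
    (f u : 'rV[R]_n.+1 -> R) :
  (2 <= n)%N ->
  0 < alpha ->
  holder_sphere alpha f ->
  (forall x, unit_sphere x -> 0 < f x) ->
  C2_sphere u ->
  (forall x, unit_sphere x -> laplace_beltrami u x + n%:R * u x = f x) ->
  sphere_convex u <->
  (forall x xi : 'rV[R]_n.+1, unit_sphere x -> unit_sphere xi ->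
     dotp xi x = 0 ->
     0 <= (omega R n)^-1 *
          integral_rV (fun y : 'rV[R]_n.+1 =>
            (enorm (x - y) ^+ 2 - (n.+1)%:R * dotp xi y ^+ 2) /
              enorm (x - y) ^+ (n.+3) *
            (extN1 f y - f x / enorm y))
          + n%:R^-1 * f x).
Proof.
move=> n2 alpha0 hf _ C2u fE; have n0 : (0 < n)%N := ltnW n2.
have rep := sphere_representation n0 alpha0 hf C2u fE.
split=> [cu x xi Sx Sxi xix|H x xi Sx xix]; first by rewrite rep//; exact: cu.
have [->|xi0] := eqVneq xi 0.
  by rewrite mul0mx !dotp0l mulr0 addr0.
have e0 : 0 < enorm xi by rewrite enorm_gt0.
have Sp := enorm_sproj xi0.
have px : dotp (sproj xi) x = 0 by rewrite /sproj dotpZl xix mulr0.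
have := H x _ Sx Sp px; rewrite (rep _ _ Sx Sp px) => h.
(* Both terms of the form are quadratic in [xi]: with [xi] written as [r *: p], [p] a unit vector,
   the form gains the factor r^2. *)
move: (sproj xi) (enorm xi) (sprojK xi0) e0 h => p r <- r0 h.
rewrite -scalemxAl !dotpZl !dotpZr.
rewrite [_ + _](_ : _ = r ^+ 2 * (dotp (p *m shess u x) p + u x * dotp p p)).
  by rewrite mulr_ge0// sqr_ge0.
by move: (dotp _ _) (dotp _ _) => *; ring.
Qed.
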